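(* Let $b$ be a connected graph over $X$, let $q:X\to\mathbb{R}$ be a potential such that $h\ge0$ on $C_c(X)$, and let $o\in X$. Then the following assertions are equivalent: (i) $h$ is subcritical in $X$. (ii) $0<\lim_{\lambda\nearrow0}(H^{(1)}-\lambda)^{-1}1_{\{x\}}(y)<\infty$ for some (equivalently, all) $x,y\in X$. (ii') $0<\int_0^\infty e^{-tH^{(1)}}1_{\{x\}}(y)\,\mathrm{d}t<\infty$ for some (equivalently, all) $x,y\in X$. (iii) For every vertex $x\in X$ there exists a positive $H$-superharmonic function $u$ such that $Hu=1_{\{x\}}$ in $X$. (iii') There are infinitely many linearly independent positive $H$-superharmonic functions in $X$. (iv) The norms $\overline h(\cdot)^{1/2}$ and $\|\cdot\|_{h,o}$ are equivalent on $D_{h,o}$. In particular, $(D_{h,o},\overline h)$ is a Hilbert space. (iv') There is no positive $H$-harmonic function in $D_{h,o}$. (v) $\mathrm{cap}_h(\{x\}):=\inf\{h(\varphi)\mid\varphi\in C_c(X),\ \varphi(x)=1\}>0$ for all $x\in X$.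
   Context: $X$ is an infinite set with the discrete topology. A graph over $X$ is a symmetric function $b:X\times X\to[0,\infty)$ with zero diagonal such that $\sum_{y\in X}b(x,y)<\infty$ for all $x\in X$; it is connected if any two vertices are joined by a finite path $x_0,\dots,x_n$ with $b(x_i,x_{i+1})>0$. $C(X)$ is the space of real valued functions on $X$ and $C_c(X)$ the subspace of finitely supported functions. Let $F(X)=\{f\in C(X)\mid \sum_{y}b(x,y)|f(y)|<\infty \text{ for all } x\in X\}$, and for $f\in F(X)$ let $Hf(x)=\sum_{y}b(x,y)(f(x)-f(y))+q(x)f(x)$. The form $h$ on $C_c(X)$ is $h(\varphi)=\frac12\sum_{x,y}b(x,y)(\varphi(x)-\varphi(y))^2+\sum_x q(x)\varphi(x)^2$; $h\ge0$ on $C_c(X)$ means $h(\varphi)\ge0$ for all $\varphi\in C_c(X)$. A function $f$ is called positive if $f\ge0$ and $f\ne0$. A function $u\in F(X)$ is $H$-harmonic (resp. $H$-superharmonic) in $X$ if $Hu=0$ (resp. $Hu\ge0$) on $X$. If $h\ge0$ on $C_c(X)$, then $h$ is closable in $\ell^2(X)$ (counting measure), and $H^{(1)}$ denotes the nonnegative selfadjoint operator in $\ell^2(X)$ associated with its closure. The form $h\ge0$ is subcritical in $X$ if there is a positive $w\in C(X)$ with $h(\varphi)\ge\sum_x w(x)\varphi(x)^2$ for all $\varphi\in C_c(X)$. For $o\in X$ let $\|\varphi\|_{h,o}=\sqrt{h(\varphi)+\varphi(o)^2}$, which is a norm on $C_c(X)$; convergence in it implies pointwise convergence. $D_{h,o}\subset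 C(X)$ is the completion of $C_c(X)$ with respect to $\|\cdot\|_{h,o}$, realized as a function space: it consists of the pointwise limits of $\|\cdot\|_{h,o}$-Cauchy sequences in $C_c(X)$. For $f\in D_{h,o}$ the limit of such a sequence $(\varphi_n)$, $\overline h(f)=\lim_n h(\varphi_n)$; by polarization $\overline h$ is a bilinear form on $D_{h,o}$, and $\|f\|_{h,o}=\sqrt{\overline h(f)+f(o)^2}$ on $D_{h,o}$. *)

(* Defs.v *)
From HB Require Import structures.
From mathcomp Require Import all_boot all_order all_algebra.
From mathcomp Require Import all_classical all_reals all_analysis.

Set Implicit Arguments.
Unset Strict Implicit.
Unset Printing Implicit Defensive.

Import Order.TTheory GRing.Theory Num.Theory.
Import numFieldNormedType.Exports.

Local Open Scope classical_set_scope.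
Local Open Scope ring_scope.

Section Spaces.
Context {R : realType} {X : choiceType}.
Implicit Types f g u : X -> R.

(* Sum of a real family over [X]; it is the usual sum as soon as the family is
   absolutely summable (the only case in which it is used). *)
Definition rsum f : R :=
  fine (\esum_(x in [set: X]) ((EFin \o f)^\+ x)%E)
  - fine (\esum_(x in [set: X]) ((EFin \o f)^\- x)%E).

Definition positive f : Prop := (forall x, 0 <= f x) /\ (exists x, f x != 0).

Definition Cc : set (X -> R) := [set f | finite_set [set x | f x != 0]].

Definition ell2 : set (X -> R) :=
  [set f | (\esum_(x in [set: X]) (f x ^+ 2)%:E < +oo)%E].

Definition ell2_dot f g : R := rsum (fun x => f x * g x).

Definition ell2_norm f : R := Num.sqrt (ell2_dot f f).

Definition cauchy_for (N : (X -> R) -> R) (u : nat -> X -> R) : Prop :=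
  forall e : R, 0 < e -> exists k : nat, forall m n : nat,
    (k <= m)%N -> (k <= n)%N -> N (u m - u n) < e.

Definition pointwise_cvg (u : nat -> X -> R) f : Prop :=
  forall x, u n x @[n --> \oo] --> f x.

Definition polar (Q : (X -> R) -> R) f g : R := (Q (f + g) - Q (f - g)) / 4.

Definition lin_indep_seq (u : nat -> X -> R) : Prop :=
  forall (n : nat) (c : 'I_n -> R),
    (forall x, \sum_(i < n) c i * u i x = 0) -> forall i, c i = 0.

Definition equivalent_norms (D : set (X -> R)) (N1 N2 : (X -> R) -> R) : Prop :=
  exists c C : R, [/\ 0 < c, 0 < C &
    forall f, D f -> c * N2 f <= N1 f /\ N1 f <= C * N2 f].

Definition is_hilbert (D : set (X -> R)) (B : (X -> R) -> (X -> R) -> R) : Prop :=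
  [/\ D 0 /\
      (forall (a : R) f g, D f -> D g -> D (fun x => a * f x + g x)),
      (forall (a : R) f g u, D f -> D g -> D u ->
         B (fun x => a * f x + g x) u = a * B f u + B g u),
      (forall f g, D f -> D g -> B f g = B g f),
      (forall f, D f -> 0 <= B f f /\ (B f f = 0 -> f = 0)) &
      (forall u : nat -> X -> R, (forall n, D (u n)) ->
         cauchy_for (fun f => Num.sqrt (B f f)) u ->
         exists2 f, D f &
           Num.sqrt (B (u n - f) (u n - f)) @[n --> \oo] --> (0 : R))].

(* A linear operator in [ell2] is given by its graph: [A f g] means that [f] is
   in the domain of [A] and that [A f = g]. *)
Definition operator := (X -> R) -> (X -> R) -> Prop.

(* (A - l)^-1 f: the u in the domain of [A] with A u - l u = f, unique when [l]
   is in the resolvent set. *)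
Definition resolvent (A : operator) (l : R) f : X -> R :=
  xget 0 [set u | exists2 v, A u v & f = (fun x => v x - l * u x)].

Definition C0_semigroup (S : R -> (X -> R) -> (X -> R)) : Prop :=
  [/\ (forall t, 0 <= t ->
         [/\ forall f, ell2 f -> ell2 (S t f),
             forall (a : R) f g, ell2 f -> ell2 g ->
               S t (fun x => a * f x + g x) = (fun x => a * S t f x + S t g x) &
             exists M : R, forall f, ell2 f ->
               ell2_norm (S t f) <= M * ell2_norm f]),
      (forall f, ell2 f -> S 0 f = f),
      (forall s t f, 0 <= s -> 0 <= t -> ell2 f -> S (s + t) f = S s (S t f)) &
      (forall f, ell2 f -> ell2_norm (S t f - f) @[t --> 0^'+] --> (0 : R))].

(* [- A] is the infinitesimal generator of [S], domain included. *)
Definition generated_by_opp (A : operator) (S : R -> (X -> R) -> (X -> R)) : Prop :=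
  forall f g, A f g <->
    [/\ ell2 f, ell2 g &
        ell2_norm (fun x => t^-1 * (f x - S t f x) - g x) @[t --> 0^'+]
          --> (0 : R)].

(* The semigroup e^{-tA}; a C0-semigroup is determined by its generator, so that
   the values on [ell2] at times [t >= 0] do not depend on the choice. *)
Definition semigroup (A : operator) : R -> (X -> R) -> (X -> R) :=
  xget (fun _ _ => 0) [set S | C0_semigroup S /\ generated_by_opp A S].

End Spaces.

Section Graph.
Context {R : realType} {X : choiceType}.
Variables (b : X -> X -> R) (q : X -> R).
Implicit Types f g u : X -> R.

Definition is_graph : Prop :=
  [/\ forall x y, 0 <= b x y,
      forall x y, b x y = b y x,
      forall x, b x x = 0 &
      forall x, (\esum_(y in [set: X]) (b x y)%:E < +oo)%E].

Definition connected_graph : Prop :=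
  forall x y, exists s : seq X, path (fun z w => 0 < b z w) x s /\ last x s = y.

Definition Fspace : set (X -> R) :=
  [set f | forall x, (\esum_(y in [set: X]) (b x y * `|f y|)%:E < +oo)%E].

Definition Hop f : X -> R :=
  fun x => rsum (fun y => b x y * (f x - f y)) + q x * f x.

Definition H_harmonic u : Prop := Fspace u /\ forall x, Hop u x = 0.

Definition H_superharmonic u : Prop := Fspace u /\ forall x, 0 <= Hop u x.

(* Meaningful on [Cc] only: elsewhere [fine] and the finite-support sum may take
   junk values. *)
Definition hform (phi : X -> R) : R :=
  2^-1 * fine (\esum_(p in [set: X * X])
                 (b p.1 p.2 * (phi p.1 - phi p.2) ^+ 2)%:E)
  + \sum_(x \in [set: X]) q x * phi x ^+ 2.

Definition hform_ge0 : Prop := forall phi : X -> R, Cc phi -> 0 <= hform phi.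

Definition subcritical : Prop :=
  exists2 w : X -> R, positive w &
    forall phi : X -> R, Cc phi -> rsum (fun x => w x * phi x ^+ 2) <= hform phi.

Definition capacity (x : X) : R :=
  inf [set hform phi | phi in [set phi | Cc phi /\ phi x = 1]].

Definition closure_approx f (phi : nat -> X -> R) : Prop :=
  [/\ ell2 f, forall n, Cc (phi n),
      ell2_norm (phi n - f) @[n --> \oo] --> (0 : R) &
      cauchy_for hform phi].

Definition closure_dom : set (X -> R) :=
  [set f | exists phi, closure_approx f phi].

(* The limit does not depend on the approximating sequence, by closability. *)
Definition closure_form f : R :=
  xget 0 [set l | exists2 phi, closure_approx f phi &
                    hform (phi n) @[n --> \oo] --> l].

(* The operator of the closed form Q = [closure_form]: f is in the domain and
   H1 f = g iff Q(f, v) = <g, v> for all v in the form domain. *)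
Definition H1 : operator := fun f g =>
  [/\ closure_dom f, ell2 g &
      forall v, closure_dom v -> polar closure_form f v = ell2_dot g v].

Variable o : X.

Definition honorm (phi : X -> R) : R := Num.sqrt (hform phi + phi o ^+ 2).

Definition Dho_approx f (phi : nat -> X -> R) : Prop :=
  [/\ forall n, Cc (phi n), cauchy_for honorm phi & pointwise_cvg phi f].

Definition Dho : set (X -> R) := [set f | exists phi, Dho_approx f phi].

(* The limit does not depend on the sequence, [honorm] being a norm on [Cc] whose
   completion embeds into functions. *)
Definition hbar f : R :=
  xget 0 [set l | exists2 phi, Dho_approx f phi &
                    hform (phi n) @[n --> \oo] --> l].

Definition hbar_norm f : R := Num.sqrt (hbar f + f o ^+ 2).

End Graph.

(* Main.v *)
(* Every condition is shown to be equivalent to the boundedness of all point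
   evaluations on C_c(X): phi(x)^2 <= C_x h(phi).

   Cauchy-Schwarz for |phi| and 1_x, with h(|phi|) <= h(phi), bounds
   sum_y b(x,y) |phi(y)| by |phi(x)| and h(phi)^(1/2). Following paths, one
   bounded evaluation makes all of them bounded, D_{h,o} is a function space,
   h is closable, and H passes to limits. If evaluations are bounded, minimising
   h(phi) - 2 phi(x) over nonnegative phi yields the Green function, and the
   completion has no nonzero harmonic function. If they are not, there are
   phi_n >= 0 with phi_n(o) = 1 and h(phi_n) -> 0; the limit is a positive
   harmonic function in D_{h,o}, and comparing phi_n / u at adjacent vertices
   shows that phi_n -> u / u(o) for every positive superharmonic u, so that all
   of these are proportional.

   For l > 0 the same theory applied to the potential q + l describes the form
   domain in l^2 and the resolvent at -l, which increases as l decreases to 0.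
   The semigroup is the limit of implicit Euler schemes (1 + (t/2^k) H)^(-2^k);
   it preserves positivity, and its Laplace transform is the resolvent, so that
   monotone convergence identifies its time integral with the limit of the
   resolvents at 0. The uniqueness of a C0-semigroup with a given generator makes
   this apply to the semigroup of the statement. *)
Require Import Defs.
From HB Require Import structures.
From mathcomp Require Import all_boot all_order all_algebra.
From mathcomp Require Import finmap.
From mathcomp Require Import all_classical all_reals all_analysis.
From mathcomp Require Import measurable_realfun ring lra.

Set Implicit Arguments.
Unset Strict Implicit.
Unset Printing Implicit Defensive.

Import Order.TTheory GRing.Theory Num.Theory.
Import numFieldNormedType.Exports.

Local Open Scope classical_set_scope.
Local Open Scope ring_scope.

(** * Sums over X *)

(** The obstacle is that for a critical [h] the completion of [C_c(X)] for [h] alone is not a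
    function space, while (iv) and (iv') still speak of limits in that case. The completion is
    therefore built once, for an arbitrary potential whose point evaluations are bounded, and used
    for three potentials: [q] itself when [h] is subcritical, [q + l] with l > 0, and [q + 1_o],
    whose form is the square of the norm defining [D_{h,o}]. The last two always have bounded
    evaluations.

    No integration by parts beyond finite support is used: [h(phi, f)] is taken to be the sum of
    [phi H f], with [phi] finitely supported and [f] in [F(X)]. Positivity comes from absolute
    values of minimising sequences rather than from a maximum principle.

    One pair (x, y) suffices in (ii) and (ii') because the resolvent kernel is a reproducing kernel:
    a bound on its value at (x, y) gives one at (x, x) by a Harnack inequality uniform for l <= 1,
    and its value at (x, x) bounds [phi(x)^2] by a multiple of [h(phi) + l |phi|^2]. *)

Section RealSequences.
Context {R : realType}.

Lemma cvg_fsum {T : Type} {F : set_system T} {FF : Filter F} (I : Type)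
    (r : seq I) (u : T -> I -> R) (l : I -> R) :
  (forall i, u t i @[t --> F] --> l i) ->
  \sum_(i <- r) u t i @[t --> F] --> \sum_(i <- r) l i.
Proof.
move=> ul; elim: r => [|i r IH].
  under eq_cvg do rewrite big_nil.
  by rewrite big_nil; exact: cvg_cst.
under eq_cvg do rewrite big_cons.
by rewrite big_cons; apply: cvgD.
Qed.

Lemma cvgr_epsP {V : normedModType R} (u : nat -> V) (l : V) :
  u n @[n --> \oo] --> l <->
  forall e : R, 0 < e -> exists k, forall n, (k <= n)%N -> `|u n - l| < e.
Proof.
split=> [/cvgrPdistC_lt ul e e0|ul].
  by have [k _ kP] := ul e e0; exists k => n kn; exact: kP.
apply/cvgrPdistC_lt => e e0; have [k kP] := ul e e0.
by exists k => // n /= kn; exact: kP.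
Qed.

Lemma cauchy_seq_cvg {V : completeNormedModType R} (u : nat -> V) :
  (forall e : R, 0 < e -> exists k, forall m n, (k <= m)%N -> (k <= n)%N ->
     `|u m - u n| < e) -> exists l : V, u n @[n --> \oo] --> l.
Proof.
move=> uc; apply/cvg_ex/cauchy_cvgP/cauchy_ballP => e e0.
have [k kP] := uc e e0.
exists (u @` [set n | (k <= n)%N], u @` [set n | (k <= n)%N]).
  by split; exists k => // n /= kn; exists n.
move=> [_ _] /= [[m /= km <-] [n /= kn <-]].
by rewrite -ball_normE /=; exact: kP.
Qed.

Lemma harmonic_small (e : R) : 0 < e ->
  exists k, forall n, (k <= n)%N -> n.+1%:R^-1 < e.
Proof.
move=> e0; have := @cvg_harmonic R => /cvgr_epsP /(_ e e0) [k kP].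
by exists k => n /kP; rewrite subr0 ger0_norm// invr_ge0.
Qed.

End RealSequences.

Section Summation.
Context {R : realType} {X : choiceType}.
Implicit Types f g : X -> R.

Definition abs_summable f : Prop := summable [set: X] (EFin \o f).

Lemma abs_summableE f :
  abs_summable f <-> (\esum_(x in [set: X]) (`|f x|)%:E < +oo)%E.
Proof. by []. Qed.

Lemma esum_fset_le f (M : R) : (forall x, 0 <= f x) ->
  (forall K : {fset X}, \sum_(x <- K) f x <= M) ->
  (\esum_(x in [set: X]) (f x)%:E <= M%:E)%E.
Proof.
move=> f0 fM; apply: ge_ereal_sup => _ [A [Afin _] <-].
rewrite fsbig_finite//= sumEFin lee_fin; exact: fM.
Qed.

Lemma fsum_le_esum f (K : {fset X}) : (forall x, 0 <= f x) ->
  ((\sum_(x <- K) f x)%:E <= \esum_(x in [set: X]) (f x)%:E)%E.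
Proof.
move=> f0; apply: esum_ge; exists [set` K]; first by split.
by rewrite fsbig_finite//= set_fsetK -sumEFin.
Qed.

Lemma abs_summableP f :
  abs_summable f <-> exists M, forall K : {fset X}, \sum_(x <- K) `|f x| <= M.
Proof.
split=> [/abs_summableE fs|[M fM]]; last first.
  apply/abs_summableE; apply: le_lt_trans (ltry M).
  by apply: esum_fset_le.
exists (fine (\esum_(x in [set: X]) (`|f x|)%:E)) => K.
rewrite -lee_fin fineK; first exact: fsum_le_esum.
by rewrite ge0_fin_numE// esum_ge0// => x _; rewrite lee_fin.
Qed.

Lemma abs_summable_le f g : abs_summable g -> (forall x, `|f x| <= `|g x|) ->
  abs_summable f.
Proof.
move=> /abs_summableE gs fg; apply/abs_summableE; apply: le_lt_trans gs.
by apply: le_esum => x _; rewrite lee_fin.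
Qed.

Lemma abs_summable_norm f : abs_summable f -> abs_summable (fun x => `|f x|).
Proof. by move=> /abs_summable_le; apply => x; rewrite normr_id. Qed.

Lemma abs_summableD f g : abs_summable f -> abs_summable g ->
  abs_summable (fun x => f x + g x).
Proof. exact: summableD. Qed.

Lemma abs_summableZ a f : abs_summable f -> abs_summable (fun x => a * f x).
Proof.
move=> /abs_summableP[M fM]; apply/abs_summableP; exists (`|a| * M) => K.
under eq_bigr do rewrite normrM.
by rewrite -mulr_sumr ler_wpM2l.
Qed.

Lemma abs_summableB f g : abs_summable f -> abs_summable g ->
  abs_summable (fun x => f x - g x).
Proof.
move=> fs gs; under eq_fun do rewrite -mulN1r.
by apply: abs_summableD => //; exact: abs_summableZ.
Qed.

Lemma abs_summable_fin f (K : {fset X}) :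
  (forall x, x \notin K -> f x = 0) -> abs_summable f.
Proof.
move=> fK; apply/abs_summableE.
rewrite (_ : esum _ _ = (\esum_(x in [set` K]) (`|f x|)%:E)%E); last first.
  rewrite [RHS]esum_mkcond; apply: eq_esum => x _; case: ifPn => //.
  by rewrite mem_setE => /fK ->; rewrite normr0.
by rewrite esum_fset//= fsbig_finite//= sumEFin ltry.
Qed.

Lemma rsum_ge0E f : (forall x, 0 <= f x) ->
  rsum f = fine (\esum_(x in [set: X]) (f x)%:E).
Proof.
move=> f0; rewrite /rsum [X in _ - fine X]esum1 ?subr0/=; last first.
  by move=> x _; rewrite funenegE/=; apply/max_idPr; rewrite lee_fin oppr_le0.
congr fine; apply: eq_esum => x _; rewrite funeposE/=; apply/max_idPl.
by rewrite lee_fin.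
Qed.

Lemma rsum_EFin f : (forall x, 0 <= f x) -> abs_summable f ->
  (rsum f)%:E = (\esum_(x in [set: X]) (f x)%:E)%E.
Proof.
move=> f0 fs; rewrite rsum_ge0E// fineK// ge0_fin_numE//; last first.
  by apply: esum_ge0 => x _; rewrite lee_fin.
move/abs_summableE : fs; congr (_ < _)%E.
by apply: eq_esum => x _; rewrite ger0_norm.
Qed.

Lemma rsum_ge0 f : (forall x, 0 <= f x) -> 0 <= rsum f.
Proof.
move=> f0; rewrite rsum_ge0E// fine_ge0// esum_ge0// => x _.
by rewrite lee_fin.
Qed.

Lemma fsum_le_rsum f (K : {fset X}) : (forall x, 0 <= f x) -> abs_summable f ->
  \sum_(x <- K) f x <= rsum f.
Proof. by move=> f0 fs; rewrite -lee_fin rsum_EFin//; exact: fsum_le_esum. Qed.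

Lemma le_rsum1 f x : (forall x, 0 <= f x) -> abs_summable f -> f x <= rsum f.
Proof.
by move=> f0 /(fsum_le_rsum [fset x]%fset f0); rewrite big_seq_fset1.
Qed.

Lemma rsum_le_bound f M : (forall x, 0 <= f x) ->
  (forall K : {fset X}, \sum_(x <- K) f x <= M) -> abs_summable f /\ rsum f <= M.
Proof.
move=> f0 fM; have fs : abs_summable f.
  by apply/abs_summableP; exists M => K; under eq_bigr do rewrite ger0_norm//.
by split=> //; rewrite -lee_fin rsum_EFin//; exact: esum_fset_le.
Qed.

(** [rsum] is defined through positive and negative parts, exactly the form in which [esumB]
    expresses a difference of nonnegative families. Linearity of [rsum] is derived from this
    case. *)
Lemma rsumB_ge0 f g : (forall x, 0 <= f x) -> (forall x, 0 <= g x) ->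
  abs_summable f -> abs_summable g ->
  rsum (fun x => f x - g x) = rsum f - rsum g.
Proof.
move=> f0 g0 fs gs.
have fin (h : X -> R) : (forall x, 0 <= h x) -> abs_summable h ->
  (\esum_(x in [set: X]) (h x)%:E)%E \is a fin_num.
  by move=> h0 hs; rewrite -rsum_EFin.
have pos (h k : X -> R) : (forall x, 0 <= h x) -> (forall x, 0 <= k x) ->
    abs_summable h -> abs_summable k ->
    (\esum_(x in [set: X]) ((EFin \o h) \- (EFin \o k))^\+ x)%E \is a fin_num.
  move=> h0 k0 hs ks.
  rewrite (_ : esum _ _ = (\esum_(x in [set: X]) (Num.max (h x - k x) 0)%:E)%E).
    apply: fin => [x|]; first by rewrite le_max lexx orbT.
    apply: (abs_summable_le hs) => x; rewrite ger0_norm ?le_max ?lexx ?orbT//.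
    by rewrite ger0_norm// ge_max h0 andbT gerBl.
  by apply: eq_esum => x _; rewrite funeposE/= EFin_max.
have := @esumB R X setT (EFin \o f) (EFin \o g) fs gs
  (fun x _ => f0 x) (fun x _ => g0 x).
move=> /(congr1 fine); rewrite !fineB/=; last 4 first.
- exact: fin.
- exact: fin.
- exact: pos.
- rewrite (_ : esum _ _ = (\esum_(x in [set: X])
    ((EFin \o g) \- (EFin \o f))^\+ x)%E); first exact: pos.
  apply: eq_esum => x _; rewrite funenegE funeposE/=.
  by rewrite opprB.
by rewrite -!rsum_ge0E// => <-.
Qed.

Let pos f x := Num.max (f x) 0.
Let neg f x := Num.max (- f x) 0.

Let posneg f x : f x = pos f x - neg f x.
Proof. by rewrite /pos /neg; do 2 case: ltP => ?; lra. Qed.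

Let pos_ge0 f x : 0 <= pos f x.
Proof. by rewrite le_max lexx orbT. Qed.

Let neg_ge0 f x : 0 <= neg f x.
Proof. by rewrite le_max lexx orbT. Qed.

Let pos_sum f : abs_summable f -> abs_summable (pos f).
Proof.
move=> /abs_summable_le; apply => x; rewrite ger0_norm//.
by rewrite /pos ge_max normr_ge0 ler_norm.
Qed.

Let neg_sum f : abs_summable f -> abs_summable (neg f).
Proof.
move=> /abs_summable_le; apply => x; rewrite ger0_norm//.
by rewrite /neg ge_max normr_ge0 -normrN ler_norm.
Qed.

Lemma rsumD_ge0 f g : (forall x, 0 <= f x) -> (forall x, 0 <= g x) ->
  abs_summable f -> abs_summable g ->
  rsum (fun x => f x + g x) = rsum f + rsum g.
Proof.
move=> f0 g0 fs gs; apply: EFin_inj; rewrite [RHS]EFinD !rsum_EFin//.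
- by rewrite -esumD// => x _; rewrite lee_fin.
- by move=> x; exact: addr_ge0.
- exact: abs_summableD.
Qed.

Lemma rsumD f g : abs_summable f -> abs_summable g ->
  rsum (fun x => f x + g x) = rsum f + rsum g.
Proof.
move=> fs gs.
rewrite (_ : (fun _ => _) =
    (fun x => (pos f x + pos g x) - (neg f x + neg g x))); last first.
  by apply/funext => x; rewrite {1}(posneg f) {1}(posneg g); lra.
rewrite rsumB_ge0; last 4 first.
- by move=> x; exact: addr_ge0.
- by move=> x; exact: addr_ge0.
- by apply: abs_summableD; exact: pos_sum.
- by apply: abs_summableD; exact: neg_sum.
rewrite !rsumD_ge0//; [|exact: neg_sum|exact: neg_sum|exact: pos_sum|
  exact: pos_sum].
rewrite [in RHS](_ : f = fun x => pos f x - neg f x); last exact/funext.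
rewrite [in RHS](_ : g = fun x => pos g x - neg g x); last exact/funext.
rewrite !rsumB_ge0//; [lra|exact: pos_sum|exact: neg_sum|exact: pos_sum|
  exact: neg_sum].
Qed.

Lemma rsumZ a f : abs_summable f -> rsum (fun x => a * f x) = a * rsum f.
Proof.
have ge0 (c : R) (g : X -> R) : 0 <= c -> (forall x, 0 <= g x) -> abs_summable g ->
    rsum (fun x => c * g x) = c * rsum g.
  move=> c0 g0 gs.
  have le (d : R) (h : X -> R) : 0 < d -> (forall x, 0 <= h x) -> abs_summable h ->
      rsum (fun x => d * h x) <= d * rsum h.
    move=> d0 h0 hs; apply: (proj2 (rsum_le_bound _ _)) => [x|K].
      by rewrite mulr_ge0// ltW.
    by rewrite -mulr_sumr ler_wpM2l ?(ltW d0)//; exact: fsum_le_rsum.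
  have [->|cn0] := eqVneq c 0.
    rewrite mul0r (_ : (fun _ => _) = (fun x => g x - g x)) ?rsumB_ge0 ?subrr//.
    by apply/funext => x; rewrite mul0r subrr.
  have cp : 0 < c by rewrite lt_neqAle eq_sym cn0.
  (* The reverse inequality is [le] for the factor [c^-1] and the family [c * g]. *)
  apply/eqP; rewrite eq_le le//= mulrC -ler_pdivlMr// mulrC.
  rewrite -[in leLHS](_ : (fun x => c^-1 * (c * g x)) = g).
    apply: le => [|x|]; [by rewrite invr_gt0|by rewrite mulr_ge0|].
    exact: abs_summableZ.
  by apply/funext => x; rewrite mulrA mulVf ?mul1r.
move=> fs.
have [a0|a0] := leP 0 a.
  rewrite (_ : (fun _ => _) = (fun x => a * pos f x - a * neg f x)); last first.
    by apply/funext => x; rewrite {1}posneg mulrBr.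
  rewrite rsumB_ge0; first last.
  - by apply/abs_summableZ/neg_sum.
  - by apply/abs_summableZ/pos_sum.
  - by move=> x; rewrite mulr_ge0.
  - by move=> x; rewrite mulr_ge0.
  rewrite !ge0//; [|exact: neg_sum|exact: pos_sum].
  rewrite -mulrBr -rsumB_ge0//; [|exact: pos_sum|exact: neg_sum].
  by congr (_ * rsum _); apply/funext => x; rewrite -posneg.
have na0 : 0 <= - a by lra.
rewrite (_ : (fun _ => _) = (fun x => - a * neg f x - - a * pos f x)); last first.
  by apply/funext => x; rewrite {1}posneg; lra.
rewrite rsumB_ge0; first last.
- by apply/abs_summableZ/pos_sum.
- by apply/abs_summableZ/neg_sum.
- by move=> x; rewrite mulr_ge0.
- by move=> x; rewrite mulr_ge0.
rewrite !ge0//; [|exact: pos_sum|exact: neg_sum].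
rewrite [in RHS](_ : f = fun x => pos f x - neg f x); last exact/funext.
rewrite rsumB_ge0//; [lra|exact: pos_sum|exact: neg_sum].
Qed.

Lemma rsumB f g : abs_summable f -> abs_summable g ->
  rsum (fun x => f x - g x) = rsum f - rsum g.
Proof.
move=> fs gs; under [in LHS]eq_fun do rewrite -mulN1r.
by rewrite rsumD ?rsumZ// ?mulN1r//; exact: abs_summableZ.
Qed.

Lemma ler_rsum f g : abs_summable f -> abs_summable g ->
  (forall x, f x <= g x) -> rsum f <= rsum g.
Proof.
move=> fs gs fg; rewrite -subr_ge0 -rsumB//; apply: rsum_ge0 => x.
by rewrite subr_ge0.
Qed.

Lemma ler_norm_rsum f : abs_summable f -> `|rsum f| <= rsum (fun x => `|f x|).
Proof.
move=> fs; have afs := abs_summable_norm fs; rewrite ler_norml; apply/andP; split.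
  rewrite -mulN1r -rsumZ//; apply: ler_rsum => // [|x].
    exact: abs_summableZ.
  by rewrite mulN1r -lerN2 opprK -normrN ler_norm.
by apply: ler_rsum => // x; exact: ler_norm.
Qed.

Lemma rsum0 : rsum (fun _ : X => 0 : R) = 0.
Proof.
rewrite rsum_ge0E//= esum1//.
Qed.

Lemma rsum_fin f (K : {fset X}) :
  (forall x, x \notin K -> f x = 0) -> rsum f = \sum_(x <- K) f x.
Proof.
have ge0 (g : X -> R) : (forall x, 0 <= g x) -> (forall x, x \notin K -> g x = 0) ->
    rsum g = \sum_(x <- K) g x.
  move=> g0 gK; apply: EFin_inj; rewrite rsum_EFin//; last exact: abs_summable_fin gK.
  rewrite (_ : esum _ _ = (\esum_(x in [set` K]) (g x)%:E)%E); last first.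
    rewrite [RHS]esum_mkcond; apply: eq_esum => x _; case: ifPn => //.
    by rewrite mem_setE => /gK ->.
  by rewrite esum_fset//= ?fsbig_finite//= ?set_fsetK ?sumEFin// => x _; rewrite lee_fin.
move=> fK; have fs := abs_summable_fin fK.
rewrite {1}(_ : f = fun x => pos f x - neg f x); last exact/funext.
rewrite rsumB_ge0//; [|exact: pos_sum|exact: neg_sum].
rewrite !ge0//; first by rewrite -sumrB; apply: eq_bigr => x _; rewrite -posneg.
  by move=> x /fK; rewrite /neg => ->; rewrite oppr0 maxxx.
by move=> x /fK; rewrite /pos => ->; rewrite maxxx.
Qed.

Lemma rsum_single f x : (forall y, y != x -> f y = 0) -> rsum f = f x.
Proof.
move=> fx; rewrite (@rsum_fin _ [fset x]%fset) ?big_seq_fset1// => y.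
by rewrite inE; exact: fx.
Qed.

Lemma rsum_eq0 f : (forall x, 0 <= f x) -> abs_summable f -> rsum f = 0 ->
  forall x, f x = 0.
Proof.
move=> f0 fs fs0 x; apply/eqP; rewrite eq_le f0 andbT -fs0; exact: le_rsum1.
Qed.

(** Finite partial sums pass to the limit, which gives a form of Fatou's lemma along an arbitrary
    proper filter. *)
Lemma rsum_cvg_bound {T : Type} {F : set_system T} {FF : ProperFilter F}
    (u : T -> X -> R) f M :
  (forall x, u t x @[t --> F] --> f x) ->
  (\forall t \near F, abs_summable (u t) /\ rsum (fun x => `|u t x|) <= M) ->
  abs_summable f /\ rsum (fun x => `|f x|) <= M.
Proof.
move=> uf uM.
have fM (K : {fset X}) : \sum_(x <- K) `|f x| <= M.
  have cv : \sum_(x <- K) `|u t x| @[t --> F] --> \sum_(x <- K) `|f x|.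
    by apply: cvg_fsum => x; exact: cvg_norm.
  apply: (cvgr_to_le cv); apply: filterS uM => t [us uM].
  rewrite (le_trans _ uM)//; apply: fsum_le_rsum => //.
  exact: abs_summable_norm.
have [|s b] := @rsum_le_bound (fun x => `|f x|) M _ fM; first by [].
by split=> //; apply: (abs_summable_le s) => x; rewrite normr_id.
Qed.

End Summation.

(** * Fubini for absolutely summable double families *)

Section Fubini.
Context {R : realType} {X Y : choiceType}.
Implicit Types F : X * Y -> R.

Let ge0_fubini F : (forall p, 0 <= F p) -> abs_summable F ->
  [/\ forall x, abs_summable (fun y => F (x, y)),
      abs_summable (fun x => rsum (fun y => F (x, y))) &
      rsum F = rsum (fun x => rsum (fun y => F (x, y)))].
Proof.
move=> F0 Fs.
have E : (\esum_(x in [set: X]) \esum_(y in [set: Y]) (F (x, y))%:E)%E = (rsum F)%:E.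
  rewrite rsum_EFin// esum_esum; last by move=> *; rewrite lee_fin.
  rewrite (_ : _ `*`` _ = setT); last by apply/seteqP; split.
  by apply: eq_esum => -[].
have Fx x : abs_summable (fun y => F (x, y)).
  apply/abs_summableE.
  rewrite (_ : esum _ _ = \esum_(y in [set: Y]) (F (x, y))%:E)%E; last first.
    by apply: eq_esum => y _; rewrite ger0_norm.
  apply: (@le_lt_trans _ _ (rsum F)%:E); last exact: ltry.
  rewrite -E; apply: esum_ge; exists [set x]; first by split.
  by rewrite fsbig_set1.
have E' : (\esum_(x in [set: X]) (rsum (fun y => F (x, y)))%:E)%E = (rsum F)%:E.
  by rewrite -E; apply: eq_esum => x _; rewrite rsum_EFin.
have r0 x : 0 <= rsum (fun y => F (x, y)) by apply: rsum_ge0.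
have rs : abs_summable (fun x => rsum (fun y => F (x, y))).
  apply/abs_summableE.
  rewrite (_ : esum _ _ = (rsum F)%:E) ?ltry// -E'.
  by apply: eq_esum => x _; rewrite ger0_norm.
by split=> //; apply: EFin_inj; rewrite -E' rsum_EFin.
Qed.

Lemma abs_summable_prod F : (forall p, 0 <= F p) ->
  (forall x, abs_summable (fun y => F (x, y))) ->
  abs_summable (fun x => rsum (fun y => F (x, y))) -> abs_summable F.
Proof.
move=> F0 Fx Fr; apply/abs_summableE.
rewrite (_ : esum _ _ = (rsum (fun x => rsum (fun y => F (x, y))))%:E) ?ltry//.
rewrite rsum_EFin//; last by move=> x; exact: rsum_ge0.
transitivity (\esum_(x in [set: X]) \esum_(y in [set: Y]) (F (x, y))%:E)%E.
  rewrite esum_esum; last by move=> *; rewrite lee_fin.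
  rewrite (_ : _ `*`` _ = setT); last by apply/seteqP; split.
  by apply: eq_esum => -[x y] _; rewrite ger0_norm.
by apply: eq_esum => x _; rewrite rsum_EFin.
Qed.

Lemma rsum_fubini F : abs_summable F ->
  [/\ forall x, abs_summable (fun y => F (x, y)),
      abs_summable (fun x => rsum (fun y => F (x, y))) &
      rsum F = rsum (fun x => rsum (fun y => F (x, y)))].
Proof.
(* A signed family is the difference of the nonnegative families [|F| + F] and [|F|]. *)
move=> Fs; set P := fun p => `|F p| + F p; set N := fun p => `|F p|.
have Ns : abs_summable N by exact: abs_summable_norm.
have Ps : abs_summable P by exact: abs_summableD.
have [|Px Pr PE] := ge0_fubini _ Ps.
  by move=> p; rewrite /P; have := ler_norm (- F p); rewrite normrN; lra.
have [|Nx Nr NE] := ge0_fubini _ Ns; first by move=> p; exact: normr_ge0.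
have FE : F = (fun p => P p - N p) by apply/funext => p; rewrite /P /N; lra.
have Fx x : abs_summable (fun y => F (x, y)).
  by rewrite FE; exact: abs_summableB.
have E x : rsum (fun y => F (x, y)) =
    rsum (fun y => P (x, y)) - rsum (fun y => N (x, y)).
  by rewrite -rsumB// FE.
split=> //; first by under eq_fun do rewrite E; exact: abs_summableB.
rewrite (_ : (fun x => rsum (fun y => F (x, y))) = fun x =>
  rsum (fun y => P (x, y)) - rsum (fun y => N (x, y))); last exact/funext.
by rewrite rsumB// -PE -NE -rsumB// -FE.
Qed.

End Fubini.

Section FubiniSwap.
Context {R : realType} {X Y : choiceType}.

Lemma rsum_reindex (e : X -> Y) (f : Y -> R) : bijective e ->
  (abs_summable f <-> abs_summable (f \o e)) /\ rsum f = rsum (f \o e).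
Proof.
move=> be.
have bj : set_bij [set: X] [set: Y] e by rewrite setTT_bijective.
split; first by rewrite /abs_summable /summable [X in (X < _)%E](@reindex_esum _ _ _ _ _ _ _ bj).
rewrite /rsum; congr (fine _ - fine _).
  by rewrite (@reindex_esum _ _ _ _ _ e _ bj); apply: eq_esum => x _; rewrite !funeposE.
by rewrite (@reindex_esum _ _ _ _ _ e _ bj); apply: eq_esum => x _; rewrite !funenegE.
Qed.

End FubiniSwap.

(** * Square-summable functions *)

(** The polynomial is tested at its minimiser [t = - b / c]. The Cauchy-Schwarz inequalities below
    and the vanishing of a first variation all come from here. *)
Lemma quad_discr {R : realType} (a b c : R) : 0 <= c ->
  (forall t, 0 <= a + 2 * t * b + t ^+ 2 * c) -> b ^+ 2 <= a * c.
Proof.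
move=> c0 h.
have [c00|cn0] := eqVneq c 0.
  rewrite c00 mulr0; have [->|b0] := eqVneq b 0; first by rewrite expr0n.
  (* For [c = 0] and [b != 0] this [t] gives the polynomial the value -1. *)
  have := h (- (a + 1) / (2 * b)); rewrite c00 mulr0 addr0.
  rewrite (_ : 2 * _ * b = - (a + 1)); first lra.
  by field.
have cp : 0 < c by rewrite lt_neqAle eq_sym cn0.
have := h (- b / c); rewrite (_ : _ + _ = a - b ^+ 2 / c); last by field.
by rewrite subr_ge0 ler_pdivrMr.
Qed.

Section SquareSummable.
Context {R : realType} {X : choiceType}.
Implicit Types f g u : X -> R.

Lemma ell2P f : ell2 f <-> abs_summable (fun x => f x ^+ 2).
Proof.
rewrite /ell2/= abs_summableE.
rewrite (_ : (\esum_(x in _) `|f x ^+ 2|%:E)%E =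
  (\esum_(x in [set: X]) (f x ^+ 2)%:E)%E)//.
by apply: eq_esum => x _; rewrite ger0_norm ?sqr_ge0.
Qed.

Lemma ell2M f g : ell2 f -> ell2 g -> abs_summable (fun x => f x * g x).
Proof.
move=> /ell2P fs /ell2P gs.
apply: abs_summable_le (abs_summableD fs gs) _ => x.
rewrite [leRHS]ger0_norm ?addr_ge0 ?sqr_ge0// normrM.
rewrite -[f x ^+ 2]ger0_norm ?sqr_ge0// -[g x ^+ 2]ger0_norm ?sqr_ge0// !normrX.
by have := sqr_ge0 (`|f x| - `|g x|); have := sqr_ge0 (`|f x| + `|g x|); nra.
Qed.

Lemma ell2_lin a f g : ell2 f -> ell2 g -> ell2 (fun x => a * f x + g x).
Proof.
move=> fs gs; apply/ell2P.
rewrite (_ : (fun _ => _) = (fun x => a ^+ 2 * (f x * f x) +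
  ((2 * a) * (f x * g x) + g x * g x))); last by apply/funext => x; ring.
apply: abs_summableD; first by apply/abs_summableZ/ell2M.
by apply: abs_summableD; [apply/abs_summableZ|]; exact: ell2M.
Qed.

Lemma ell20 : ell2 (fun _ : X => 0 : R).
Proof.
by rewrite /ell2/= esum1 ?ltry// => x _; rewrite expr0n.
Qed.

Lemma ell2Z a f : ell2 f -> ell2 (fun x => a * f x).
Proof.
by move=> fs; under eq_fun do rewrite -[_ * _]addr0; apply: ell2_lin ell20.
Qed.

Lemma ell2B f g : ell2 f -> ell2 g -> ell2 (f - g).
Proof.
move=> fs gs; rewrite (_ : f - g = fun x => -1 * g x + f x); first exact: ell2_lin.
by apply/funext => x; rewrite mulN1r addrC.
Qed.

Lemma ell2_dotC f g : ell2_dot f g = ell2_dot g f.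
Proof. by rewrite /ell2_dot; congr rsum; apply/funext => x; rewrite mulrC. Qed.

Lemma ell2_dot_linl a f g u : ell2 f -> ell2 g -> ell2 u ->
  ell2_dot (fun x => a * f x + g x) u = a * ell2_dot f u + ell2_dot g u.
Proof.
move=> fs gs us; rewrite /ell2_dot -rsumZ; last exact: ell2M.
rewrite -rsumD; [|exact/abs_summableZ/ell2M|exact: ell2M].
by congr rsum; apply/funext => x; ring.
Qed.

Lemma ell2_dot_linr a f g u : ell2 f -> ell2 g -> ell2 u ->
  ell2_dot u (fun x => a * f x + g x) = a * ell2_dot u f + ell2_dot u g.
Proof.
by move=> fs gs us; rewrite ell2_dotC ell2_dot_linl// !(ell2_dotC _ u).
Qed.

Lemma ell2_dotB f g u : ell2 f -> ell2 g -> ell2 u ->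
  ell2_dot (f - g) u = ell2_dot f u - ell2_dot g u.
Proof.
move=> fs gs us; rewrite (_ : f - g = fun x => -1 * g x + f x); last first.
  by apply/funext => x; rewrite mulN1r addrC.
by rewrite ell2_dot_linl//; ring.
Qed.

Lemma ell2_dot_ge0 f : 0 <= ell2_dot f f.
Proof. by apply: rsum_ge0 => x; rewrite -expr2 sqr_ge0. Qed.

Lemma ell2_dot_eq0 f : ell2 f -> ell2_dot f f = 0 -> f = 0.
Proof.
move=> fs f0; apply/funext => x; apply/eqP; rewrite -sqrf_eq0 expr2; apply/eqP.
have := @rsum_eq0 _ _ (fun x => f x * f x); apply => // [y|]; last exact: ell2M.
by rewrite -expr2 sqr_ge0.
Qed.

Lemma ell2_norm_ge0 f : 0 <= ell2_norm f.
Proof. exact: sqrtr_ge0. Qed.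

Lemma ell2_normE f : ell2_norm f ^+ 2 = ell2_dot f f.
Proof. by rewrite sqr_sqrtr// ell2_dot_ge0. Qed.

Lemma ell2_CS f g : ell2 f -> ell2 g ->
  `|ell2_dot f g| <= ell2_norm f * ell2_norm g.
Proof.
move=> fs gs; rewrite -[leLHS]sqrtr_sqr -sqrtrM ?ell2_dot_ge0// ler_wsqrtr//.
apply: quad_discr => [|t]; first exact: ell2_dot_ge0.
have := ell2_dot_ge0 (fun x => t * g x + f x).
rewrite ell2_dot_linl//; last exact: ell2_lin.
by rewrite !ell2_dot_linr// (ell2_dotC g f) => /le_trans; apply; lra.
Qed.

Lemma ell2_normZ a f : ell2 f -> ell2_norm (fun x => a * f x) = `|a| * ell2_norm f.
Proof.
move=> fs; rewrite /ell2_norm -(sqrtr_sqr a) -sqrtrM ?sqr_ge0//; congr Num.sqrt.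
rewrite /ell2_dot -rsumZ; last exact: ell2M.
by congr rsum; apply/funext => x; ring.
Qed.

Lemma ell2_normD f g : ell2 f -> ell2 g ->
  ell2_norm (f + g) <= ell2_norm f + ell2_norm g.
Proof.
move=> fs gs; rewrite -[leRHS]ger0_norm ?addr_ge0 ?ell2_norm_ge0// -sqrtr_sqr.
rewrite ler_wsqrtr// sqrrD !ell2_normE.
rewrite (_ : f + g = fun x => 1 * f x + g x); last first.
  by apply/funext => x; rewrite mul1r.
rewrite ell2_dot_linl//; last exact: ell2_lin.
rewrite !ell2_dot_linr// (ell2_dotC g f).
by have := ell2_CS fs gs; have := ler_norm (ell2_dot f g); lra.
Qed.

Lemma ell2_eval f x : ell2 f -> `|f x| <= ell2_norm f.
Proof.
move=> fs; rewrite -[leLHS]sqrtr_sqr ler_wsqrtr// expr2.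
apply: (@le_rsum1 _ _ (fun x => f x * f x)); last exact: ell2M.
by move=> y; rewrite -expr2 sqr_ge0.
Qed.

(** Fatou for squares: closed balls are stable under pointwise limits. It turns pointwise limits of
    Cauchy sequences into limits in norm. *)
Lemma ell2_cvg_bound {T : Type} {F : set_system T} {FF : ProperFilter F}
    (u : T -> X -> R) f M : 0 <= M ->
  (forall x, u t x @[t --> F] --> f x) ->
  (\forall t \near F, ell2 (u t) /\ ell2_norm (u t) <= M) ->
  ell2 f /\ ell2_norm f <= M.
Proof.
move=> M0 uf uM.
have [||fs fM] := @rsum_cvg_bound _ _ _ F _ (fun t x => u t x ^+ 2)
  (fun x => f x ^+ 2) (M ^+ 2).
- move=> x; under eq_cvg do rewrite expr2; rewrite expr2; exact: cvgM.
- apply: filterS uM => t [/ell2P us le]; split=> //.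
  rewrite (_ : (fun _ => _) = (fun x => u t x * u t x)); last first.
    by apply/funext => x; rewrite ger0_norm ?sqr_ge0// expr2.
  rewrite -/(ell2_dot (u t) (u t)) -ell2_normE ler_pXn2r// nnegrE//.
  exact: ell2_norm_ge0.
split; first exact/ell2P.
rewrite -(@ler_pXn2r _ 2)// ?nnegrE ?ell2_norm_ge0// ell2_normE.
rewrite /ell2_dot (_ : (fun _ => _) = (fun x => `|f x ^+ 2|))//.
by apply/funext => x; rewrite ger0_norm ?sqr_ge0// expr2.
Qed.

End SquareSummable.

(** * The Banach space of square-summable functions as a type *)

Section L2Type.
Context {R : realType} {X : choiceType}.

Definition l2_pred : {pred X -> R} := [pred f | `[< ell2 f >]].

Lemma l2_submod_closed : submod_closed l2_pred.
Proof.
split=> [|a f g]; rewrite !inE; first exact: ell20.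
by move=> fs gs; exact: ell2_lin.
Qed.

HB.instance Definition _ :=
  GRing.isSubmodClosed.Build R (X -> R) l2_pred l2_submod_closed.

(** [ell2] is a set of functions; the operator theory below and Banach-Steinhaus ask for a type
    carrying a complete normed structure. *)
Record l2 := L2 { l2val :> X -> R ; l2valP : l2val \in l2_pred }.

HB.instance Definition _ := [isSub for l2val].
HB.instance Definition _ := gen_eqMixin l2.
HB.instance Definition _ := gen_choiceMixin l2.
HB.instance Definition _ := [SubChoice_isSubLmodule of l2 by <:].

Definition l2norm (f : l2) : R := ell2_norm f.

Lemma l2_ell2 (f : l2) : ell2 f.
Proof. by have := l2valP f; rewrite inE. Qed.

Let l2_normD (f g : l2) : l2norm (f + g) <= l2norm f + l2norm g.
Proof. by apply: ell2_normD; exact: l2_ell2. Qed.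

Let l2_normZ (a : R) (f : l2) : l2norm (a *: f) = `|a| * l2norm f.
Proof. by apply: ell2_normZ; exact: l2_ell2. Qed.

Let l2_norm_eq0 (f : l2) : l2norm f = 0 -> f = 0.
Proof.
move=> f0; apply: val_inj; apply: ell2_dot_eq0; first exact: l2_ell2.
by rewrite -ell2_normE -/(l2norm f) f0 expr0n.
Qed.

HB.instance Definition _ :=
  Lmodule_isNormed.Build R l2 l2_normD l2_normZ l2_norm_eq0.

Lemma l2_normE (f : l2) : `|f| = ell2_norm f.
Proof. by []. Qed.

Let l2_cauchy_cvg (F : set_system l2) : ProperFilter F -> cauchy F -> cvg F.
Proof.
move=> FF Fc.
have near2 (e : R) : 0 < e -> \forall f \near F, \forall g \near F, `|f - g| < e.
  move=> e0; move: Fc => /cauchy_ballP /(_ e e0) [[A B] /= [FA FB] AB].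
  apply: filterS FA => f Af /=; apply: filterS FB => g Bg /=.
  by have := AB (f, g) (conj Af Bg); rewrite /= -ball_normE.
have Fx x : cvg ((fun f : l2 => f x) @ F).
  apply/cauchy_cvgP/cauchy_ballP => e e0.
  move: Fc => /cauchy_ballP /(_ e e0) [[A B] /= [FA FB] AB].
  exists ((fun f : l2 => f x) @` A, (fun f : l2 => f x) @` B) => /=.
    by split; [apply: filterS FA|apply: filterS FB] => f Af /=; exists f.
  move=> [_ _] /= [[f Af <-] [g Bg <-]].
  have := AB (f, g); rewrite -!ball_normE/= => /(_ (conj Af Bg)).
  by apply: le_lt_trans; apply: (ell2_eval x (l2_ell2 (f - g))).
pose l (x : X) : R := lim ((fun f : l2 => f x) @ F).
(* Evaluations are 1-Lipschitz, so a pointwise limit exists; Fatou, with [f] fixed and the other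
   variable running along [F], shows that it is the limit in norm. *)
have bd (e : R) : 0 < e -> \forall f \near F,
    ell2 (l2val f - l) /\ ell2_norm (l2val f - l) <= e.
  move=> e0; apply: filterS (near2 e e0) => f fF.
  apply: (@ell2_cvg_bound _ _ _ F _ (fun g : l2 => l2val f - l2val g)).
  - exact: ltW.
  - by move=> x; apply: cvgB; [exact: cvg_cst|exact: Fx].
  - apply: filterS fF => g fg; split; first exact: (l2_ell2 (f - g)).
    exact: ltW.
have ls : ell2 l.
  have [f [fls _]] := filter_ex (bd 1 ltr01).
  rewrite (_ : l = l2val f - (l2val f - l)); last by rewrite subKr.
  by apply: ell2B => //; exact: l2_ell2.
have lP : l \in l2_pred by rewrite inE.
apply/cvg_ex; exists (L2 lP); apply/cvgrPdistC_le => e e0.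
by apply: filterS (bd e e0) => f [_].
Qed.

HB.instance Definition _ := Uniform_isComplete.Build l2 l2_cauchy_cvg.

End L2Type.
Arguments l2 : clear implicits.

(** * Finitely supported functions *)

Section FiniteSupport.
Context {R : realType} {X : choiceType}.
Implicit Types phi psi : X -> R.

Lemma deltaE (x y : X) : \1_[set x] y = (y == x)%:R :> R.
Proof. by rewrite indicE; congr (nat_of_bool _)%:R; apply/idP/eqP => [|->]; rewrite inE. Qed.

Lemma CcP phi : Cc phi <-> exists K : {fset X}, forall x, x \notin K -> phi x = 0.
Proof.
split=> [fin|[K KP]].
  exists (fset_set [set x | phi x != 0]) => x; rewrite in_fset_set//.
  by rewrite notin_setE/= => /negP; rewrite negbK => /eqP.
apply: (@sub_finite_set _ _ [set` K]) => // x /=; apply: contraNT => /KP ->.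
by rewrite eqxx.
Qed.

Lemma Cc_lin a phi psi : Cc phi -> Cc psi -> Cc (fun x => a * phi x + psi x).
Proof.
move=> /CcP[K KP] /CcP[L LP]; apply/CcP; exists (K `|` L)%fset => x.
by rewrite inE negb_or => /andP[/KP -> /LP ->]; rewrite mulr0 addr0.
Qed.

Lemma Cc_delta (x : X) : Cc (\1_[set x] : X -> R).
Proof.
apply/CcP; exists [fset x]%fset => y; rewrite inE deltaE => /negPf ->.
by [].
Qed.

Lemma Cc0 : Cc (fun _ : X => 0 : R).
Proof. by apply/CcP; exists fset0. Qed.

Lemma CcZ a phi : Cc phi -> Cc (fun x => a * phi x).
Proof.
by move=> /CcP[K KP]; apply/CcP; exists K => x /KP ->; rewrite mulr0.
Qed.

Lemma CcB phi psi : Cc phi -> Cc psi -> Cc (phi - psi).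
Proof.
move=> hp hq; rewrite (_ : phi - psi = fun x => -1 * psi x + phi x).
  exact: Cc_lin.
by apply/funext => x; rewrite mulN1r addrC.
Qed.

Lemma CcD phi psi : Cc phi -> Cc psi -> Cc (phi + psi).
Proof.
move=> hp hq; rewrite (_ : phi + psi = fun x => 1 * psi x + phi x).
  exact: Cc_lin.
by apply/funext => x; rewrite mul1r addrC.
Qed.

Lemma Cc_norm phi : Cc phi -> Cc (fun x => `|phi x|).
Proof.
by move=> /CcP[K KP]; apply/CcP; exists K => x /KP ->; rewrite normr0.
Qed.

(** Point masses span [C_c(X)], so linear statements need to be checked only on them. *)
Lemma Cc_ind (P : (X -> R) -> Prop) : P (fun=> 0) ->
  (forall a x phi, Cc phi -> P phi -> P (fun y => a * \1_[set x] y + phi y)) ->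
  forall phi, Cc phi -> P phi.
Proof.
move=> P0 PS phi /CcP[K KP].
have {KP} : forall x, x \notin (K : seq X) -> phi x = 0 by exact: KP.
elim: (K : seq X) phi => [|x s IH] phi phiP.
  by rewrite (_ : phi = fun=> 0)//; apply/funext => x; exact: phiP.
rewrite (_ : phi = fun y => phi x * \1_[set x] y +
  (if y == x then 0 else phi y)); last first.
  by apply/funext => y; rewrite deltaE; case: eqP => [->|_] /=; rewrite ?mulr1 ?addr0 ?mulr0 ?add0r.
have P' y : y \notin s -> (if y == x then 0 else phi y) = 0.
  move=> ys; case: eqP => // /eqP yx; apply: phiP.
  by rewrite inE negb_or yx.
apply: PS; last exact: IH.
apply/CcP; exists (seq_fset tt s) => y; rewrite seq_fsetE; exact: P'.
Qed.

Lemma Cc_summable phi f : Cc phi -> abs_summable (fun x => phi x * f x).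
Proof.
by move=> /CcP[K KP]; apply: (@abs_summable_fin _ _ _ K) => x /KP ->; rewrite mul0r.
Qed.

Lemma Cc_ell2 phi : Cc phi -> ell2 phi.
Proof. by move=> c; apply/ell2P; under eq_fun do rewrite expr2; exact: Cc_summable. Qed.

Lemma ell2_dot_delta (x : X) (f : X -> R) : ell2_dot \1_[set x] f = f x.
Proof.
rewrite /ell2_dot (@rsum_single _ _ _ x) ?deltaE ?eqxx ?mul1r// => y yx.
by rewrite deltaE (negPf yx) mul0r.
Qed.

End FiniteSupport.

(** * The form on finitely supported functions *)

Section GraphForm.
Context {R : realType} {X : choiceType}.
Variable b : X -> X -> R.
Hypothesis gb : is_graph b.
Implicit Types (f g phi psi : X -> R) (q r : X -> R) (x y : X).

Let b_ge0 x y : 0 <= b x y. Proof. by case: gb. Qed.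
Let bC x y : b x y = b y x. Proof. by case: gb. Qed.
Let bxx x : b x x = 0. Proof. by case: gb. Qed.

Let b_summable x : abs_summable (b x).
Proof.
apply/abs_summableE; case: gb => _ _ _ /(_ x).
rewrite (_ : esum _ _ = \esum_(y in [set: X]) (`|b x y|)%:E)%E//.
by apply: eq_esum => y _; rewrite ger0_norm.
Qed.

Definition deg x : R := rsum (b x).

Lemma FspaceP f : Fspace b f <-> forall x, abs_summable (fun y => b x y * f y).
Proof.
have E x : (\esum_(y in [set: X]) (b x y * `|f y|)%:E)%E =
    (\esum_(y in [set: X]) (`|b x y * f y|)%:E)%E.
  by apply: eq_esum => y _; rewrite normrM (ger0_norm (b_ge0 x y)).
by split=> h x; [apply/abs_summableE; rewrite -E; exact: h|
  rewrite E; exact/abs_summableE/h].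
Qed.

Lemma Fspace_lin a f g : Fspace b f -> Fspace b g ->
  Fspace b (fun x => a * f x + g x).
Proof.
move=> /FspaceP Ff /FspaceP Fg; apply/FspaceP => x.
rewrite (_ : (fun _ => _) = (fun y => a * (b x y * f y) + b x y * g y)).
  by apply: abs_summableD => //; exact: abs_summableZ.
by apply/funext => y; ring.
Qed.

Lemma Cc_Fspace phi : Cc phi -> Fspace b phi.
Proof.
by move=> c; apply/FspaceP => x; under eq_fun do rewrite mulrC; exact: Cc_summable.
Qed.

Lemma HopE q f x : Fspace b f ->
  Hop b q f x = (deg x + q x) * f x - rsum (fun y => b x y * f y).
Proof.
move=> /FspaceP Ff; rewrite /Hop (_ : (fun _ => _) =
  (fun y => f x * b x y - b x y * f y)); last by apply/funext => y; ring.
by rewrite rsumB ?rsumZ//; [rewrite /deg; ring|exact: abs_summableZ].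
Qed.

Lemma Hop_lin q a f g x : Fspace b f -> Fspace b g ->
  Hop b q (fun x => a * f x + g x) x = a * Hop b q f x + Hop b q g x.
Proof.
move=> Ff Fg; rewrite !HopE//; last exact: Fspace_lin.
rewrite (_ : (fun _ => _) = (fun y => a * (b x y * f y) + b x y * g y)).
  have /FspaceP fs := Ff; have /FspaceP gs := Fg.
  by rewrite rsumD ?rsumZ//; [ring|exact: abs_summableZ].
by apply/funext => y; ring.
Qed.

Lemma Hop_delta q x y : Hop b q \1_[set x] y = (deg y + q y) * (y == x)%:R - b y x.
Proof.
rewrite HopE; last exact/Cc_Fspace/Cc_delta.
rewrite (@rsum_single _ _ _ x) ?deltaE ?eqxx ?mulr1// => z zx.
by rewrite deltaE (negPf zx) mulr0.
Qed.

Lemma Hop_shift q r f x : Hop b (q + r) f x = Hop b q f x + r x * f x.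
Proof. by rewrite /Hop fctE/=; ring. Qed.

(** Green's formula taken as a definition: this is the bilinear form of [h] on finitely supported
    functions, and it keeps its meaning for every [f] in [F(X)], even of infinite energy. *)
Definition hB q phi f : R := rsum (fun x => phi x * Hop b q f x).

Lemma hB_linl q a phi psi f : Cc phi -> Cc psi ->
  hB q (fun x => a * phi x + psi x) f = a * hB q phi f + hB q psi f.
Proof.
move=> c1 c2; rewrite /hB -rsumZ; last exact: Cc_summable.
rewrite -rsumD; [|exact/abs_summableZ/Cc_summable|exact: Cc_summable].
by congr rsum; apply/funext => x; ring.
Qed.

Lemma hB_linr q a f g phi : Cc phi -> Fspace b f -> Fspace b g ->
  hB q phi (fun x => a * f x + g x) = a * hB q phi f + hB q phi g.
Proof.
move=> c Ff Fg; rewrite /hB -rsumZ; last exact: Cc_summable.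
rewrite -rsumD; [|exact/abs_summableZ/Cc_summable|exact: Cc_summable].
by congr rsum; apply/funext => x; rewrite Hop_lin//; ring.
Qed.

Lemma hB_delta q x f : hB q \1_[set x] f = Hop b q f x.
Proof.
rewrite /hB (@rsum_single _ _ _ x) ?deltaE ?eqxx ?mul1r// => y yx.
by rewrite deltaE (negPf yx) mul0r.
Qed.

Lemma hB0l q f : hB q (fun=> 0) f = 0.
Proof. by rewrite /hB; under eq_fun do rewrite mul0r; exact: rsum0. Qed.

Lemma hB0r q phi : hB q phi (fun=> 0) = 0.
Proof.
rewrite /hB (_ : (fun _ => _) = (fun=> 0)) ?rsum0//; apply/funext => x.
rewrite HopE; last exact/Cc_Fspace/Cc0.
rewrite (_ : (fun _ => _) = (fun=> 0)) ?rsum0; first by ring.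
by apply/funext => y; rewrite mulr0.
Qed.

(** Induction on both arguments reduces the claim to two point masses, where it is the symmetry of
    [b]. *)
Lemma hBC q phi psi : Cc phi -> Cc psi -> hB q phi psi = hB q psi phi.
Proof.
move=> c1; move: psi; apply: Cc_ind => [|a x psi c2 IH]; first by rewrite hB0l hB0r.
rewrite [RHS]hB_linl; [|exact: Cc_delta|exact: c2].
rewrite [LHS]hB_linr; [|exact: c1|exact/Cc_Fspace/Cc_delta|exact: Cc_Fspace].
rewrite {}IH; congr (_ * _ + _) => {psi c2}.
move: phi c1; apply: Cc_ind => [|c y phi c2 IH]; first by rewrite hB0l hB0r.
rewrite [LHS]hB_linl; [|exact: Cc_delta|exact: c2].
rewrite [RHS]hB_linr; [|exact: Cc_delta|exact/Cc_Fspace/Cc_delta|exact: Cc_Fspace].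
rewrite {}IH; congr (_ * _ + _).
rewrite !hB_delta !Hop_delta (bC x y) eq_sym.
by case: eqP => [->//|_]; rewrite !mulr0.
Qed.

Definition grad_sq phi (p : X * X) : R := b p.1 p.2 * (phi p.1 - phi p.2) ^+ 2.

Let sq_summable phi : Cc phi ->
  let F := fun p : X * X => b p.1 p.2 * phi p.1 ^+ 2 in
  abs_summable F /\ rsum F = rsum (fun x => phi x * (deg x * phi x)).
Proof.
move=> c F.
have Fx x : abs_summable (fun y => F (x, y)).
  by rewrite /F/=; under eq_fun do rewrite mulrC; exact: abs_summableZ.
have E x : rsum (fun y => F (x, y)) = phi x * (deg x * phi x).
  rewrite /F/=; under eq_fun do rewrite mulrC.
  by rewrite rsumZ// /deg; ring.
have EE : (fun x => rsum (fun y => F (x, y))) = (fun x => phi x * (deg x * phi x)).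
  exact/funext.
have Fs : abs_summable F.
  apply: abs_summable_prod => //; last by rewrite EE; exact: Cc_summable.
  by move=> p; rewrite mulr_ge0// sqr_ge0.
by split=> //; have [_ _ ->] := rsum_fubini Fs; rewrite EE.
Qed.

(** Even for finite support the double sum may have infinitely many terms. The square is expanded;
    the two pure terms are exchanged by swapping the variables, and Fubini applies to each piece. *)
Lemma grad_sq_sum phi : Cc phi -> abs_summable (grad_sq phi) /\
  rsum (grad_sq phi) =
    2 * rsum (fun x => phi x * (deg x * phi x - rsum (fun y => b x y * phi y))).
Proof.
move=> c; have /= [Fs FE] := sq_summable c.
set F := (fun p : X * X => _) in Fs FE.
pose swap (p : X * X) := (p.2, p.1).
have swapb : bijective swap by exists swap => -[].
have [FsE FEs] := rsum_reindex F swapb.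
have Fs' : abs_summable (F \o swap) by apply/FsE.
pose G (p : X * X) := b p.1 p.2 * (phi p.1 * phi p.2).
have Gs : abs_summable G.
  apply: (abs_summable_le (abs_summableD Fs Fs')) => -[x y] /=.
  rewrite /G /F /= (bC y x) -mulrDr !normrM ler_wpM2l//.
  rewrite [leRHS]ger0_norm ?addr_ge0 ?sqr_ge0//.
  rewrite -[phi x ^+ 2]ger0_norm ?sqr_ge0// -[phi y ^+ 2]ger0_norm ?sqr_ge0//.
  rewrite !normrX.
  by have := sqr_ge0 (`|phi x| - `|phi y|);
     have := sqr_ge0 (`|phi x| + `|phi y|); nra.
have SE : grad_sq phi = (fun p => (F p + (F \o swap) p) - 2 * G p).
  by apply/funext => -[x y]; rewrite /grad_sq /F /G /= (bC y x); ring.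
split.
  rewrite SE; apply: abs_summableB; first exact: abs_summableD.
  exact: abs_summableZ.
rewrite SE rsumB; [|exact: abs_summableD|exact: abs_summableZ].
rewrite rsumD// rsumZ// -FEs FE.
have [_ _ ->] := rsum_fubini Gs.
rewrite (_ : (fun x => rsum _) = (fun x => phi x * rsum (fun y => b x y * phi y))).
  transitivity (2 * (rsum (fun x => phi x * (deg x * phi x)) -
      rsum (fun x => phi x * rsum (fun y => b x y * phi y)))); first by ring.
  rewrite -rsumB; [|exact: Cc_summable|exact: Cc_summable].
  by congr (2 * rsum _); apply/funext => x; ring.
apply/funext => x; rewrite -rsumZ; last by have /FspaceP := Cc_Fspace c; exact.
by congr rsum; apply/funext => y; rewrite /G/=; ring.
Qed.

Lemma hform_rsum q phi : Cc phi ->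
  hform b q phi = 2^-1 * rsum (grad_sq phi) + rsum (fun x => phi x * (q x * phi x)).
Proof.
move=> c; rewrite /hform; congr (_ * _ + _).
  by rewrite rsum_ge0E// => p; rewrite mulr_ge0// sqr_ge0.
have /CcP[K KP] := c.
rewrite (@rsum_fin _ _ _ K) => [|x /KP ->]; last by rewrite mul0r.
rewrite (@fsbigTE _ _ _ _ K) => [|x /KP ->]; last by rewrite expr0n mulr0.
by apply: eq_bigr => x _; ring.
Qed.

Lemma hform_hB q phi : Cc phi -> hform b q phi = hB q phi phi.
Proof.
move=> c; rewrite hform_rsum//; have [_ ->] := grad_sq_sum c.
rewrite mulrA mulVf// mul1r -rsumD; [|exact: Cc_summable|exact: Cc_summable].
congr rsum; apply/funext => x; rewrite HopE; last exact: Cc_Fspace.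
ring.
Qed.

Lemma hform_shift q r phi : Cc phi ->
  hform b (q + r) phi = hform b q phi + rsum (fun x => r x * phi x ^+ 2).
Proof.
move=> c; rewrite !hform_rsum// -addrA; congr (_ + _).
rewrite (_ : (fun x => r x * _) = (fun x => phi x * (r x * phi x))).
  rewrite -rsumD; [|exact: Cc_summable|exact: Cc_summable].
  by congr rsum; apply/funext => x; rewrite fctE; ring.
by apply/funext => x; ring.
Qed.

(** Edge by edge this is the reverse triangle inequality, and the potential term does not see signs.
    Positivity of Green functions and of null sequences rests on it. *)
Lemma hform_norm q phi : Cc phi -> hform b q (fun x => `|phi x|) <= hform b q phi.
Proof.
move=> c; have c' := Cc_norm c; rewrite !hform_rsum//.
have [s _] := grad_sq_sum c; have [s' _] := grad_sq_sum c'.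
apply: lerD; last first.
  by rewrite [leRHS](_ : _ = rsum (fun x => `|phi x| * (q x * `|phi x|)))//;
    congr rsum; apply/funext => x; rewrite mulrCA [RHS]mulrCA -normrM ger0_norm//
    -expr2 sqr_ge0.
rewrite ler_wpM2l// ler_rsum// => -[x y]; rewrite /grad_sq/= ler_wpM2l//.
rewrite -[leLHS]real_normK ?num_real// -[leRHS]real_normK ?num_real//.
by rewrite lerXn2r ?nnegrE// ler_dist_dist.
Qed.

Lemma hform0 q : hform b q (fun=> 0) = 0.
Proof. by rewrite hform_hB ?hB0l//; exact: Cc0. Qed.

Lemma hform_delta q x : hform b q \1_[set x] = deg x + q x.
Proof.
rewrite hform_hB; last exact: Cc_delta.
by rewrite hB_delta Hop_delta eqxx bxx mulr1 subr0.
Qed.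

Lemma hformD q a phi psi : Cc phi -> Cc psi ->
  hform b q (fun x => a * phi x + psi x) =
  a ^+ 2 * hform b q phi + 2 * a * hB q phi psi + hform b q psi.
Proof.
move=> c1 c2; rewrite !hform_hB//; last exact: Cc_lin.
have [F1 F2] := (Cc_Fspace c1, Cc_Fspace c2).
rewrite hB_linl// !hB_linr// (hBC _ c2 c1); ring.
Qed.

Section Nonneg.
Variable q : X -> R.
Hypothesis h0 : hform_ge0 b q.

Lemma hB_CS phi psi : Cc phi -> Cc psi ->
  (hB q phi psi) ^+ 2 <= hform b q phi * hform b q psi.
Proof.
move=> c1 c2; rewrite mulrC; apply: quad_discr => [|t]; first exact: h0.
have := h0 (Cc_lin t c1 c2); rewrite hformD// => /le_trans; apply; lra.
Qed.

Lemma potential_ge0 x : 0 <= deg x + q x.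
Proof. by rewrite -hform_delta; apply/h0/Cc_delta. Qed.

(* Cauchy-Schwarz for |phi| and the indicator of x, together with
   h(|phi|) <= h(phi). *)
Lemma weighted_sum_le phi x : Cc phi ->
  rsum (fun y => b x y * `|phi y|) <=
  (deg x + q x) * `|phi x| + Num.sqrt (deg x + q x) * Num.sqrt (hform b q phi).
Proof.
move=> c; have c' := Cc_norm c; have cd := @Cc_delta R X x.
have := hB_CS cd c'; rewrite hB_delta hform_delta HopE; last exact: Cc_Fspace.
rewrite -ler_sqrt ?sqr_ge0// ?mulr_ge0// ?potential_ge0 ?h0//.
rewrite sqrtr_sqr sqrtrM ?potential_ge0// => CS.
have : Num.sqrt (hform b q (fun y => `|phi y|)) <= Num.sqrt (hform b q phi).
  by rewrite ler_wsqrtr// hform_norm.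
move=> /(ler_wpM2l (sqrtr_ge0 (deg x + q x))).
set s := _ * `|phi x| in CS *; set t := rsum _ in CS *.
by have := ler_norm (- (s - t)); rewrite normrN; lra.
Qed.

End Nonneg.
End GraphForm.

(** * Completion of the form and minimisation *)

Section FormCompletion.
Context {R : realType} {X : choiceType}.
Variable b : X -> X -> R.
Hypothesis gb : is_graph b.
Implicit Types (f g u v phi psi : X -> R) (x y : X).

(* Under this condition the Hilbert completion of [Cc] for [hform b q] is a
   space of functions. *)
Definition bounded_evals (q : X -> R) : Prop :=
  forall x, exists2 C : R, 0 <= C &
    forall phi, Cc phi -> phi x ^+ 2 <= C * hform b q phi.

Variable q : X -> R.
Hypothesis h0 : hform_ge0 b q.
Hypothesis hev : bounded_evals q.

Local Notation Q := (hform b q).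
Local Notation B := (hB b q).
Local Notation N phi := (Num.sqrt (Q phi)).

(** The Cauchy condition is put on the quadratic form, not on its square root; [cauchy_Q_N] passes
    from one to the other. *)
Definition approx f (phi : nat -> X -> R) : Prop :=
  [/\ forall n, Cc (phi n), cauchy_for Q phi & pointwise_cvg phi f].

Definition dom : set (X -> R) := [set f | exists phi : nat -> X -> R, approx f phi].

(** On [dom] this is the limit along every approximating sequence, by [qbar_lim]; outside it is the
    default 0. *)
Definition qbar f : R :=
  xget 0 [set l | exists2 phi : nat -> X -> R, approx f phi & Q (phi n) @[n --> \oo] --> l].

Definition bform f g : R := polar qbar f g.

Let Q0 phi : Cc phi -> 0 <= Q phi. Proof. exact: h0. Qed.

Lemma Q_lin a phi psi : Cc phi -> Cc psi ->
  Q (fun x => a * phi x + psi x) = a ^+ 2 * Q phi + 2 * a * B phi psi + Q psi.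
Proof. exact: hformD. Qed.

Lemma Q_add phi psi : Cc phi -> Cc psi ->
  Q (phi + psi) = Q phi + 2 * B phi psi + Q psi.
Proof.
move=> c1 c2; rewrite (_ : phi + psi = fun x => 1 * phi x + psi x).
  by rewrite Q_lin//; ring.
by apply/funext => x; rewrite mul1r.
Qed.

Lemma Q_sub phi psi : Cc phi -> Cc psi ->
  Q (phi - psi) = Q phi - 2 * B phi psi + Q psi.
Proof.
move=> c1 c2; rewrite (_ : phi - psi = fun x => -1 * psi x + phi x).
  by rewrite Q_lin// (hBC gb _ c2 c1); ring.
by apply/funext => x; rewrite mulN1r addrC.
Qed.

Lemma B_le phi psi : Cc phi -> Cc psi -> `|B phi psi| <= N phi * N psi.
Proof.
move=> c1 c2; rewrite -[leLHS]sqrtr_sqr -sqrtrM ?Q0// ler_wsqrtr//.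
exact: hB_CS.
Qed.

Lemma N_add phi psi : Cc phi -> Cc psi -> N (phi + psi) <= N phi + N psi.
Proof.
move=> c1 c2; rewrite -[leRHS]ger0_norm ?addr_ge0 ?sqrtr_ge0// -sqrtr_sqr.
rewrite ler_wsqrtr// Q_add// sqrrD !sqr_sqrtr ?Q0//.
by have := B_le c1 c2; have := ler_norm (B phi psi); lra.
Qed.

Lemma N_sub_dist phi psi : Cc phi -> Cc psi -> `|N phi - N psi| <= N (phi - psi).
Proof.
move=> c1 c2; have := N_add (CcB c1 c2) c2; rewrite subrK => h1.
have := N_add (CcB c2 c1) c1; rewrite subrK => h2.
have E : N (psi - phi) = N (phi - psi).
  by rewrite !Q_sub// (hBC gb _ c1 c2); congr Num.sqrt; ring.
by rewrite ler_norml; apply/andP; split; lra.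
Qed.

Lemma cauchy_Q_N (phi : nat -> X -> R) : cauchy_for Q phi ->
  forall e : R, 0 < e -> exists k, forall m n, (k <= m)%N -> (k <= n)%N ->
    N (phi m - phi n) < e.
Proof.
move=> c e e0; have [|k kP] := c (e ^+ 2); first by rewrite exprn_gt0.
exists k => m n km kn; rewrite -[e]ger0_norm ?ltW// -sqrtr_sqr.
by rewrite ltr_sqrt ?exprn_gt0//; exact: kP.
Qed.

Lemma eval_N x : exists2 C : R, 0 <= C & forall phi, Cc phi -> `|phi x| <= C * N phi.
Proof.
have [C C0 CP] := hev x; exists (Num.sqrt C); first exact: sqrtr_ge0.
by move=> phi c; rewrite -sqrtrM// -[leLHS]sqrtr_sqr ler_wsqrtr//; exact: CP.
Qed.

Lemma weighted_N x : exists2 C : R, 0 <= C &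
  forall phi, Cc phi -> rsum (fun y => b x y * `|phi y|) <= C * N phi.
Proof.
have [C C0 CP] := eval_N x; have p0 := potential_ge0 gb h0 x.
exists ((deg b x + q x) * C + Num.sqrt (deg b x + q x)).
  by rewrite addr_ge0 ?sqrtr_ge0// mulr_ge0.
move=> phi c; apply: le_trans (weighted_sum_le gb h0 x c) _.
by rewrite [leRHS]mulrDl lerD2r -mulrA ler_wpM2l//; exact: CP.
Qed.

(** [weighted_N] bounds [sum_y b(x,y) |phi_n(y) - phi_m(y)|]; Fatou in [m] then gives convergence of
    the weighted sums, not merely of the values. Hence limits stay in [F(X)] and [H] commutes with
    them. *)
Lemma approx_weighted f (phi : nat -> X -> R) x : approx f phi ->
  abs_summable (fun y => b x y * f y) /\
  forall e : R, 0 < e -> exists k, forall n, (k <= n)%N ->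
    `|rsum (fun y => b x y * phi n y) - rsum (fun y => b x y * f y)| < e.
Proof.
move=> [c ca cp]; have [C C0 CP] := weighted_N x.
have Cs n : abs_summable (fun y => b x y * phi n y).
  by have /(FspaceP gb) := Cc_Fspace gb (c n); exact.
have key (e : R) : 0 < e -> exists k, forall n, (k <= n)%N ->
    abs_summable (fun y => b x y * (phi n y - f y)) /\
    rsum (fun y => `|b x y * (phi n y - f y)|) <= e.
  (* Dividing by [C + 1] covers the case [C = 0]; the same device recurs below. *)
  move=> e0; have [|k kP] := cauchy_Q_N ca (e := e / (C + 1)).
    by rewrite divr_gt0// ltr_wpDl.
  exists k => n kn.
  apply: (@rsum_cvg_bound _ _ _ \oo _
    (fun m y => b x y * (phi n y - phi m y))) => [y|].
    by apply: cvgM; [exact: cvg_cst|apply: cvgB; [exact: cvg_cst|exact: cp]].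
  exists k => // m /= km; have cnm := CcB (c n) (c m); split.
    by have /(FspaceP gb) := Cc_Fspace gb cnm; exact.
  rewrite (_ : (fun _ => _) = (fun y => b x y * `|(phi n - phi m) y|)); last first.
    by apply/funext => y; rewrite normrM ger0_norm//; case: gb.
  apply: le_trans (CP _ cnm) _; have := kP n m kn km.
  rewrite ltr_pdivlMr ?ltr_wpDl// => /ltW; apply: le_trans.
  by rewrite mulrC ler_wpM2l ?sqrtr_ge0// lerDl.
have fs : abs_summable (fun y => b x y * f y).
  have [k kP] := key 1 ltr01; have [s _] := kP k (leqnn k).
  rewrite (_ : (fun _ => _) =
    (fun y => b x y * phi k y - b x y * (phi k y - f y))).
    exact: abs_summableB.
  by apply/funext => y; ring.
split=> // e e0; have [|k kP] := key (e / 2); first by rewrite divr_gt0.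
exists k => n kn; rewrite -rsumB//; have [s le] := kP n kn.
rewrite (_ : (fun _ => _) = (fun y => b x y * (phi n y - f y))); last first.
  by apply/funext => y; ring.
apply: le_lt_trans (ler_norm_rsum s) _; apply: le_lt_trans le _; lra.
Qed.

Lemma dom_Fspace f : dom f -> Fspace b f.
Proof.
by move=> [phi fa]; apply/(FspaceP gb) => x; have [] := approx_weighted x fa.
Qed.

Lemma approx_Hop f (phi : nat -> X -> R) x : approx f phi ->
  Hop b q (phi n) x @[n --> \oo] --> Hop b q f x.
Proof.
move=> fa; have [c _ cp] := fa.
have Ff : Fspace b f by apply: dom_Fspace; exists phi.
rewrite HopE//; under eq_cvg => n do rewrite (HopE gb q x (Cc_Fspace gb (c n))).
apply: cvgB; first by apply: cvgM; [exact: cvg_cst|exact: cp].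
by apply/cvgr_epsP; have [] := approx_weighted x fa.
Qed.

Lemma approx_hB f (phi : nat -> X -> R) psi : approx f phi -> Cc psi ->
  B psi (phi n) @[n --> \oo] --> B psi f.
Proof.
move=> fa /CcP[K KP].
have E g : B psi g = \sum_(x <- K) psi x * Hop b q g x.
  by rewrite /hB (@rsum_fin _ _ _ K) => [//|x /KP ->]; rewrite mul0r.
rewrite E; under eq_cvg => n do rewrite E.
apply: cvg_fsum => x; apply: cvgM; first exact: cvg_cst.
exact: approx_Hop.
Qed.

Lemma approx_lin a f g (phi psi : nat -> X -> R) : approx f phi -> approx g psi ->
  approx (fun x => a * f x + g x) (fun n x => a * phi n x + psi n x).
Proof.
move=> [c1 ca1 cp1] [c2 ca2 cp2]; split.
- by move=> n; exact: Cc_lin.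
- move=> e e0.
  have [|k1 kP1] := ca1 (e / (4 * (a ^+ 2 + 1))).
    by rewrite divr_gt0// mulr_gt0// ltr_wpDl ?sqr_ge0.
  have [|k2 kP2] := ca2 (e / 4); first by rewrite divr_gt0.
  exists (maxn k1 k2) => m n; rewrite !geq_max => /andP[m1 m2] /andP[n1 n2].
  have := kP1 m n m1 n1; have := kP2 m n m2 n2.
  set p := phi m - phi n; set s := psi m - psi n.
  have cp : Cc p by exact: CcB.
  have cs : Cc s by exact: CcB.
  rewrite (_ : _ - _ = fun x => a * p x + s x); last first.
    by apply/funext => x; rewrite /p /s !fctE; ring.
  (* Adding this inequality gives [Q (a p + s) <= 2 a^2 Q p + 2 Q s], which explains the constants
     [4 (a^2 + 1)] and 4. *)
  have : 0 <= Q (fun x => - a * p x + s x) by apply/Q0/Cc_lin.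
  rewrite !Q_lin// => hm h2.
  rewrite ltr_pdivlMr; last by rewrite mulr_gt0// ltr_wpDl ?sqr_ge0.
  by have := Q0 cp; have := Q0 cs; have := sqr_ge0 a; nra.
- move=> x; apply: cvgD; last exact: cp2.
  by apply: cvgM; [exact: cvg_cst|exact: cp1].
Qed.

Lemma approx_cst phi : Cc phi -> approx phi (fun=> phi).
Proof.
move=> c; split=> // [e e0|x]; last exact: cvg_cst.
by exists 0%N => m n _ _; rewrite subrr (hform0 gb).
Qed.

Lemma Cc_dom phi : Cc phi -> dom phi.
Proof. by move=> c; exists (fun=> phi); exact: approx_cst. Qed.

Lemma approxB f g (phi psi : nat -> X -> R) : approx f phi -> approx g psi ->
  approx (f - g) (fun n => phi n - psi n).
Proof.
move=> fa ga; have := approx_lin (-1) ga fa.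
rewrite (_ : (fun x => _) = f - g); last first.
  by apply/funext => x; rewrite mulN1r addrC.
rewrite (_ : (fun n x => _) = (fun n => phi n - psi n))//.
by apply/funext => n; apply/funext => x; rewrite mulN1r addrC.
Qed.

Lemma approxD f g (phi psi : nat -> X -> R) : approx f phi -> approx g psi ->
  approx (f + g) (fun n => phi n + psi n).
Proof.
move=> fa ga; have := approx_lin 1 ga fa.
rewrite (_ : (fun x => _) = f + g); last first.
  by apply/funext => x; rewrite mul1r addrC.
rewrite (_ : (fun n x => _) = (fun n => phi n + psi n))//.
by apply/funext => n; apply/funext => x; rewrite mul1r addrC.
Qed.

(* Closability: h(phi_n) = h(phi_n - phi_k) - h(phi_k) + 2 h(phi_k, phi_n), and
   the last term vanishes in the limit. *)
Lemma approx_null (phi : nat -> X -> R) : approx (fun=> 0) phi -> Q (phi n) @[n --> \oo] --> (0 : R).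
Proof.
move=> fa; have [c ca _] := fa; apply/cvgr_epsP => e e0.
have [|k kP] := ca (e / 2); first by rewrite divr_gt0.
have := approx_hB fa (c k); rewrite (hB0r gb) => /cvgr_epsP /(_ (e / 4)).
move=> [|l lP]; first by rewrite divr_gt0.
exists (maxn k l) => n; rewrite geq_max => /andP[kn ln].
rewrite subr0 ger0_norm ?Q0//; have := kP n k kn (leqnn k).
rewrite Q_sub// (hBC gb _ (c n) (c k)).
have := lP n ln; rewrite subr0; have := ler_norm (B (phi k) (phi n)).
by have := Q0 (c k); lra.
Qed.

Lemma approx_Q_cvg f (phi : nat -> X -> R) : approx f phi -> exists l : R, Q (phi n) @[n --> \oo] --> l.
Proof.
move=> [c ca _].
have [l lP] : exists l : R, N (phi n) @[n --> \oo] --> l.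
  apply: cauchy_seq_cvg => e e0; have [k kP] := cauchy_Q_N ca e0.
  exists k => m n km kn; apply: le_lt_trans (kP m n km kn).
  exact: N_sub_dist.
exists (l * l); under eq_cvg => n do rewrite -[Q _]sqr_sqrtr ?Q0// expr2.
exact: cvgM.
Qed.

(** The difference of two approximating sequences of [f] approximates 0, so its energy tends to 0 by
    [approx_null] and the two norms share their limit. *)
Lemma approx_Q_unique f (phi psi : nat -> X -> R) (l l' : R) : approx f phi -> approx f psi ->
  Q (phi n) @[n --> \oo] --> l -> Q (psi n) @[n --> \oo] --> l' -> l = l'.
Proof.
move=> fa ga cl cl'; have [c1 _ _] := fa; have [c2 _ _] := ga.
have /approx_null d0 : approx (fun=> 0) (fun n => phi n - psi n).
  have := approxB fa ga; rewrite (_ : f - f = fun=> 0)//.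
  by apply/funext => x; rewrite fctE subrr.
have s (u : nat -> R) (a : R) : u n @[n --> \oo] --> a ->
    Num.sqrt (u n) @[n --> \oo] --> Num.sqrt a.
  by move=> ua; apply: continuous_cvg => //; exact: sqrt_continuous.
have E : Num.sqrt l - Num.sqrt l' = 0.
  apply/eqP; rewrite -normr_le0.
  have h1 : `|N (phi n) - N (psi n)| @[n --> \oo] --> `|Num.sqrt l - Num.sqrt l'|.
    by apply: cvg_norm; apply: cvgB; exact: s.
  rewrite -(@sqrtr0 R); apply: ler_cvg_to h1 (s _ _ d0) _.
  by exists 0%N => // n _; exact: N_sub_dist.
have ge (u : nat -> X -> R) (a : R) : (forall n, Cc (u n)) ->
    Q (u n) @[n --> \oo] --> a -> 0 <= a.
  by move=> cu ua; apply: (cvgr_to_ge ua); exists 0%N => // n _; exact: Q0.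
rewrite -(sqr_sqrtr (ge _ _ c1 cl)) -(sqr_sqrtr (ge _ _ c2 cl')).
by congr (_ ^+ 2); lra.
Qed.

Lemma qbar_lim f (phi : nat -> X -> R) : approx f phi -> Q (phi n) @[n --> \oo] --> qbar f.
Proof.
move=> fa; have [l lP] := approx_Q_cvg fa.
rewrite /qbar; case: xgetP => [l' -> [psi ga gl]|].
  by rewrite (approx_Q_unique ga fa gl lP).
by move=> /(_ l); case; exists phi.
Qed.

Lemma qbar_Cc phi : Cc phi -> qbar phi = Q phi.
Proof.
move=> c; apply: (approx_Q_unique (approx_cst c) (approx_cst c)).
  exact/qbar_lim/approx_cst.
exact: cvg_cst.
Qed.

Lemma qbar_ge0 f : dom f -> 0 <= qbar f.
Proof.
move=> [phi fa]; apply: (cvgr_to_ge (qbar_lim fa)); exists 0%N => // n _.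
by apply: Q0; case: fa.
Qed.

Lemma dom_lin a f g : dom f -> dom g -> dom (fun x => a * f x + g x).
Proof.
move=> [phi fa] [psi ga]; exists (fun n x => a * phi n x + psi n x).
exact: approx_lin.
Qed.

Lemma dom0 : dom (fun=> 0).
Proof. exact/Cc_dom/Cc0. Qed.

Lemma domB f g : dom f -> dom g -> dom (f - g).
Proof.
by move=> [phi fa] [psi ga]; exists (fun n => phi n - psi n); exact: approxB.
Qed.

Lemma domD f g : dom f -> dom g -> dom (f + g).
Proof.
by move=> [phi fa] [psi ga]; exists (fun n => phi n + psi n); exact: approxD.
Qed.

Lemma bform_lim f g (phi psi : nat -> X -> R) : approx f phi -> approx g psi ->
  B (phi n) (psi n) @[n --> \oo] --> bform f g.
Proof.
move=> fa ga; have [c1 _ _] := fa; have [c2 _ _] := ga.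
have E n : B (phi n) (psi n) = (Q (phi n + psi n) - Q (phi n - psi n)) / 4.
  by rewrite Q_add// Q_sub//; field.
under eq_cvg => n do rewrite E.
apply: cvgM; last exact: cvg_cst.
by apply: cvgB; apply: qbar_lim; [exact: approxD|exact: approxB].
Qed.

Lemma bformC f g : dom f -> dom g -> bform f g = bform g f.
Proof.
move=> [phi fa] [psi ga]; have [c1 _ _] := fa; have [c2 _ _] := ga.
have := bform_lim fa ga; under eq_cvg => n do rewrite hBC//.
by move=> h; apply: cvg_unique h (bform_lim ga fa).
Qed.

Lemma bform_linl a f g v : dom f -> dom g -> dom v ->
  bform (fun x => a * f x + g x) v = a * bform f v + bform g v.
Proof.
move=> [phi fa] [psi ga] [w va].
have [c1 _ _] := fa; have [c2 _ _] := ga.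
have := bform_lim (approx_lin a fa ga) va.
under eq_cvg => n do rewrite hB_linl//.
move=> h; apply: (cvg_unique _ h) => //.
apply: cvgD; last exact: bform_lim.
by apply: cvgM; [exact: cvg_cst|exact: bform_lim].
Qed.

Lemma bform_linr a f g v : dom f -> dom g -> dom v ->
  bform v (fun x => a * f x + g x) = a * bform v f + bform v g.
Proof.
move=> df dg dv; rewrite bformC//; last exact: dom_lin.
by rewrite bform_linl// !(bformC _ dv).
Qed.

Lemma bform_diag f : dom f -> bform f f = qbar f.
Proof.
move=> [phi fa]; have [c _ _] := fa; have := bform_lim fa fa.
under eq_cvg => n do rewrite -hform_hB//.
by move=> h; apply: cvg_unique h (qbar_lim fa).
Qed.

Lemma bform_Cc f psi : dom f -> Cc psi -> bform f psi = B psi f.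
Proof.
move=> [phi fa] c; have [c1 _ _] := fa.
have := bform_lim fa (approx_cst c).
under eq_cvg => n do rewrite hBC//.
by move=> h; apply: cvg_unique h (approx_hB fa c).
Qed.

Lemma bform_CS f g : dom f -> dom g -> bform f g ^+ 2 <= qbar f * qbar g.
Proof.
move=> df dg; apply: quad_discr => [|t]; first exact: qbar_ge0.
have := qbar_ge0 (dom_lin t dg df).
rewrite -bform_diag; last exact: dom_lin.
rewrite bform_linl//; last exact: dom_lin.
rewrite !bform_linr// (bformC dg df) !bform_diag// => /le_trans; apply.
by rewrite le_eqVlt; apply/orP; left; apply/eqP; ring.
Qed.

Lemma qbarB f g : dom f -> dom g -> qbar (f - g) = qbar f - 2 * bform f g + qbar g.
Proof.
move=> df dg; rewrite (_ : f - g = fun x => -1 * g x + f x); last first.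
  by apply/funext => x; rewrite mulN1r addrC.
have dl := dom_lin (-1) dg df.
rewrite -bform_diag// bform_linl// !bform_linr// (bformC dg df) !bform_diag//.
by ring.
Qed.

Lemma qbar_sqrtD f g : dom f -> dom g ->
  Num.sqrt (qbar (f + g)) <= Num.sqrt (qbar f) + Num.sqrt (qbar g).
Proof.
move=> df dg; rewrite -[leRHS]ger0_norm ?addr_ge0 ?sqrtr_ge0// -sqrtr_sqr.
rewrite ler_wsqrtr// sqrrD !sqr_sqrtr ?qbar_ge0// -sqrtrM ?qbar_ge0//.
have : bform f g <= Num.sqrt (qbar f * qbar g).
  rewrite (le_trans (ler_norm _))// -sqrtr_sqr ler_wsqrtr//; exact: bform_CS.
rewrite -[qbar (f + g)]bform_diag; last exact: domD.
rewrite (_ : f + g = fun x => 1 * g x + f x); last first.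
  by apply/funext => x; rewrite mul1r addrC.
rewrite bform_linl//; last exact: dom_lin.
by rewrite !bform_linr// (bformC dg df) !bform_diag//; lra.
Qed.

Lemma approx_dense f (phi : nat -> X -> R) : approx f phi -> forall e : R, 0 < e ->
  exists k, forall n, (k <= n)%N -> qbar (f - phi n) <= e.
Proof.
move=> fa e e0; have [c ca _] := fa; have [k kP] := ca e e0; exists k => n kn.
have := qbar_lim (approxB fa (approx_cst (c n))).
move=> /cvgr_to_le; apply; exists k => // m /= km; apply/ltW; exact: kP.
Qed.

Lemma bform_cvg g v (psi : nat -> X -> R) : dom g -> approx v psi ->
  bform g (psi n) @[n --> \oo] --> bform g v.
Proof.
move=> dg va; have [c _ _] := va; have dv : dom v by exists psi.
apply/cvgr_epsP => e e0.
have g0 := qbar_ge0 dg; have g1 : 0 < qbar g + 1 by rewrite ltr_wpDl.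
have [|k kP] := approx_dense va (e := e ^+ 2 / (2 * (qbar g + 1))).
  by rewrite divr_gt0 ?exprn_gt0// mulr_gt0.
exists k => n kn; have dn := Cc_dom (c n).
have -> : bform g (psi n) - bform g v = - bform g (v - psi n).
  rewrite (_ : v - psi n = fun x => -1 * psi n x + v x); last first.
    by apply/funext => x; rewrite mulN1r addrC.
  by rewrite bform_linr//; ring.
have := bform_CS dg (domB dv dn); have := kP n kn; rewrite normrN.
move: (bform _ _) (qbar (v - _)) => z w hw hz.
rewrite -(@ltr_pXn2r _ 2)// ?nnegrE ?(ltW e0)// real_normK ?num_real//.
apply: le_lt_trans hz _; apply: le_lt_trans (ler_wpM2l g0 hw) _.
rewrite mulrA ltr_pdivrMr ?mulr_gt0//.
have : 0 < e ^+ 2 by rewrite exprn_gt0.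
by nra.
Qed.

Lemma dom_eval x (C : R) : (forall phi, Cc phi -> phi x ^+ 2 <= C * Q phi) ->
  forall f, dom f -> f x ^+ 2 <= C * qbar f.
Proof.
move=> CP f [phi fa]; have [c _ cp] := fa.
have h1 : phi n x ^+ 2 @[n --> \oo] --> f x ^+ 2.
  by under eq_cvg do rewrite expr2; rewrite expr2; apply: cvgM; exact: cp.
have h2 : C * Q (phi n) @[n --> \oo] --> C * qbar f.
  by apply: cvgM; [exact: cvg_cst|exact: qbar_lim].
by apply: ler_cvg_to h1 h2 _; exists 0%N => // n _; exact: CP.
Qed.

Lemma qbar_eq0 f : dom f -> qbar f = 0 -> f = fun=> 0.
Proof.
move=> df f0; apply/funext => x; apply/eqP; rewrite -sqrf_eq0 eq_le sqr_ge0 andbT.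
by have [C C0 CP] := hev x; rewrite (le_trans (dom_eval CP df))// f0 mulr0.
Qed.

Lemma cauchy_approx (phi : nat -> X -> R) : (forall n, Cc (phi n)) ->
  cauchy_for Q phi -> exists f, approx f phi.
Proof.
move=> c ca.
have cx x : exists l : R, phi n x @[n --> \oo] --> l.
  apply: cauchy_seq_cvg => e e0; have [C C0 CP] := eval_N x.
  have [|k kP] := cauchy_Q_N ca (e := e / (C + 1)).
    by rewrite divr_gt0// ltr_wpDl.
  exists k => m n km kn; apply: le_lt_trans (CP _ (CcB (c m) (c n))) _.
  have := kP m n km kn; rewrite ltr_pdivlMr ?ltr_wpDl// => h.
  by apply: le_lt_trans h; rewrite mulrC ler_wpM2l ?sqrtr_ge0// lerDl.
have [f fP] := choice cx.
by exists f; split.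
Qed.

(** Each [u n] is replaced by a finitely supported function at distance at most [1/(n+1)]. The new
    sequence is Cauchy in [C_c(X)], and bounded evaluations give it a pointwise limit. *)
Lemma dom_complete (u : nat -> X -> R) : (forall n, dom (u n)) ->
  cauchy_for (fun f => Num.sqrt (qbar f)) u ->
  exists2 f, dom f & Num.sqrt (qbar (u n - f)) @[n --> \oo] --> (0 : R).
Proof.
move=> du uc.
have ap n : exists phi, Cc phi /\ Num.sqrt (qbar (u n - phi)) <= n.+1%:R^-1.
  have [phi fa] := du n.
  have [|k kP] := approx_dense fa (e := n.+1%:R^-1 ^+ 2).
    by rewrite exprn_gt0// invr_gt0.
  exists (phi k); split; first by case: fa.
  rewrite -[leRHS]ger0_norm ?invr_ge0// -sqrtr_sqr ler_wsqrtr//.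
  exact: kP.
have [phi phiP] := choice ap.
have c n : Cc (phi n) by have [] := phiP n.
have symm f g : dom f -> dom g -> qbar (f - g) = qbar (g - f).
  by move=> df dg; rewrite !qbarB// (bformC df dg); ring.
have arith (p r s i j w d : R) : r <= j -> p <= i -> s < d -> j < d -> i < d ->
    w <= s + r -> p + w < 3 * d by lra.
have arith2 (p r i e : R) : p <= i -> i < e / 2 -> 0 < e -> r <= e / 3 ->
    p + r < e by lra.
have ca : cauchy_for Q phi.
  move=> e e0; pose d : R := Num.sqrt e / 3; have dE : Num.sqrt e = 3 * d by rewrite /d; field.
  have d0 : 0 < d by rewrite divr_gt0// sqrtr_gt0.
  clearbody d.
  have [k1 kP1] := harmonic_small d0; have [k2 kP2] := uc d d0.
  exists (maxn k1 k2) => m n; rewrite !geq_max => /andP[m1 m2] /andP[n1 n2].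
  rewrite -qbar_Cc; last exact: CcB.
  rewrite -ltr_sqrt//.
  have dm := Cc_dom (c m); have dn := Cc_dom (c n).
  rewrite (_ : phi m - phi n = (phi m - u m) + ((u m - u n) + (u n - phi n))).
    apply: le_lt_trans (qbar_sqrtD (domB dm (du m))
      (domD (domB (du m) (du n)) (domB (du n) dn))) _.
    have := qbar_sqrtD (domB (du m) (du n)) (domB (du n) dn).
    have := kP1 m m1; have := kP1 n n1; have /= := kP2 m n m2 n2.
    have [_] := phiP m; have [_] := phiP n; rewrite (symm (phi m))//.
    by rewrite dE; exact: arith.
  by apply/funext => x; rewrite !fctE; ring.
have [f fa] := cauchy_approx c ca; exists f; first by exists phi.
apply/cvgr_epsP => e e0.
have [k1 kP1] := harmonic_small (divr_gt0 e0 (ltr0n _ 2)).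
have [|k2 kP2] := approx_dense fa (e := (e / 3) ^+ 2).
  by rewrite exprn_gt0// divr_gt0.
exists (maxn k1 k2) => n; rewrite geq_max => /andP[n1 n2].
have df : dom f by exists phi.
have dn := Cc_dom (c n).
rewrite subr0 ger0_norm ?sqrtr_ge0//.
rewrite (_ : u n - f = (u n - phi n) + (phi n - f)); last first.
  by apply/funext => x; rewrite !fctE; ring.
apply: le_lt_trans (qbar_sqrtD (domB (du n) dn) (domB dn df)) _.
have : Num.sqrt (qbar (phi n - f)) <= e / 3.
  rewrite symm// -[leRHS]ger0_norm; last by rewrite divr_ge0// ltW.
  by rewrite -sqrtr_sqr ler_wsqrtr//; exact: kP2.
move: (phiP n).2 (kP1 n n1) e0; exact: arith2.
Qed.

(** * Riesz representation by minimising a quadratic functional *)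

Section Riesz.
Variables (L : (X -> R) -> R) (M : R).
Hypothesis Llin : forall a phi psi, Cc phi -> Cc psi ->
  L (fun x => a * phi x + psi x) = a * L phi + L psi.
Hypothesis LM : forall phi, Cc phi -> L phi ^+ 2 <= M * Q phi.

Local Notation J phi := (Q phi - 2 * L phi).


(** By the arithmetic-geometric inequality, [4 (L phi)^2 <= 4 |M| Q phi <= (Q phi + |M|)^2]. *)
Let J_lbound phi : Cc phi -> - `|M| <= J phi.
Proof.
move=> c; have q0 := Q0 c; have : L phi ^+ 2 <= (Q phi + `|M|) ^+ 2 / 4.
  apply: le_trans (LM c) _; have := ler_norm M; have := sqr_ge0 (Q phi - `|M|).
  by nra.
have q1 : 0 <= Q phi + `|M| by rewrite addr_ge0.
rewrite -ler_sqrt; last by rewrite mulr_ge0// sqr_ge0.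
rewrite sqrtr_sqr sqrtrM ?sqr_ge0// sqrtr_sqr (ger0_norm q1).
rewrite (_ : 4^-1 = 2^-1 ^+ 2 :> R); last by field.
rewrite sqrtr_sqr (ger0_norm (_ : 0 <= 2^-1)) ?invr_ge0// => h.
by have := ler_norm (L phi); lra.
Qed.

Let m := inf [set J phi | phi in [set phi | Cc phi]].

Let J_inf : has_inf [set J phi | phi in [set phi | Cc phi]].
Proof.
split; first by exists (J (fun=> 0)), (fun=> 0) => //; exact: Cc0.
by exists (- `|M|) => _ [phi c <-]; exact: J_lbound.
Qed.

Let m_le phi : Cc phi -> m <= J phi.
Proof. by move=> c; apply: ge_inf; [case: J_inf|exists phi]. Qed.

Let L_delta phi psi a : Cc phi -> Cc psi ->
  J (fun x => a * psi x + phi x) =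
  J phi + 2 * a * (B psi phi - L psi) + a ^+ 2 * Q psi.
Proof. by move=> c1 c2; rewrite Q_lin// Llin//; ring. Qed.

(** The midpoint of two almost minimisers cannot beat the infimum, so the parallelogram identity
    makes the sequence Cauchy; the identity for [B psi g] is the Euler-Lagrange equation of the
    limit. *)
Let minimizing (phi : nat -> X -> R) : (forall n, Cc (phi n)) ->
  (forall n, J (phi n) <= m + n.+1%:R^-1) ->
  exists g, approx g phi /\ forall psi, Cc psi -> B psi g = L psi.
Proof.
move=> c Jm.
have ca : cauchy_for Q phi.
  move=> e e0; have [k kP] := harmonic_small (divr_gt0 e0 (ltr0n _ 4)).
  exists k => i j ki kj.
  have ci := CcZ 2^-1 (c i).
  have := m_le (Cc_lin 2^-1 (c j) ci).
  have E : J (fun x => 2^-1 * phi j x + 2^-1 * phi i x) =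
      2^-1 * J (phi i) + 2^-1 * J (phi j) - 4^-1 * Q (phi i - phi j).
    have -> : (fun x => 2^-1 * phi j x + 2^-1 * phi i x) =
        (fun x => 2^-1 * (phi j - phi i) x + phi i x).
      by apply/funext => x; rewrite !fctE; field.
    rewrite L_delta//; last exact: CcB.
    have -> : phi j - phi i = (fun x => -1 * phi i x + phi j x).
      by apply/funext => x; rewrite !fctE; ring.
    rewrite Q_lin// Llin// hB_linl// -hform_hB// Q_sub// (hBC gb _ (c j) (c i)).
    by field.
  have arith (v p r ii jj w : R) : p <= v + ii -> r <= v + jj -> ii < e / 4 ->
      jj < e / 4 -> v <= 2^-1 * p + 2^-1 * r - 4^-1 * w -> w < e by lra.
  rewrite E; exact: arith (Jm i) (Jm j) (kP i ki) (kP j kj).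
have [g ga] := cauchy_approx c ca; exists g; split=> // psi cpsi.
apply/eqP; rewrite -subr_eq0 -sqrf_eq0 eq_le sqr_ge0 andbT.
(* The first variation is a quadratic polynomial in [t] with constant term 0. It is nonnegative for
   all [t], so its linear coefficient vanishes. *)
rewrite -[leRHS](mul0r (Q psi)); apply: quad_discr => [|t]; first exact: Q0.
have lim : n.+1%:R^-1 + 2 * t * (B psi (phi n) - L psi) + t ^+ 2 * Q psi
    @[n --> \oo] --> 0 + 2 * t * (B psi g - L psi) + t ^+ 2 * Q psi.
  apply: cvgD; last exact: cvg_cst.
  apply: cvgD; first exact: cvg_harmonic.
  apply: cvgM; first exact: cvg_cst.
  by apply: cvgB; [exact: approx_hB|exact: cvg_cst].
apply: (cvgr_to_ge lim); exists 0%N => // n _.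
have arith (v p i w z : R) : v <= p + w + z -> p <= v + i -> 0 <= i + w + z.
  by lra.
by have := m_le (Cc_lin t cpsi (c n)); rewrite L_delta// => /arith; exact.
Qed.

(* The minimising sequence of [Q - 2 L] can be taken nonnegative when [L] is
   positive, because [Q |phi| <= Q phi]. *)
Lemma riesz : exists g, [/\ dom g, forall psi, Cc psi -> B psi g = L psi &
  (forall phi, Cc phi -> (forall x, 0 <= phi x) -> 0 <= L phi) ->
     forall x, 0 <= g x].
Proof.
have ex n : exists phi, Cc phi /\ J phi <= m + n.+1%:R^-1.
  have n0 : 0 < n.+1%:R^-1 :> R by rewrite invr_gt0.
  have [_ [phi c <-] /ltW h] := inf_adherent n0 J_inf.
  by exists phi.
have [phi phiP] := choice ex.
have [Lpos|nL] := pselect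
  (forall phi, Cc phi -> (forall x, 0 <= phi x) -> 0 <= L phi); last first.
  have [n|n|g [ga gP]] := @minimizing phi.
  - by have [] := phiP n.
  - by have [] := phiP n.
  by exists g; split=> //; exists phi.
have [n|n|g [ga gP]] := @minimizing (fun n x => `|phi n x|).
- by apply: Cc_norm; have [] := phiP n.
- have [c] := phiP n; apply: le_trans; apply: lerB; first exact: hform_norm.
  have := Lpos _ (Cc_lin (-1) c (Cc_norm c)).
  rewrite Llin//; last exact: Cc_norm.
  have H : forall x, 0 <= -1 * phi n x + `|phi n x|.
    by move=> x; have := ler_norm (phi n x); lra.
  by move=> /(_ H); lra.
exists g; split=> // [|_ x]; first by exists (fun n x => `|phi n x|).
have [_ _ /(_ x) gx] := ga.
by apply: (cvgr_to_ge gx); exists 0%N.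
Qed.

End Riesz.
End FormCompletion.

(** * Pointwise bounds and ground states on connected graphs *)

Section ConnectedGraph.
Context {R : realType} {X : choiceType}.
Variable b : X -> X -> R.
Hypothesis gb : is_graph b.
Implicit Types (f g u v phi psi : X -> R) (q r : X -> R) (x y : X).

Local Notation bd := (bounded_evals b).

Let b_ge0 x y : 0 <= b x y. Proof. by case: gb. Qed.

Let bu_summable u x : Fspace b u -> abs_summable (fun y => b x y * u y).
Proof. by move=> /(FspaceP gb) /(_ x). Qed.

Lemma hform_ge0_shift q r : hform_ge0 b q -> (forall x, 0 <= r x) ->
  hform_ge0 b (q + r).
Proof.
move=> h0 r0 phi c; rewrite hform_shift// addr_ge0 ?h0// rsum_ge0// => x.
by rewrite mulr_ge0// sqr_ge0.
Qed.

Lemma hform_shift_cst q (l : R) phi : Cc phi ->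
  hform b (q + cst l) phi = hform b q phi + l * ell2_dot phi phi.
Proof.
move=> c; rewrite hform_shift// /ell2_dot -rsumZ; last exact: Cc_summable.
by congr (_ + rsum _); apply/funext => x; rewrite expr2.
Qed.

Lemma hform_shift_delta q x phi : Cc phi ->
  hform b (q + \1_[set x]) phi = hform b q phi + phi x ^+ 2.
Proof.
move=> c; rewrite hform_shift//; congr (_ + _).
rewrite (@rsum_single _ _ _ x) ?deltaE ?eqxx ?mul1r// => y yx.
by rewrite deltaE (negPf yx) mul0r.
Qed.

(** Since [h >= 0], the shifted form dominates [l |phi|^2], which dominates [l phi(x)^2], whether or
    not [h] is critical. *)
Lemma bounded_evals_cst q (l : R) : hform_ge0 b q -> 0 < l -> bd (q + cst l).
Proof.
move=> h0 l0 x; exists l^-1; first by rewrite invr_ge0 ltW.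
move=> phi c; rewrite hform_shift_cst// mulrDr mulrA mulVf ?gt_eqF// mul1r.
apply: (@le_trans _ _ (ell2_dot phi phi)).
  rewrite -ell2_normE -real_normK ?num_real// lerXn2r ?nnegrE ?ell2_norm_ge0//.
  exact/ell2_eval/Cc_ell2.
by rewrite lerDr mulr_ge0 ?invr_ge0 ?h0// ltW.
Qed.

(** For [u >= 0] all neighbours enter the sum with the same sign, so a single one can be kept. *)
Lemma superharmonic_step q u x y : Fspace b u -> (forall z, 0 <= u z) ->
  0 <= Hop b q u x -> b x y * u y <= (deg b x + q x) * u x.
Proof.
move=> Fu u0; rewrite HopE// subr_ge0; apply: le_trans.
apply: (@le_rsum1 _ _ (fun y => b x y * u y)); last exact: bu_summable.
by move=> z; rewrite mulr_ge0.
Qed.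

Hypothesis cb : connected_graph b.

(** [superharmonic_step] is iterated along a path. The constant depends on the path and on [q] but
    not on [u], which allows its use on a whole family of Green functions. *)
Lemma harnack q x y : hform_ge0 b q -> exists2 C : R, 0 <= C & forall u,
  Fspace b u -> (forall z, 0 <= u z) -> (forall z, 0 <= Hop b q u z) ->
  u y <= C * u x.
Proof.
move=> h0; have [s [sp <-]] := cb x y.
elim: s x sp => [|z s IH] x /= => [_|/andP[xz /IH[C C0 CP]]].
  by exists 1 => // u _ _ _; rewrite mul1r.
exists (C * ((deg b x + q x) / b x z)).
  by rewrite mulr_ge0// divr_ge0// potential_ge0.
move=> u Fu u0 Hu; apply: le_trans (CP u Fu u0 Hu) _.
rewrite -mulrA ler_wpM2l// mulrAC ler_pdivlMr// mulrC.
exact: superharmonic_step.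
Qed.

(** By Harnack, a zero at one vertex spreads to every vertex. *)
Lemma superharmonic_gt0 q u : hform_ge0 b q -> positive u ->
  Fspace b u -> (forall z, 0 <= Hop b q u z) -> forall x, 0 < u x.
Proof.
move=> h0 [u0 [y uy]] Fu Hu x; have [C C0 CP] := harnack x y h0.
rewrite lt_neqAle u0 andbT eq_sym; apply: contra_neqN uy => /eqP ux.
by apply/eqP; rewrite eq_le u0 andbT (le_trans (CP u Fu u0 Hu))// ux mulr0.
Qed.

Section Fixed.
Variable q : X -> R.
Hypothesis h0 : hform_ge0 b q.

(** [weighted_sum_le] controls each neighbour of a vertex by the value there and the energy; a path
    is followed from [x] to [y]. The summand 1 in the constant carries the energy term along. *)
Lemma pointwise_bound x y : exists2 C : R, 0 <= C & forall phi, Cc phi ->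
  `|phi y| <= C * (`|phi x| + Num.sqrt (hform b q phi)).
Proof.
have [s [sp <-]] := cb x y.
elim: s x sp => [|z s IH] x /= => [_|/andP[xz /IH[C C0 CP]]].
  by exists 1 => // phi c; rewrite mul1r lerDl sqrtr_ge0.
have d0 := potential_ge0 gb h0 x; set d := deg b x + q x in d0.
have K0 : 0 <= (d + Num.sqrt d) / b x z.
  by rewrite divr_ge0// addr_ge0// sqrtr_ge0.
exists (C * ((d + Num.sqrt d) / b x z + 1)).
  by rewrite mulr_ge0// addr_ge0.
move=> phi c; apply: le_trans (CP phi c) _.
rewrite -mulrA ler_wpM2l// mulrDl mul1r lerD//; last by rewrite lerDr.
rewrite mulrAC ler_pdivlMr// mulrC.
apply: (@le_trans _ _ (rsum (fun y => b x y * `|phi y|))).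
  apply: (@le_rsum1 _ _ (fun y => b x y * `|phi y|)) => [y'|].
    by rewrite mulr_ge0.
  exact/bu_summable/Cc_Fspace/Cc_norm.
apply: le_trans (weighted_sum_le gb h0 x c) _; rewrite -/d.
have := normr_ge0 (phi x); have := sqrtr_ge0 (hform b q phi).
by have := sqrtr_ge0 d; nra.
Qed.

Lemma bounded_evals1 o (C : R) :
  (forall phi, Cc phi -> phi o ^+ 2 <= C * hform b q phi) -> bd q.
Proof.
move=> CP x; have [K K0 KP] := pointwise_bound o x.
exists (2 * K ^+ 2 * (`|C| + 1)).
  by rewrite mulr_ge0 ?addr_ge0// mulr_ge0// sqr_ge0.
move=> phi c; have H0 := h0 c; have := KP phi c.
rewrite -[phi x ^+ 2]real_normK ?num_real// => le.
have CH : `|phi o| ^+ 2 <= `|C| * hform b q phi.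
  rewrite real_normK ?num_real//; apply: le_trans (CP phi c) _.
  by rewrite ler_wpM2r// ler_norm.
apply: (@le_trans _ _ ((K * (`|phi o| + Num.sqrt (hform b q phi))) ^+ 2)).
  rewrite lerXn2r// nnegrE mulr_ge0// addr_ge0// sqrtr_ge0//.
have := sqr_sqrtr H0; set s := Num.sqrt _ => s2.
rewrite exprMn [leRHS](_ : _ = K ^+ 2 * (2 * (`|C| * hform b q phi + s ^+ 2))).
  rewrite ler_wpM2l ?sqr_ge0//.
  by have := sqr_ge0 (`|phi o| - s); nra.
by rewrite s2; ring.
Qed.

(** The form of [q + 1_o] contains [phi(o)^2], so evaluation at [o] is bounded by construction and
    all others follow by [pointwise_bound]. This makes [D_{h,o}] accessible for critical [h] too. *)
Lemma bounded_evals_delta o : bd (q + \1_[set o]).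
Proof.
have h0' : hform_ge0 b (q + \1_[set o]).
  by apply: hform_ge0_shift => // x; rewrite deltaE ler0n.
move=> x; have [K K0 KP] := pointwise_bound o x.
exists (2 * K ^+ 2); first by rewrite mulr_ge0// sqr_ge0.
move=> phi c; have H0 := h0 c; have := KP phi c.
rewrite hform_shift_delta// -[phi x ^+ 2]real_normK ?num_real//.
rewrite -[phi o ^+ 2]real_normK ?num_real// => le.
apply: (@le_trans _ _ ((K * (`|phi o| + Num.sqrt (hform b q phi))) ^+ 2)).
  rewrite lerXn2r// nnegrE mulr_ge0// addr_ge0// sqrtr_ge0//.
have := sqr_sqrtr H0; set s := Num.sqrt _ => s2.
rewrite exprMn [leRHS](_ : _ = K ^+ 2 * (2 * (s ^+ 2 + `|phi o| ^+ 2))); last first.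
  by rewrite s2; ring.
rewrite ler_wpM2l ?sqr_ge0//.
by have := sqr_ge0 (`|phi o| - s); nra.
Qed.

(** A weight carried by one vertex is enough. On an empty [X] the bounds hold vacuously while no
    positive weight exists, hence the clause on nonemptiness. *)
Lemma subcriticalP : subcritical b q <-> (exists x : X, True) /\ bd q.
Proof.
split=> [[w [w0 [x wx]] wP]|[[x _] bq]].
  split; first by exists x.
  have wxp : 0 < w x by rewrite lt_neqAle eq_sym wx w0.
  apply: (@bounded_evals1 x (w x)^-1) => phi c.
  rewrite mulrC ler_pdivlMr// mulrC; apply: le_trans (wP phi c).
  apply: (@le_rsum1 _ _ (fun x => w x * phi x ^+ 2)) => [y|].
    by rewrite mulr_ge0// sqr_ge0.
  rewrite (_ : (fun _ => _) = (fun x => phi x * (w x * phi x))).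
    exact: Cc_summable.
  by apply/funext => y; ring.
have [C C0 CP] := bq x; have C1 : 0 < C + 1 by rewrite ltr_wpDl.
exists (fun y => (C + 1)^-1 * \1_[set x] y).
  split=> [y|]; first by rewrite mulr_ge0 ?invr_ge0 ?(ltW C1)// deltaE ler0n.
  by exists x; rewrite deltaE eqxx mulr1 invr_eq0 gt_eqF.
move=> phi c; rewrite (@rsum_single _ _ _ x) => [|y yx].
  rewrite deltaE eqxx mulr1 mulrC ler_pdivrMr// mulrC (le_trans (CP _ c))//.
  by rewrite ler_wpM2r ?h0// lerDl.
by rewrite deltaE (negPf yx) mulr0 mul0r.
Qed.

Let cap_lb x : has_lbound [set hform b q phi | phi in [set phi | Cc phi /\ phi x = 1]].
Proof. by exists 0 => _ [phi [c _] <-]; exact: h0. Qed.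

(** By homogeneity, [capacity b q x >= c > 0] is the bound [phi(x)^2 <= c^-1 h(phi)]. *)
Lemma capacityP : (forall x, 0 < capacity b q x) <-> bd q.
Proof.
split=> [cap x|bq x].
  exists (capacity b q x)^-1; first by rewrite invr_ge0 ltW.
  move=> phi c; rewrite mulrC ler_pdivlMr// mulrC.
  have [->|px] := eqVneq (phi x) 0; first by rewrite expr0n mulr0 h0.
  rewrite -ler_pdivlMr; last by rewrite exprn_even_gt0.
  have c' := CcZ (phi x)^-1 c.
  apply: ge_inf => //; exists (fun y => (phi x)^-1 * phi y).
    by split=> //; rewrite mulVf.
  have := hformD gb q (phi x)^-1 c (@Cc0 R X).
  rewrite hB0r// hform0// mulr0 !addr0 exprVn mulrC => <-.
  by congr (hform b q _); apply/funext => y; rewrite addr0.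
have [C C0 CP] := bq x; have C1 : 0 < C + 1 by rewrite ltr_wpDl.
apply: (@lt_le_trans _ _ (C + 1)^-1); first by rewrite invr_gt0.
apply: lb_le_inf.
  exists (hform b q \1_[set x]), \1_[set x] => //.
  by split; [exact: Cc_delta|rewrite deltaE eqxx].
move=> _ [phi [c px] <-]; rewrite -[leLHS]mul1r ler_pdivrMr// mulrC.
rewrite -[leLHS](_ : phi x ^+ 2 = 1); last by rewrite px expr1n.
by rewrite (le_trans (CP _ c))// ler_wpM2r ?h0// lerDl.
Qed.

(** By [bounded_evals1] the bound fails at the prescribed vertex for every constant. A function
    violating it with constant [n+1] is scaled to the value 1 at [x] and replaced by its absolute
    value. *)
Lemma not_bounded_evals x : ~ bd q -> exists phi : nat -> X -> R,
  forall n, [/\ Cc (phi n), forall y, 0 <= phi n y, phi n x = 1 &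
    hform b q (phi n) <= n.+1%:R^-1].
Proof.
move=> nb; suff ex n : exists phi : X -> R, [/\ Cc phi, forall y, 0 <= phi y,
    phi x = 1 & hform b q phi <= n.+1%:R^-1].
  by have [phi phiP] := choice ex; exists phi.
apply: contrapT => ne; apply: nb.
apply: (@bounded_evals1 x n.+1%:R) => phi c.
have [->|px] := eqVneq (phi x) 0; first by rewrite expr0n mulr_ge0// h0.
rewrite leNgt; apply/negP => lt; apply: ne.
have c' := CcZ (phi x)^-1 c.
exists (fun y => `|(phi x)^-1 * phi y|); split=> //.
- exact: Cc_norm.
- by rewrite mulVf// normr1.
apply: le_trans (hform_norm gb _ c') _.
have := hformD gb q (phi x)^-1 c (@Cc0 R X).
rewrite hB0r// hform0// mulr0 !addr0.
rewrite (_ : (fun _ => _) = (fun y => (phi x)^-1 * phi y)) => [->|]; last first.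
  by apply/funext => y; rewrite addr0.
rewrite exprVn mulrC ler_pdivrMr ?exprn_even_gt0// mulrC ler_pdivlMr//.
by rewrite mulrC ltW.
Qed.

(* A one-edge version of the ground state representation: for superharmonic
   [u > 0] one has [(deg x + q x) phi(x)^2 >= sum_z b(x,z) u(z)/u(x) phi(x)^2],
   and pairing (x,z) with (z,x) produces a square. *)
Lemma picone u phi x y : (forall z, 0 < u z) -> Fspace b u ->
  (forall z, 0 <= Hop b q u z) -> Cc phi ->
  b x y * (u x * u y) * (phi x / u x - phi y / u y) ^+ 2 <= 2 * hform b q phi.
Proof.
move=> u0 Fu Hu c; have /CcP[K0 K0P] := c.
(* [x] and [y] are added to the support so that their term occurs in the finite double sum. *)
pose K := (K0 `|` [fset x; y])%fset.
have KP z : z \notin K -> phi z = 0.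
  by rewrite !inE !negb_or => /andP[/K0P].
have xK : x \in K by rewrite !inE eqxx orbT.
have yK : y \in K by rewrite !inE eqxx !orbT.
have un0 z : u z != 0 by rewrite gt_eqF.
pose a (s t : X) := b s t * (u t / u s * phi s ^+ 2 - phi s * phi t).
have hE : \sum_(s <- K) \sum_(t <- K) a s t <= hform b q phi.
  rewrite hform_hB// /hB (@rsum_fin _ _ _ K) => [|z /KP ->]; last by rewrite mul0r.
  apply: ler_sum => s _; rewrite HopE//; last exact: Cc_Fspace.
  rewrite (@rsum_fin _ _ (fun t => b s t * phi t) K) => [|z /KP ->]; last first.
    by rewrite mulr0.
  rewrite mulrBr mulr_sumr.
  have : \sum_(t <- K) b s t * u t <= (deg b s + q s) * u s.
    have := Hu s; rewrite HopE// subr_ge0; apply: le_trans.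
    apply: (@fsum_le_rsum _ _ (fun t => b s t * u t)) => [z|].
      by rewrite mulr_ge0// ltW.
    exact: bu_summable.
  rewrite -ler_pdivrMr// mulr_suml => le.
  rewrite (_ : \sum_(t <- K) a s t = phi s ^+ 2 * \sum_(t <- K) b s t * u t / u s -
      \sum_(t <- K) phi s * (b s t * phi t)).
    rewrite lerB// [leRHS](_ : _ = phi s ^+ 2 * (deg b s + q s)); last by ring.
    by rewrite ler_wpM2l// sqr_ge0.
  rewrite mulr_sumr -sumrB; apply: eq_bigr => t _; rewrite /a; ring.
have sq s t : a s t + a t s = b s t * (u s * u t) * (phi s / u s - phi t / u t) ^+ 2.
  rewrite /a (_ : b t s = b s t); last by case: gb.
  by field; rewrite !un0.
have E : 2 * (\sum_(s <- K) \sum_(t <- K) a s t) =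
    \sum_(s <- K) \sum_(t <- K) (a s t + a t s).
  rewrite mulrDl mul1r [X in _ + X]exchange_big/= -big_split/=.
  by apply: eq_bigr => s _; rewrite -big_split.
apply: (@le_trans _ _ (\sum_(s <- K) \sum_(t <- K) (a s t + a t s))); last first.
  by rewrite -E ler_wpM2l.
have a0 s t : 0 <= a s t + a t s.
  by rewrite sq mulr_ge0 ?sqr_ge0// mulr_ge0// mulr_ge0// ltW.
(* All terms are nonnegative, and only that of the ordered pair [(x, y)] is kept. *)
rewrite -sq (big_rem x)//= (big_rem y)//= -!addrA addrA lerDl.
by rewrite addr_ge0//; apply: sumr_ge0 => s _ //; apply: sumr_ge0.
Qed.

Lemma null_seq_ratio u (phi : nat -> X -> R) o : (forall z, 0 < u z) -> Fspace b u ->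
  (forall z, 0 <= Hop b q u z) ->
  (forall n, [/\ Cc (phi n), forall y, 0 <= phi n y, phi n o = 1 &
    hform b q (phi n) <= n.+1%:R^-1]) ->
  forall x, phi n x @[n --> \oo] --> u x / u o.
Proof.
move=> u0 Fu Hu phiP x.
have un0 z : u z != 0 by rewrite gt_eqF.
suff H : phi n x / u x @[n --> \oo] --> (u o)^-1.
  have : phi n x / u x * u x @[n --> \oo] --> (u o)^-1 * u x.
    exact: cvgM H (cvg_cst _).
  by rewrite mulrC; under eq_cvg do rewrite mulfVK//.
have H0 : phi n o / u o @[n --> \oo] --> (u o)^-1.
  have E n : phi n o / u o = (u o)^-1 by have [_ _ -> _] := phiP n; rewrite mul1r.
  by under eq_cvg do rewrite E; exact: cvg_cst.
have [s [sp <-]] := cb o x.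
have : forall w, path (fun z w => 0 < b z w) w s ->
    phi n w / u w @[n --> \oo] --> (u o)^-1 ->
    phi n (last w s) / u (last w s) @[n --> \oo] --> (u o)^-1; last exact.
elim: s {sp} => [//|z s IH] w /= /andP[wz sp] Hw; apply: IH => //.
have c0 : 0 < b w z * (u w * u z) by rewrite mulr_gt0// mulr_gt0.
have D0 : phi n w / u w - phi n z / u z @[n --> \oo] --> (0 : R).
  have hc : Num.sqrt (2 / (b w z * (u w * u z)) * n.+1%:R^-1) @[n --> \oo] -->
      Num.sqrt (2 / (b w z * (u w * u z)) * 0).
    apply: continuous_cvg; first exact: sqrt_continuous.
    by apply: cvgM; [exact: cvg_cst|exact: cvg_harmonic].
  rewrite mulr0 sqrtr0 in hc.
  apply: norm_cvg0; apply: (squeeze_cvgr _ (cvg_cst 0) hc).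
  exists 0%N => // n _ /=; rewrite normr_ge0/= -sqrtr_sqr ler_wsqrtr//.
  have [c _ _ hn] := phiP n; rewrite mulrAC ler_pdivlMr// mulrC.
  apply: le_trans (picone w z u0 Fu Hu c) _.
  by rewrite ler_wpM2l.
have : phi n w / u w - (phi n w / u w - phi n z / u z) @[n --> \oo] -->
  (u o)^-1 - 0 by exact: cvgB Hw D0.
by rewrite subr0; under eq_cvg do rewrite subKr.
Qed.

End Fixed.
End ConnectedGraph.

(** * Semigroups generated by m-accretive operators *)

(** [P^(n+1) f - Q^(n+1) f = P (P^n f - Q^n f) + Q^n (P f - Q f)], where commutation moves [P] past
    [Q^n]. Powers of [Q] are bounded only below [n], so [Q] may belong to a semigroup bounded on
    bounded time intervals. *)
Lemma telescope_le {R : realType} {E : normedModType R} (P Q : E -> E) (K : R) (f : E) :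
  (forall u v, P (u - v) = P u - P v) -> (forall u v, Q (u - v) = Q u - Q v) ->
  (forall u, `|P u| <= `|u|) -> (forall u, P (Q u) = Q (P u)) ->
  forall n, (forall j u, (j < n)%N -> `|iter j Q u| <= K * `|u|) ->
  `|iter n P f - iter n Q f| <= n%:R * (K * `|P f - Q f|).
Proof.
move=> PB QB Pc PQ; have iB j u v : iter j Q (u - v) = iter j Q u - iter j Q v.
  by elim: j => //= j ->; rewrite QB.
have PiQ j u : P (iter j Q u) = iter j Q (P u).
  by elim: j => //= j IH; rewrite PQ IH.
elim=> [|n IH] nK; first by rewrite subrr normr0 mul0r.
rewrite (_ : _ - _ = P (iter n P f - iter n Q f) + iter n Q (P f - Q f)); last first.
  by rewrite PB iB PiQ -iterSr /= addrA subrK.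
rewrite (le_trans (ler_normD _ _))// -natr1 mulrDl mul1r lerD//.
  by rewrite (le_trans (Pc _))// IH// => j u jn; apply: nK; rewrite ltnS ltnW.
exact: nK.
Qed.

Lemma sub_split {V : zmodType} (a b c d : V) :
  a - b = (c - d) + ((a - c) - (b - d)).
Proof. by rewrite opprB addrACA [c + _]addrC subrK addKr. Qed.

Section AccretiveOperator.
Context {R : realType} {E : completeNormedModType R}.
Variable A : E -> E -> Prop.
Implicit Types (f g h u v w : E) (r s t e : R).

(** The Lumer-Phillips conditions for an operator given by its graph: linearity, accretivity,
    surjectivity of [1 + s A], dense domain. *)
Definition m_accretive : Prop :=
  [/\ forall (a : R) u v u' v', A u v -> A u' v' ->
        A (a *: u + u') (a *: v + v'),
      forall s u v, 0 < s -> A u v -> `|u| <= `|u + s *: v|,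
      forall s f, 0 < s -> exists u v, A u v /\ u + s *: v = f &
      forall f e, 0 < e -> exists u v, A u v /\ `|f - u| < e].

Hypothesis mA : m_accretive.

Let A_lin (a : R) u v u' v' : A u v -> A u' v' -> A (a *: u + u') (a *: v + v').
Proof. by case: mA => + _ _ _; exact. Qed.

Let A_acc s u v : 0 < s -> A u v -> `|u| <= `|u + s *: v|.
Proof. by case: mA => _ + _ _; exact. Qed.

Let A_surj s f : 0 < s -> exists u v, A u v /\ u + s *: v = f.
Proof. by case: mA => _ _ + _; exact. Qed.

Let A_dense f e : 0 < e -> exists u v, A u v /\ `|f - u| < e.
Proof. by case: mA => _ _ _; exact. Qed.

Let A_sub u v u' v' : A u v -> A u' v' -> A (u - u') (v - v').
Proof.
move=> a1 a2; have := A_lin (-1) a2 a1.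
by rewrite !scaleN1r ![- _ + _]addrC.
Qed.

(* The resolvent (1 + s A)^-1, and the identity at [s = 0]. *)
Definition J s f : E :=
  if 0 < s then xget 0 [set u | exists v, A u v /\ u + s *: v = f] else f.

Lemma J_unique s f u v : 0 < s -> A u v -> u + s *: v = f -> J s f = u.
Proof.
move=> s0 Auv uvf; rewrite /J s0; case: xgetP => [w _ [z [Awz wzf]]|]; last first.
  by move=> /(_ u); case; exists v.
apply/eqP; rewrite -subr_eq0 -normr_le0.
rewrite (le_trans (A_acc s0 (A_sub Awz Auv)))// scalerBr.
by rewrite addrACA -opprD wzf uvf subrr normr0.
Qed.

Lemma J_spec s f : 0 < s -> exists v, A (J s f) v /\ J s f + s *: v = f.
Proof.
move=> s0; have [u [v [Auv uvf]]] := A_surj f s0.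
by rewrite (J_unique s0 Auv uvf); exists v.
Qed.

Lemma J0 f : J 0 f = f. Proof. by rewrite /J ltxx. Qed.

Lemma J_lin (a : R) s f g : 0 <= s -> J s (a *: f + g) = a *: J s f + J s g.
Proof.
rewrite le_eqVlt => /predU1P[<-|s0]; first by rewrite !J0.
have [v [Av <-]] := J_spec f s0; have [w [Aw <-]] := J_spec g s0.
rewrite (J_unique s0 Av erefl) (J_unique s0 Aw erefl).
apply: J_unique s0 (A_lin a Av Aw) _.
by rewrite !scalerDr !scalerA (mulrC s) addrACA.
Qed.

Lemma JB s f g : 0 <= s -> J s (f - g) = J s f - J s g.
Proof. by move=> s0; rewrite addrC -scaleN1r J_lin// scaleN1r addrC. Qed.

Lemma J_contr s f : 0 <= s -> `|J s f| <= `|f|.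
Proof.
rewrite le_eqVlt => /predU1P[<-|s0]; first by rewrite J0.
by have [v [Av {2}<-]] := J_spec f s0; exact: A_acc.
Qed.

(** [J s] preserves the graph of [A], and [1 - J s = s J s A] on the domain. The error estimates
    below combine this with contractivity. *)
Lemma J_sub s u v : 0 <= s -> A u v -> A (J s u) (J s v) /\ u - J s u = s *: J s v.
Proof.
rewrite le_eqVlt => /predU1P[<-|s0] Auv.
  by rewrite !J0 subrr scale0r.
have [z [Az zE]] := J_spec v s0.
have Aw : A (u - s *: J s v) (J s v).
  have := A_lin (- s) Az Auv; rewrite !scaleNr ![- _ + _]addrC.
  by rewrite -[in X in A _ X]zE addrK.
have JE : J s u = u - s *: J s v.
  by apply: J_unique s0 Aw _; rewrite subrK.
by rewrite JE; split=> //; rewrite subKr.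
Qed.

Lemma J_comm r s f : 0 <= r -> 0 <= s -> J r (J s f) = J s (J r f).
Proof.
move=> r0; rewrite le_eqVlt => /predU1P[<-|s0]; first by rewrite !J0.
have [v [Av vE]] := J_spec f s0; have [Ar _] := J_sub r0 Av.
apply/esym; apply: J_unique s0 Ar _.
by rewrite -[in RHS]vE [in RHS]addrC J_lin// addrC.
Qed.

Lemma J_dist s u v : 0 <= s -> A u v -> `|J s u - u| <= s * `|v|.
Proof.
move=> s0 Auv; have [_] := J_sub s0 Auv; rewrite distrC => ->.
by rewrite normrZ ger0_norm// ler_wpM2l// J_contr.
Qed.

(** On the domain this is [J_dist]; density and contractivity extend it to every [f]. *)
Lemma J_id f e : 0 < e -> exists2 d, 0 < d &
  forall s, 0 <= s -> s <= d -> `|J s f - f| < e.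
Proof.
move=> e0; have [u [v [Auv fu]]] := A_dense f (divr_gt0 e0 (ltr0n _ 4)).
have v1 : 0 < `|v| + 1 by rewrite ltr_wpDl.
exists (e / 4 / (`|v| + 1)); first by rewrite divr_gt0// divr_gt0.
set d := _ / (_ + 1) => s s0 sd.
have sv : s * `|v| <= e / 4.
  apply: le_trans (ler_wpM2r (normr_ge0 _) sd) _.
  by rewrite /d -mulrA ler_piMr ?divr_ge0 ?(ltW e0)// mulrC ler_pdivrMr// mul1r lerDl.
rewrite (_ : J s f - f = J s (f - u) + (J s u - u) - (f - u)); last first.
  by rewrite JB// addrA subrK opprB addrA subrK.
apply: le_lt_trans (ler_normB _ _) _.
have := ler_normD (J s (f - u)) (J s u - u).
have := J_contr (f - u) s0; have := J_dist s0 Auv.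
move: fu sv; lra.
Qed.

(* J_{r+s} - J_r J_s = r s J_r J_s J_{r+s} A^2 *)
Lemma J_split r s f g h : 0 <= r -> 0 <= s -> A f g -> A g h ->
  `|J (r + s) f - J r (J s f)| <= r * s * `|h|.
Proof.
move=> r0 s0 Afg Agh; have rs0 := addr_ge0 r0 s0.
have [Aw fw] := J_sub rs0 Afg; have [Aw1 _] := J_sub rs0 Agh.
set w := J (r + s) f in Aw fw *; set w1 := J (r + s) g in Aw Aw1 fw.
set w2 := J (r + s) h in Aw1.
have Ju t u v : 0 <= t -> A u v -> J t (t *: v + u) = u.
  rewrite le_eqVlt => /predU1P[<-|t0] Auv; first by rewrite J0 scale0r add0r.
  by apply: J_unique t0 Auv _; rewrite addrC.
(* [w = J r J s (1 + s A)(1 + r A) w], and the product expands to [(1 + (r + s) A) w + r s A^2 w],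
   that is [f + r s w2]. *)
have E1 : w = J r (J s (r *: (s *: w2 + w1) + (s *: w1 + w))).
  by rewrite J_lin// !Ju.
have E2 : r *: (s *: w2 + w1) + (s *: w1 + w) = (r * s) *: w2 + f.
  rewrite scalerDr scalerA -addrA; congr (_ + _); rewrite addrA -scalerDl -fw.
  by rewrite subrK.
rewrite {1}E1 E2 !J_lin// addrK normrZ ger0_norm ?mulr_ge0//.
rewrite ler_wpM2l ?mulr_ge0//.
by rewrite (le_trans (J_contr _ r0))// (le_trans (J_contr _ s0))// J_contr.
Qed.

Lemma iter_J_lin n (a : R) s f g : 0 <= s ->
  iter n (J s) (a *: f + g) = a *: iter n (J s) f + iter n (J s) g.
Proof. by move=> s0; elim: n => //= n ->; rewrite J_lin. Qed.

Lemma iter_JB n s f g : 0 <= s ->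
  iter n (J s) (f - g) = iter n (J s) f - iter n (J s) g.
Proof. by move=> s0; elim: n => //= n ->; rewrite JB. Qed.

Lemma iter_J_contr n s f : 0 <= s -> `|iter n (J s) f| <= `|f|.
Proof.
by move=> s0; elim: n => //= n; apply: le_trans; exact: J_contr.
Qed.

Lemma iter_J_comm m r s f : 0 <= r -> 0 <= s ->
  iter m (J r) (J s f) = J s (iter m (J r) f).
Proof. by move=> r0 s0; elim: m => //= m ->; rewrite J_comm. Qed.

(* Implicit Euler scheme with 2^k steps; dyadic steps make consecutive
   approximations comparable through [J_split]. *)
Definition euler (k : nat) t f : E := iter (2 ^ k) (J (t / 2 ^+ k)) f.

Let dy_ge0 k t : 0 <= t -> 0 <= t / 2 ^+ k.
Proof. by move=> t0; rewrite divr_ge0// exprn_ge0. Qed.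

Let dy_mul k t : (2 ^ k)%:R * (t / 2 ^+ k) = t.
Proof. by rewrite natrX mulrC divfK// expf_neq0. Qed.

Lemma iter_double n (F : E -> E) f : iter (n * 2) F f = iter n (fun u => F (F u)) f.
Proof. by elim: n f => //= n IH f; rewrite IH. Qed.

(** A step of length [2 s] is compared with two steps of length [s = t / 2^(k+1)]: there are [2^k]
    local errors, each at most [s^2 |h|]. *)
Lemma euler_step k t f g h : 0 <= t -> A f g -> A g h ->
  `|euler k t f - euler k.+1 t f| <= t ^+ 2 * `|h| * (2 ^+ k)^-1.
Proof.
move=> t0 Afg Agh; rewrite /euler expnSr iter_double.
set s := t / 2 ^+ k.+1; have s0 : 0 <= s by exact: dy_ge0.
have ss : t / 2 ^+ k = s + s.
  by rewrite /s exprS; field; rewrite expf_neq0.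
have ts : 0 <= t / 2 ^+ k by exact: dy_ge0.
have := @telescope_le R E (J (t / 2 ^+ k)) (fun u => J s (J s u)) 1 f.
move=> /(_ _ _ _ _ (2 ^ k)%N _) /le_trans; apply.
- by move=> u v; exact: JB.
- by move=> u v; rewrite !JB.
- by move=> u; exact: J_contr.
- by move=> u; rewrite J_comm// [in LHS](J_comm _ ts)//.
- by move=> j u _; rewrite -iter_double mul1r; exact: iter_J_contr.
rewrite mul1r {1}ss; apply: le_trans (ler_wpM2l (ler0n _ _) (J_split s0 s0 Afg Agh)) _.
rewrite [leLHS](_ : _ = 4^-1 * (t ^+ 2 * `|h| * (2 ^+ k)^-1)); last first.
  by rewrite /s natrX exprS; field; rewrite expf_neq0.
by rewrite ler_piMl ?invf_le1 ?mulr_ge0 ?invr_ge0 ?exprn_ge0// ler1n.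
Qed.

Lemma euler_cauchy k j t f g h : 0 <= t -> A f g -> A g h ->
  `|euler k t f - euler (k + j) t f| <= 2 * (t ^+ 2 * `|h|) * (2 ^+ k)^-1.
Proof.
move=> t0 Afg Agh; set c := t ^+ 2 * `|h|.
have c0 : 0 <= c by rewrite mulr_ge0// exprn_ge0.
(* The exact geometric sum is kept in the inequality claimed next, so that the induction on [j]
   closes. *)
have two i : 0 < (2 ^+ i)^-1 :> R by rewrite invr_gt0 exprn_gt0.
suff : `|euler k t f - euler (k + j) t f| <=
    2 * c * ((2 ^+ k)^-1 - (2 ^+ (k + j))^-1).
  move=> /le_trans; apply; rewrite ler_wpM2l ?mulr_ge0// gerBl ltW//.
elim: j => [|j IH]; first by rewrite addn0 !subrr normr0 mulr0.
rewrite -[_ - _](subrKA (euler (k + j) t f)) addnS.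
apply: le_trans (ler_normD _ _) _; apply: le_trans (lerD IH (euler_step _ t0 Afg Agh)) _.
rewrite -/c [in leRHS]exprS invfM.
by rewrite le_eqVlt; apply/orP; left; apply/eqP; field; rewrite !expf_neq0.
Qed.

Lemma euler_contr k t f : 0 <= t -> `|euler k t f| <= `|f|.
Proof. by move=> t0; apply: iter_J_contr; exact: dy_ge0. Qed.

Lemma eulerB k t f g : 0 <= t -> euler k t (f - g) = euler k t f - euler k t g.
Proof. by move=> t0; apply: iter_JB; exact: dy_ge0. Qed.

(** The domain of [A^2] is a core: [J s] with small [s] maps the domain into it and, commuting with
    [A], moves both [u] and [v] only a little. *)
Lemma graph_core u v e : 0 < e -> A u v -> exists u' v' w',
  [/\ A u' v', A v' w', `|u - u'| < e & `|v - v'| < e].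
Proof.
move=> e0 Auv; have [d0 d0p h0] := J_id u e0; have [d1 d1p h1] := J_id v e0.
have s0 : 0 < Num.min d0 d1 by rewrite lt_min d0p.
have [w [Aw _]] := J_spec v s0; have [Auv' _] := J_sub (ltW s0) Auv.
exists (J (Num.min d0 d1) u), (J (Num.min d0 d1) v), w; split=> //.
  by rewrite distrC h0 ?(ltW s0)// ge_min lexx.
by rewrite distrC h1 ?(ltW s0)// ge_min lexx orbT.
Qed.

Lemma core_dense f e : 0 < e -> exists u v w, [/\ A u v, A v w & `|f - u| < e].
Proof.
move=> e0; have [u [v [Auv fu]]] := A_dense f (divr_gt0 e0 (ltr0n _ 2)).
have [u' [v' [w' [A1 A2 uu' _]]]] := graph_core (divr_gt0 e0 (ltr0n _ 2)) Auv.
exists u', v', w'; split=> //; rewrite -(subrKA u).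
by apply: le_lt_trans (ler_normD _ _) _; move: fu uu'; lra.
Qed.

Lemma pow2_small (c e : R) : 0 < e ->
  exists k, forall n, (k <= n)%N -> c * (2 ^+ n)^-1 < e.
Proof.
move=> e0; have c1 : 0 < `|c| + 1 by rewrite ltr_wpDl.
have := @cvg_harmonic R => /cvgr_epsP /(_ _ (divr_gt0 e0 c1)) [k kP].
exists k => n /kP; rewrite subr0 ger0_norm ?invr_ge0// ltr_pdivlMr// => h.
apply: le_lt_trans h; rewrite mulrC.
apply: (@le_trans _ _ ((2 ^+ n)^-1 * (`|c| + 1))).
  rewrite ler_wpM2l ?invr_ge0 ?exprn_ge0//.
  by rewrite (le_trans (ler_norm c))// lerDl.
rewrite ler_wpM2r ?(ltW c1)// lef_pV2 ?posrE ?exprn_gt0// -natrX ler_nat.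
exact: ltn_expl.
Qed.

Definition T t f : E := lim (euler k t f @[k --> \oo]).

Lemma euler_cvg t f : 0 <= t -> euler k t f @[k --> \oo] --> T t f.
Proof.
move=> t0.
suff [l lP] : exists l : E, euler k t f @[k --> \oo] --> l.
  by rewrite /T (cvg_lim _ lP).
apply: cauchy_seq_cvg => e e0.
have [u [v [w [A1 A2 fu]]]] := core_dense f (divr_gt0 e0 (ltr0n _ 8)).
have [k kP] := pow2_small (2 * (t ^+ 2 * `|w|)) (divr_gt0 e0 (ltr0n _ 4)).
have key i : (k <= i)%N -> `|euler k t f - euler i t f| < e / 2.
  move=> ki; rewrite (_ : _ - _ = (euler k t u - euler i t u) +
      (euler k t (f - u) - euler i t (f - u))); last first.
    by rewrite !eulerB//; exact: sub_split.
  apply: le_lt_trans (ler_normD _ _) _.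
  have := euler_cauchy k (i - k) t0 A1 A2; rewrite subnKC//.
  have := ler_normB (euler k t (f - u)) (euler i t (f - u)).
  have := euler_contr k (f - u) t0; have := euler_contr i (f - u) t0.
  move: (kP k (leqnn k)) fu; lra.
exists k => m n km kn; rewrite -(subrKA (euler k t f)).
apply: le_lt_trans (ler_normD _ _) _; rewrite [X in X + _]distrC.
by have := key m km; have := key n kn; lra.
Qed.

Arguments euler_cvg {t} f.

Lemma T_lin t (a : R) f g : 0 <= t -> T t (a *: f + g) = a *: T t f + T t g.
Proof.
move=> t0; have := euler_cvg (a *: f + g) t0.
have E0 k : euler k t (a *: f + g) = a *: euler k t f + euler k t g.
  by apply: iter_J_lin; exact: dy_ge0.
under eq_cvg do rewrite E0.
move=> h; apply: (cvg_unique _ h) => //.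
by apply: cvgD; [apply: cvgZr|]; exact: euler_cvg.
Qed.

Lemma TB t f g : 0 <= t -> T t (f - g) = T t f - T t g.
Proof. by move=> t0; rewrite addrC -scaleN1r T_lin// scaleN1r addrC. Qed.

Lemma TZ t (a : R) f : 0 <= t -> T t (a *: f) = a *: T t f.
Proof.
by move=> t0; have := TB f f t0; rewrite !subrr => T0;
  rewrite -[a *: f]addr0 T_lin// T0 addr0.
Qed.

Lemma T_limit_le t f c (u : nat -> E) : 0 <= t ->
  (forall k, `|euler k t f - u k| <= c) -> forall l, u n @[n --> \oo] --> l ->
  `|T t f - l| <= c.
Proof.
move=> t0 uc l ul.
have h : `|euler k t f - u k| @[k --> \oo] --> `|T t f - l|.
  by apply: cvg_norm; apply: cvgB => //; exact: euler_cvg.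
by apply: (cvgr_to_le h); exists 0%N.
Qed.

Lemma T_contr t f : 0 <= t -> `|T t f| <= `|f|.
Proof.
move=> t0; rewrite -[T t f]subr0.
apply: (T_limit_le t0 (u := fun=> 0)); last exact: cvg_cst.
by move=> k; rewrite subr0; exact: euler_contr.
Qed.

Lemma T0 f : T 0 f = f.
Proof.
have := euler_cvg f (lexx 0).
have E0 k : euler k 0 f = f.
  by rewrite /euler mul0r; elim: (2 ^ k)%N => //= n ->; exact: J0.
by under eq_cvg do rewrite E0; move=> h; apply: cvg_unique h (cvg_cst _).
Qed.

Lemma T_dist t f g : 0 <= t -> A f g -> `|T t f - f| <= t * `|g|.
Proof.
move=> t0 Afg; apply: (T_limit_le t0 (u := fun=> f)); last exact: cvg_cst.
move=> k; have s0 := dy_ge0 k t0; rewrite /euler.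
have iid n : iter n (@id E) f = f by elim: n.
rewrite -{2}(iid (2 ^ k)%N).
have := @telescope_le R E (J (t / 2 ^+ k)) id 1 f.
move=> /(_ _ _ _ _ (2 ^ k)%N _) /le_trans; apply => //.
- by move=> u v; exact: JB.
- by move=> u; exact: J_contr.
- by move=> j u _; rewrite mul1r; elim: j.
rewrite mul1r; apply: le_trans (ler_wpM2l (ler0n _ _) (J_dist s0 Afg)) _.
by rewrite mulrA dy_mul.
Qed.

(** A Taylor bound, proved first for [n] implicit Euler steps of length [s]: the step from [n] to
    [n+1] adds an error of at most [(n+1) s^2 |h|]. *)
Lemma T_quad t f g h : 0 <= t -> A f g -> A g h ->
  `|f - T t f - t *: g| <= t ^+ 2 * `|h|.
Proof.
move=> t0 Afg Agh.
have it n s : 0 <= s -> `|iter n (J s) f - (f - (n%:R * s) *: g)| <=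
    (n%:R * s) ^+ 2 * `|h|.
  move=> s0; elim: n => [|n IH] /=.
    by rewrite mul0r scale0r subr0 subrr normr0 expr0n mul0r.
  have [Ah fJ] := J_sub s0 Afg; have Jg := J_dist s0 Agh.
  have ns0 : 0 <= n%:R * s by rewrite mulr_ge0.
  have -> : J s (iter n (J s) f) - (f - (n.+1%:R * s) *: g) =
      J s (iter n (J s) f - (f - (n%:R * s) *: g)) -
      ((n%:R + 1) * s) *: (J s g - g).
    rewrite JB// (_ : J s (f - _) = J s f - (n%:R * s) *: J s g); last first.
      by rewrite addrC -scaleNr J_lin// scaleNr addrC.
    rewrite (_ : J s f = f - s *: J s g); last by rewrite -fJ subKr.
    have -> : f - s *: J s g - (n%:R * s) *: J s g =
        f - ((n%:R + 1) * s) *: J s g.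
      by rewrite -addrA -opprD -scalerDl; congr (_ - _ *: _); ring.
    rewrite -natr1 scalerBr !opprB -!addrA; congr (_ + _).
    by rewrite [RHS]addrCA [X in - f + X]addrC subrK addrC.
  apply: le_trans (ler_normB _ _) _; rewrite normrZ ger0_norm; last first.
    by rewrite mulr_ge0.
  have := J_contr (iter n (J s) f - (f - (n%:R * s) *: g)) s0.
  move=> /le_trans /(_ IH) h1.
  apply: le_trans (lerD h1 (ler_wpM2l _ Jg)) _; first by rewrite mulr_ge0.
  rewrite -natr1; set N : R := n%:R; have N0 : 0 <= N by exact: ler0n.
  rewrite [leLHS](_ : _ = (N ^+ 2 + N + 1) * (s ^+ 2 * `|h|)); last by ring.
  rewrite [leRHS](_ : _ = (N ^+ 2 + 2 * N + 1) * (s ^+ 2 * `|h|)); last by ring.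
  by rewrite ler_wpM2r ?mulr_ge0 ?exprn_ge0//; lra.
rewrite addrAC distrC.
apply: (T_limit_le t0 (u := fun=> f - t *: g)); last exact: cvg_cst.
by move=> k; have := it (2 ^ k)%N _ (dy_ge0 k t0); rewrite dy_mul.
Qed.

Lemma euler_split k r s f g h : 0 <= r -> 0 <= s -> A f g -> A g h ->
  `|euler k (r + s) f - euler k r (euler k s f)| <= r * s * `|h| * (2 ^+ k)^-1.
Proof.
move=> r0 s0 Afg Agh.
have [r0' s0'] := (dy_ge0 k r0, dy_ge0 k s0).
have rs0' : 0 <= (r + s) / 2 ^+ k by rewrite dy_ge0// addr_ge0.
set P := J (r / 2 ^+ k); set Q := J (s / 2 ^+ k).
have iE n u : iter n P (iter n Q u) = iter n (fun u => P (Q u)) u.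
  by elim: n => //= n <-; rewrite /P /Q iter_J_comm.
rewrite /euler -/P -/Q iE.
have := @telescope_le R E (J ((r + s) / 2 ^+ k)) (fun u => P (Q u)) 1 f.
move=> /(_ _ _ _ _ (2 ^ k)%N _) /le_trans; apply.
- by move=> u v; exact: JB.
- by move=> u v; rewrite /P /Q !JB.
- by move=> u; exact: J_contr.
- by move=> u; rewrite /P /Q J_comm// [in LHS](J_comm _ rs0')//.
- move=> j u _; rewrite mul1r; elim: j => //= j; apply: le_trans.
  by rewrite /P /Q (le_trans (J_contr _ _))// J_contr.
rewrite mul1r [X in J X f]mulrDl.
apply: le_trans (ler_wpM2l (ler0n _ _) (J_split r0' s0' Afg Agh)) _.
rewrite le_eqVlt; apply/orP; left; apply/eqP.
by rewrite natrX; field; rewrite expf_neq0.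
Qed.

Lemma dense_eq (F G : E -> E) (M : R) :
  (forall f g, F (f - g) = F f - F g) -> (forall f g, G (f - g) = G f - G g) ->
  (forall f, `|F f| <= M * `|f|) -> (forall f, `|G f| <= M * `|f|) ->
  (forall f g h, A f g -> A g h -> F f = G f) -> F =1 G.
Proof.
move=> FB GB FM GM FG f; apply/eqP; rewrite -subr_eq0 -normr_le0.
rewrite leNgt; apply/negP => d0.
have M1 : 0 < 2 * (`|M| + 1) by rewrite mulr_gt0// ltr_wpDl.
have [u [v [w [A1 A2]]]] := core_dense f (divr_gt0 d0 M1).
rewrite ltr_pdivlMr// ltNge => /negP; apply.
rewrite (_ : F f - G f = F (f - u) - G (f - u)); last first.
  by rewrite FB GB (FG _ _ _ A1 A2) opprB addrA subrK.
apply: le_trans (ler_normB _ _) _.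
have := FM (f - u); have := GM (f - u); have := normr_ge0 (f - u).
by have := ler_norm M; nra.
Qed.

Lemma T_add s t f : 0 <= s -> 0 <= t -> T (s + t) f = T s (T t f).
Proof.
move=> s0 t0; have st0 := addr_ge0 s0 t0.
move: f; apply: (@dense_eq _ _ 1) => [f g|f g|f|f|f g h Afg Agh].
- exact: TB.
- by rewrite !TB.
- by rewrite mul1r T_contr.
- by rewrite mul1r (le_trans (T_contr _ s0))// T_contr.
have c1 := euler_cvg f st0.
have c2 : euler k s (euler k t f) @[k --> \oo] --> T s (T t f).
  apply/cvgr_epsP => e e0; have e2 := divr_gt0 e0 (ltr0n R 2).
  have /cvgr_epsP /(_ _ e2) [k1 kP1] := euler_cvg f t0.
  have /cvgr_epsP /(_ _ e2) [k2 kP2] := euler_cvg (T t f) s0.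
  exists (maxn k1 k2) => n; rewrite geq_max => /andP[n1 n2].
  rewrite -(subrKA (euler n s (T t f))) -eulerB//.
  apply: le_lt_trans (ler_normD _ _) _.
  have := euler_contr n (euler n t f - T t f) s0.
  by have := kP1 n n1; have := kP2 n n2; lra.
have : euler k (s + t) f - euler k s (euler k t f) @[k --> \oo] --> (0 : E).
  apply/cvgr_epsP => e e0; have [k kP] := pow2_small (s * t * `|h|) e0.
  exists k => n /kP; rewrite subr0; apply: le_lt_trans.
  exact: euler_split s0 t0 Afg Agh.
move=> c3; have : euler k (s + t) f - (euler k (s + t) f -
  euler k s (euler k t f)) @[k --> \oo] --> T (s + t) f - 0 by exact: cvgB.
under eq_cvg do rewrite subKr.
by move=> c4; rewrite -(cvg_unique _ c4 c2)// subr0.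
Qed.

(** [T_quad] asks for the domain of [A^2]. A general [f] is replaced by some [u] there, close in
    graph norm, and [T_dist] controls [f - u]. *)
Lemma T_generator f g : A f g ->
  t^-1 *: (f - T t f) @[t --> 0^'+] --> g.
Proof.
move=> Afg; apply/cvgrPdistC_lt => e e0.
have [u [v [w [A1 A2 _ gv]]]] := graph_core (divr_gt0 e0 (ltr0n _ 4)) Afg.
have w1 : 0 < `|w| + 1 by rewrite ltr_wpDl.
near=> t.
have t0 : 0 < t by near: t; exact: nbhs_right_gt.
have tw : t * `|w| < e / 4.
  have : t < e / 4 / (`|w| + 1).
    by near: t; apply: nbhs_right_lt; rewrite !divr_gt0.
  rewrite ltr_pdivlMr//; apply: le_lt_trans.
  by rewrite ler_wpM2l ?(ltW t0)// lerDl.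
rewrite -(ltr_pM2l t0) -{1}(gtr0_norm t0) -normrZ scalerBr scalerA divff ?gt_eqF//.
rewrite scale1r (_ : _ - _ = ((f - u) - T t (f - u)) + (u - T t u - t *: v) -
    t *: (g - v)); last first.
  rewrite TB ?(ltW t0)// scalerBr.
  have -> : f - u - (T t f - T t u) = (f - T t f) - (u - T t u).
    by rewrite !opprD !opprK addrACA.
  by rewrite subrKA opprB subrKA.
apply: le_lt_trans (ler_normB _ _) _; apply: le_lt_trans (lerD (ler_normD _ _) (lexx _)) _.
have := T_dist (ltW t0) (A_sub Afg A1); rewrite distrC => h1.
have h2 := T_quad (ltW t0) A1 A2; rewrite normrZ gtr0_norm//.
rewrite expr2 -mulrA in h2.
have h3 : t * `|g - v| < t * (e / 4) by rewrite ltr_pM2l.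
have h4 : t * (t * `|w|) < t * (e / 4) by rewrite ltr_pM2l.
have -> : t * e = t * (e / 4) + t * (e / 4) + t * (e / 4) + t * (e / 4) by field.
have := mulr_gt0 t0 (divr_gt0 e0 (ltr0n _ 4)).
by lra.
Unshelve. all: by end_near. Qed.

(** [u + A u = f + g] is solvable. On [w = f - u] the generator takes the value [- w], so [T t w]
    would be close to [(1 + t) w] for small [t], against contractivity unless [w = 0]. *)
Lemma generator_A f g : t^-1 *: (f - T t f) @[t --> 0^'+] --> g -> A f g.
Proof.
move=> fg; have [v [Av vE]] := J_spec (f + g) (@ltr01 R).
rewrite scale1r in vE; set u := J 1 (f + g) in Av vE.
suff w0 : f - u = 0.
  have uf : u = f by apply/esym/eqP; rewrite -subr_eq0 w0.
  by move: Av vE; rewrite uf => Av /addrI <-.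
set w := f - u.
have gv : g - v = - w.
  by apply/eqP; rewrite -subr_eq0 opprK /w addrC addrACA -opprD vE subrr.
have : t^-1 *: (f - T t f) - t^-1 *: (u - T t u) @[t --> 0^'+] --> g - v.
  by apply: cvgB => //; exact: T_generator.
rewrite gv => /cvgrPdistC_lt lim.
apply/eqP; rewrite -normr_le0 leNgt; apply/negP => wn.
have [t [t0 ht]] : exists t, 0 < t /\
    `|t^-1 *: (f - T t f) - t^-1 *: (u - T t u) - - w| < `|w|.
  near (0 : R)^'+ => t; exists t; split.
    by near: t; exact: nbhs_right_gt.
  by near: t; exact: lim.
move: ht; rewrite opprK -scalerBr.
rewrite (_ : f - T t f - (u - T t u) = w - T t w); last first.
  by rewrite /w TB ?(ltW t0)// !opprD !opprK addrACA.
rewrite ltNge => /negP; apply.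
rewrite -(ler_pM2l t0) -{2}(gtr0_norm t0) -normrZ scalerDr scalerA divff ?gt_eqF//.
rewrite scale1r.
have -> : w - T t w + t *: w = (1 + t) *: w - T t w.
  by rewrite scalerDl scale1r addrAC.
have h1 : `|(1 + t) *: w| = `|w| + t * `|w|.
  by rewrite normrZ gtr0_norm ?addr_gt0// mulrDl mul1r.
have := ler_normD ((1 + t) *: w - T t w) (T t w); rewrite subrK h1.
by have := T_contr w (ltW t0); lra.
Unshelve. all: by end_near. Qed.

(** * Uniqueness of the semigroup with a given generator *)

Section Uniqueness.
Variable S : R -> E -> E.
Hypothesis S_lin : forall t (a : R) f g, 0 <= t ->
  S t (a *: f + g) = a *: S t f + S t g.
Hypothesis S_bounded : forall t, 0 <= t -> exists M, forall f, `|S t f| <= M * `|f|.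
Hypothesis S0 : forall f, S 0 f = f.
Hypothesis S_add : forall s t f, 0 <= s -> 0 <= t -> S (s + t) f = S s (S t f).
Hypothesis S_cont : forall f, `|S t f - f| @[t --> 0^'+] --> (0 : R).
Hypothesis S_gen : forall f g,
  A f g <-> `|t^-1 *: (f - S t f) - g| @[t --> 0^'+] --> (0 : R).

Let SB t f g : 0 <= t -> S t (f - g) = S t f - S t g.
Proof. by move=> t0; rewrite addrC -scaleN1r S_lin// scaleN1r addrC. Qed.

Let SZ t (a : R) f : 0 <= t -> S t (a *: f) = a *: S t f.
Proof.
by move=> t0; have := SB f f t0; rewrite !subrr => h;
  rewrite -[a *: f]addr0 S_lin// h addr0.
Qed.

(* Otherwise there are [s_n -> 0] with unbounded [S s_n], although [S s_n f]
   converges for every [f], against Banach-Steinhaus. *)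
Let S_locally_bounded : exists d M : R, [/\ 0 < d, 1 <= M &
  forall s f, 0 <= s -> s <= d -> `|S s f| <= M * `|f|].
Proof.
apply: contrapT => nb.
have ex n : exists p : R * E, [/\ 0 <= p.1, p.1 <= n.+1%:R^-1 &
    n.+1%:R * `|p.2| < `|S p.1 p.2|].
  apply: contrapT => ne; apply: nb; exists n.+1%:R^-1, n.+1%:R; split=> //.
    by rewrite ler1n.
  move=> s f s0 sn; rewrite leNgt; apply/negP => lt; apply: ne.
  by exists (s, f).
have [p pP] := choice ex.
pose F : set (E -> E) := [set S (p n).1 | n in [set: nat]].
have [||M MP] := @Banach_Steinhauss R E E F _ _ 1.
- move=> _ [n _ <-]; have [p0 _ _] := pP n; split.
    move=> r; have [M MP] := S_bounded p0; exists (`|M| * `|r|) => x xr.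
    apply: le_trans (MP x) _; apply: (@le_trans _ _ (`|M| * `|x|)).
      by rewrite ler_wpM2r// ler_norm.
    by rewrite ler_wpM2l// (le_trans xr)// ler_norm.
  by move=> a u v; exact: S_lin.
- move=> x.
  have [k kP] : exists k, forall n, (k <= n)%N -> `|S (p n).1 x - x| <= 1.
    have /cvgrPdistC_lt /(_ 1 ltr01) := S_cont x.
    move=> [d /= d0 dP]; have [k kP] := harmonic_small d0; exists k => n kn.
    have [p0 pn _] := pP n; move: p0; rewrite le_eqVlt => /predU1P[<-|p0].
      by rewrite S0 subrr normr0.
    have := dP (p n).1; rewrite /= sub0r normrN gtr0_norm//.
    move=> /(_ (le_lt_trans pn (kP n kn)) p0).
    by rewrite subr0 normr_id => /ltW.
  have fin : exists M : R, forall n, (n < k)%N -> `|S (p n).1 x| <= M.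
    elim: k {kP} => [|k [M MP]]; first by exists 0.
    exists (Num.max M `|S (p k).1 x|) => n; rewrite ltnS leq_eqVlt.
    by move=> /predU1P[->|/MP]; rewrite le_max ?lexx ?orbT// => ->.
  have [M MP] := fin; exists (Num.max M (`|x| + 1)) => _ [n _ <-].
  rewrite le_max; case: (ltnP n k) => [/MP ->//|/kP h]; apply/orP; right.
  rewrite -[S _ x](subrK x) addrC; apply: le_trans (ler_normD _ _) _.
  by rewrite lerD2l.
have [n nM] : exists n : nat, M < n.+1%:R.
  exists (Num.truncn M); exact: truncnS_gt.
have [p0 _ lt] := pP n; set f := (p n).2 in lt.
have f0 : 0 < `|f|.
  rewrite normr_gt0; apply: contraTneq lt => ->.
  by rewrite normr0 mulr0 -(scale0r f) SZ// scale0r normr0 ltxx.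
have := MP _ (ex_intro2 _ _ n I erefl) (`|f|^-1 *: f).
rewrite SZ// !normrZ normfV normr_id mulVf ?gt_eqF// => /(_ (lexx 1)).
rewrite mulrC ler_pdivrMr// => le.
have : M * `|f| < n.+1%:R * `|f| by rewrite ltr_pM2r.
by move: lt le; lra.
Qed.

Let S_mul n s f : 0 <= s -> S (n%:R * s) f = iter n (S s) f.
Proof.
move=> s0; elim: n => [|n IH] /=; first by rewrite mul0r S0.
by rewrite -natr1 addrC mulrDl mul1r S_add ?mulr_ge0// IH.
Qed.

Let S_bounded_on t : 0 <= t -> exists2 K : R, 0 <= K &
  forall s f, 0 <= s -> s <= t -> `|S s f| <= K * `|f|.
Proof.
move=> t0; have [d [M [d0 M1 MP]]] := S_locally_bounded.
pose N := (Num.truncn (t / d)).+1.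
have N0 : 0 < N%:R :> R by rewrite ltr0n.
have td : t / N%:R <= d.
  rewrite ler_pdivrMr// mulrC -ler_pdivrMr//.
  exact/ltW/truncnS_gt.
have M0 : 0 <= M by rewrite (le_trans _ M1).
exists (M ^+ N); first exact: exprn_ge0.
move=> s f s0 st.
have sN : 0 <= s / N%:R by rewrite divr_ge0// ltW.
rewrite (_ : s = N%:R * (s / N%:R)); last by rewrite mulrC divfK// gt_eqF.
have sd : s / N%:R <= d by rewrite (le_trans _ td)// ler_wpM2r// invr_ge0 ltW.
have key n u : `|iter n (S (s / N%:R)) u| <= M ^+ n * `|u|.
  elim: n => [|n IH] /=; first by rewrite mul1r.
  apply: le_trans (MP _ _ sN sd) _.
  by rewrite exprS -mulrA ler_wpM2l.
by rewrite S_mul.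
Qed.

Let S_comm r t f : 0 <= r -> 0 <= t -> S t (S r f) = S r (S t f).
Proof. by move=> r0 t0; rewrite -!S_add// addrC. Qed.

Let S_A r f g : 0 <= r -> A f g -> A (S r f) (S r g).
Proof.
move=> r0 /S_gen/cvgrPdistC_lt Afg; apply/S_gen/cvgrPdistC_lt => e e0.
have [K K0 KP] := S_bounded_on r0.
have K1 : 0 < K + 1 by rewrite ltr_wpDl.
have h : \forall t \near 0^'+, `|t^-1 *: (f - S t f) - g| < e / (K + 1).
  by apply: filterS (Afg _ (divr_gt0 e0 K1)) => t; rewrite subr0 normr_id.
near=> t; have t0 : 0 <= t by near: t; exact: nbhs_right_ge.
rewrite subr0 normr_id S_comm// -SB// -SZ// -SB//.
apply: le_lt_trans (KP _ _ r0 (lexx r)) _.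
have : `|t^-1 *: (f - S t f) - g| < e / (K + 1).
  by near: t; exact: h.
rewrite ltr_pdivlMr// mulrC; apply: le_lt_trans.
by rewrite ler_wpM2r// lerDl.
Unshelve. all: by end_near. Qed.

Let S_J r s f : 0 <= r -> 0 <= s -> J s (S r f) = S r (J s f).
Proof.
move=> r0; rewrite le_eqVlt => /predU1P[<-|s0]; first by rewrite !J0.
have [v [Av vE]] := J_spec f s0; apply: J_unique s0 (S_A r0 Av) _.
by rewrite -[in RHS]vE [in RHS]addrC S_lin// addrC.
Qed.

Let S_T r t f : 0 <= r -> 0 <= t -> T t (S r f) = S r (T t f).
Proof.
move=> r0 t0; have [K K0 KP] := S_bounded_on r0.
have E0 k : euler k t (S r f) = S r (euler k t f).
  rewrite /euler; elim: (2 ^ k)%N => //= n ->; rewrite S_J//; exact: dy_ge0.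
have h1 := euler_cvg (S r f) t0.
have h2 : S r (euler k t f) @[k --> \oo] --> S r (T t f).
  apply/cvgr_epsP => e e0; have K1 : 0 < K + 1 by rewrite ltr_wpDl.
  have /cvgr_epsP /(_ _ (divr_gt0 e0 K1)) [k kP] := euler_cvg f t0.
  exists k => n /kP; rewrite -SB// ltr_pdivlMr// mulrC.
  apply: le_lt_trans; apply: le_trans (KP _ _ r0 (lexx r)) _.
  by rewrite ler_wpM2r// lerDl.
by move: h1; under eq_cvg do rewrite E0; move=> h1; exact: cvg_unique h1 h2.
Qed.

(** On the domain of [A], [S s f] and [T s f] differ by [o(s)], so [n] steps of length [t / n]
    differ by [n o(t / n)]. Telescoping is allowed because [S] commutes with the resolvents, hence
    with [T]. *)
Lemma semigroup_unique t f : 0 <= t -> S t f = T t f.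
Proof.
move=> t0; have [K K0 KP] := S_bounded_on t0.
have KT u : `|T t u| <= (K + 1) * `|u|.
  by rewrite (le_trans (T_contr _ t0))// ler_peMl// lerDr.
have KS u : `|S t u| <= (K + 1) * `|u|.
  by rewrite (le_trans (KP _ _ t0 (lexx t)))// ler_wpM2r// lerDl.
move: f; apply: (dense_eq _ _ KS KT) => [u v|u v|f g h Afg _].
- exact: SB.
- exact: TB.
apply/eqP; rewrite -subr_eq0 -normr_le0 leNgt; apply/negP => d0.
(* With this [c] the factor [2 t K / (c + 1)] is less than 1, so the final estimate bounds the
   difference by a smaller multiple of itself. *)
pose c := t * (K + 1) * 2.
have c1 : 0 < c + 1 by rewrite ltr_wpDl// !mulr_ge0// addr_ge0.
have e0 : 0 < `|S t f - T t f| / (c + 1) by rewrite divr_gt0.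
have [n n0 hn] : exists2 n : nat, (0 < n)%N &
    `|T (t / n%:R) f - S (t / n%:R) f| <=
      t / n%:R * (2 * (`|S t f - T t f| / (c + 1))).
  move: t0; rewrite le_eqVlt => /predU1P[<-|t0].
    by exists 1%N => //; rewrite mul0r T0 S0 subrr normr0 mul0r.
  have /S_gen/cvgrPdistC_lt/(_ _ e0) h1 := Afg.
  have /cvgrPdistC_lt/(_ _ e0) h2 := T_generator Afg.
  have [d /= dp dP] := filterI h1 h2.
  have := @cvg_harmonic R => /cvgr_epsP /(_ _ (divr_gt0 dp t0)) [k /(_ k (leqnn k))].
  rewrite subr0 ger0_norm ?invr_ge0// ltr_pdivlMr// mulrC => tk.
  exists k.+1 => //; set s := t / k.+1%:R in tk *.
  have s0 : 0 < s by rewrite divr_gt0.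
  have := dP s; rewrite /= sub0r normrN gtr0_norm// => /(_ tk s0) [].
  rewrite subr0 normr_id => g1 g2.
  rewrite -ler_pdivrMl// -{1}(gtr0_norm s0) -normfV -normrZ.
  rewrite (_ : T s f - S s f = (f - S s f) - (f - T s f)); last first.
    by rewrite opprB [RHS]addrC subrKA.
  rewrite scalerBr -(subrKA g); apply: le_trans (ler_normD _ _) _.
  by rewrite [X in _ + X]distrC; lra.
have n0' : 0 < n%:R :> R by rewrite ltr0n.
set s := t / n%:R in hn; have s0 : 0 <= s by rewrite divr_ge0// ltW.
have tE : t = n%:R * s by rewrite /s mulrC divfK// gt_eqF.
have iT u : T t u = iter n (T s) u.
  rewrite tE; elim: (n) => [|m IH] /=; first by rewrite mul0r T0.
  by rewrite -natr1 addrC mulrDl mul1r T_add ?mulr_ge0// IH.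
have := @telescope_le R E (T s) (S s) K f.
move=> /(_ _ _ _ _ n _); rewrite -iT -S_mul// -tE => tel.
have {tel} : `|T t f - S t f| <= n%:R * (K * `|T s f - S s f|).
  apply: tel.
  - by move=> u v; exact: TB.
  - by move=> u v; exact: SB.
  - by move=> u; exact: T_contr.
  - by move=> u; exact: S_T.
  - move=> j u jn; rewrite -S_mul//; apply: KP; first by rewrite mulr_ge0.
    by rewrite tE ler_wpM2r// ler_nat ltnW.
rewrite distrC; set D := `|_ - _| in d0 e0 hn * => tel.
have : n%:R * (K * `|T s f - S s f|) <= n%:R * (K * (s * (2 * (D / (c + 1))))).
  by rewrite ler_wpM2l// ler_wpM2l.
rewrite [leRHS](_ : _ = (t * K * 2 / (c + 1)) * D); last first.
  by rewrite tE; field; rewrite gt_eqF.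
have : t * K * 2 / (c + 1) * D < D.
  rewrite gtr_pMl// ltr_pdivrMr// mul1r /c.
  by move: t0; lra.
by move: tel; lra.
Qed.

End Uniqueness.

Lemma T_invariant (P : E -> Prop) :
  (forall (u : nat -> E) l, (forall n, P (u n)) -> u n @[n --> \oo] --> l -> P l) ->
  (forall s f, 0 < s -> P f -> P (J s f)) ->
  forall t f, 0 <= t -> P f -> P (T t f).
Proof.
move=> Pcl PJ t f t0 Pf; apply: Pcl (euler_cvg f t0) => k.
have := dy_ge0 k t0; rewrite /euler le_eqVlt => /predU1P[<-|s0].
  by elim: (2 ^ k)%N => //= n; rewrite J0.
by elim: (2 ^ k)%N => //= n; exact: PJ.
Qed.

End AccretiveOperator.

(** * The operator of the closed form *)

Section SquareSummableMore.
Context {R : realType} {X : choiceType}.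
Implicit Types (f g : X -> R).

Lemma ell2_dense f (e : R) : ell2 f -> 0 < e ->
  exists2 phi, Cc phi & ell2_norm (f - phi) < e.
Proof.
move=> fs e0; have ffs : abs_summable (fun x => f x * f x) by exact: ell2M.
have ff0 x : 0 <= f x * f x by rewrite -expr2 sqr_ge0.
have [K KP] : exists K : {fset X},
    rsum (fun x => f x * f x) - (e / 2) ^+ 2 < \sum_(x <- K) f x * f x.
  apply: contrapT => ne.
  have [|_] := @rsum_le_bound _ _ (fun x => f x * f x)
    (rsum (fun x => f x * f x) - (e / 2) ^+ 2) ff0.
    by move=> K; rewrite leNgt; apply/negP => lt; apply: ne; exists K.
  have : 0 < (e / 2) ^+ 2 by rewrite exprn_gt0// divr_gt0.
  by move=> h1 h2; move: h2; rewrite leNgt gtrBl h1.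
pose phi x := if x \in K then f x else 0.
have c : Cc phi by apply/CcP; exists K => x; rewrite /phi => /negPf ->.
exists phi => //; apply: (@le_lt_trans _ _ (e / 2)); last first.
  by rewrite ltr_pdivrMr// ltr_pMr// ltr1n.
rewrite -(@ler_pXn2r _ 2)// ?nnegrE ?ell2_norm_ge0 ?divr_ge0 ?(ltW e0)//.
rewrite ell2_normE /ell2_dot.
rewrite (_ : (fun x => _) = (fun x => f x * f x - phi x * phi x)); last first.
  by apply/funext => x; rewrite !fctE /phi; case: ifP => _; ring.
rewrite rsumB//; last exact: Cc_summable.
rewrite (@rsum_fin _ _ (fun x => phi x * phi x) K); last first.
  by move=> x /negPf xK; rewrite /phi xK mulr0.
rewrite (_ : \sum_(x <- K) phi x * phi x = \sum_(x <- K) f x * f x); last first.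
  by apply: eq_big_seq => x xK; rewrite /phi xK.
by move: KP; lra.
Qed.

Lemma ell2_norm_dist f g : ell2 f -> ell2 g ->
  `|ell2_norm f - ell2_norm g| <= ell2_norm (f - g).
Proof.
move=> fs gs; have := ell2_normD (ell2B fs gs) gs; rewrite subrK => h1.
have := ell2_normD (ell2B gs fs) fs; rewrite subrK => h2.
have E : ell2_norm (g - f) = ell2_norm (f - g).
  rewrite (_ : g - f = fun x => -1 * (f - g) x).
    by rewrite ell2_normZ ?normrN1 ?mul1r//; exact: ell2B.
  by apply/funext => x; rewrite !fctE; ring.
by rewrite ler_norml; apply/andP; split; lra.
Qed.

Lemma ell2_norm_cvg (u : nat -> X -> R) f : (forall n, ell2 (u n)) -> ell2 f ->
  ell2_norm (u n - f) @[n --> \oo] --> (0 : R) ->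
  ell2_dot (u n) (u n) @[n --> \oo] --> ell2_dot f f.
Proof.
move=> us fs uf.
have h : ell2_norm (u n) @[n --> \oo] --> ell2_norm f.
  apply/cvgr_epsP => e e0; have /cvgr_epsP /(_ e e0) [k kP] := uf.
  exists k => n /kP; rewrite subr0 ger0_norm ?ell2_norm_ge0//.
  by apply: le_lt_trans; exact: ell2_norm_dist.
rewrite -ell2_normE expr2; under eq_cvg do rewrite -ell2_normE expr2.
exact: cvgM.
Qed.

Lemma ell2_dot_cvg (u : nat -> X -> R) f g : (forall n, ell2 (u n)) -> ell2 f -> ell2 g ->
  ell2_norm (u n - f) @[n --> \oo] --> (0 : R) ->
  ell2_dot g (u n) @[n --> \oo] --> ell2_dot g f.
Proof.
move=> us fs gs uf; apply/cvgr_epsP => e e0.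
have g1 : 0 < ell2_norm g + 1 by rewrite ltr_wpDl// ell2_norm_ge0.
have /cvgr_epsP /(_ _ (divr_gt0 e0 g1)) [k kP] := uf.
exists k => n /kP; rewrite subr0 ger0_norm ?ell2_norm_ge0// ltr_pdivlMr//.
apply: le_lt_trans; rewrite !(ell2_dotC g) -ell2_dotB//.
apply: le_trans (ell2_CS (ell2B (us n) fs) gs) _.
by rewrite ler_wpM2l ?ell2_norm_ge0// lerDl.
Qed.

End SquareSummableMore.

Section ClosedForm.
Context {R : realType} {X : choiceType}.
Variable b : X -> X -> R.
Hypothesis gb : is_graph b.
Variable q : X -> R.
Hypothesis h0 : hform_ge0 b q.
Implicit Types (f g u v phi psi : X -> R) (x y : X) (l : R).

Local Notation ql l := (q + cst l).
Local Notation Q l := (hform b (ql l)).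
Local Notation dom l := (dom b (ql l)).
Local Notation approx l := (approx b (ql l)).
Local Notation qbar l := (qbar b (ql l)).
Local Notation form l := (bform b (ql l)).

Lemma hl0 l : 0 < l -> hform_ge0 b (ql l).
Proof. by move=> l0; apply: hform_ge0_shift => // x; exact: ltW. Qed.

Let hlb l : 0 < l -> bounded_evals b (ql l).
Proof. exact: bounded_evals_cst. Qed.

Let QE l phi : Cc phi -> Q l phi = hform b q phi + l * ell2_norm phi ^+ 2.
Proof. by move=> c; rewrite hform_shift_cst// ell2_normE. Qed.

(** Being Cauchy for [h] and convergent in norm amounts to being Cauchy for [h + l |.|^2], whichever
    [l > 0] is taken. The form domain is thus an instance of [dom]. *)
Lemma closure_approx_approx l f (phi : nat -> X -> R) : 0 < l ->
  closure_approx b q f phi -> approx l f phi.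
Proof.
move=> l0 [fs c cv ca]; split=> // [e e0|x]; last first.
  apply/cvgr_epsP => e e0; have /cvgr_epsP /(_ e e0) [k kP] := cv.
  exists k => n /kP; rewrite subr0 ger0_norm ?ell2_norm_ge0//.
  apply: le_lt_trans; rewrite -[_ - _]/((phi n - f) x).
  exact/ell2_eval/ell2B/fs/Cc_ell2.
have [k1 kP1] := ca (e / 2) (divr_gt0 e0 (ltr0n _ 2)).
(* Chosen so that [l (2 d)^2 <= 4 l d <= e / 2], using [d <= 1]. *)
pose d : R := Num.min 1 (e / (8 * l)).
have d0 : 0 < d by rewrite lt_min ltr01 divr_gt0// mulr_gt0.
have /cvgr_epsP /(_ d d0) [k2 kP2] := cv.
exists (maxn k1 k2) => m n; rewrite !geq_max => /andP[m1 m2] /andP[n1 n2].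
have := kP1 m n m1 n1; have := kP2 m m2; have := kP2 n n2.
rewrite !subr0 !ger0_norm ?ell2_norm_ge0// => hn hm.
have cs k := Cc_ell2 (c k).
rewrite QE; last exact: CcB.
have tri : ell2_norm (phi m - phi n) <= ell2_norm (phi m - f) + ell2_norm (phi n - f).
  rewrite -(subrKA f); apply: le_trans (ell2_normD (ell2B (cs m) fs) (ell2B fs (cs n))) _.
  rewrite lerD2l (_ : f - phi n = fun x => -1 * (phi n - f) x).
    by rewrite ell2_normZ ?normrN1 ?mul1r//; exact: ell2B.
  by apply/funext => x; rewrite !fctE; ring.
have N2 : ell2_norm (phi m - phi n) < 2 * d.
  by apply: le_lt_trans tri _; move: hn hm; lra.
have N0 := ell2_norm_ge0 (phi m - phi n).
have dd : d * d <= e / (8 * l).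
  have d1 : d <= 1 by rewrite ge_min lexx.
  have de : d <= e / (8 * l) by rewrite ge_min lexx orbT.
  by apply: le_trans de; rewrite ler_piMr// ltW.
have ld : l * (4 * (d * d)) <= e / 2.
  rewrite (_ : e / 2 = l * (4 * (e / (8 * l)))); last by field; rewrite gt_eqF.
  by rewrite !ler_wpM2l// ltW.
have sq : ell2_norm (phi m - phi n) ^+ 2 <= 4 * (d * d).
  by rewrite expr2; nra.
have := ler_wpM2l (ltW l0) sq.
set A := hform _ _ _; set B := l * _ ^+ 2; move: ld.
set C := l * (4 * _); lra.
Qed.

Lemma approx_closure_approx l f (phi : nat -> X -> R) : 0 < l ->
  approx l f phi -> closure_approx b q f phi.
Proof.
move=> l0 [c ca cp].
have small (e : R) : 0 < e -> exists k, forall n, (k <= n)%N ->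
    ell2 (phi n - f) /\ ell2_norm (phi n - f) <= e.
  move=> e0; have [|k kP] := ca (l * e ^+ 2).
    by rewrite mulr_gt0// exprn_gt0.
  exists k => n kn; apply: (@ell2_cvg_bound _ _ _ \oo _ (fun m => phi n - phi m)).
  - exact: ltW.
  - by move=> x; apply: cvgB; [exact: cvg_cst|exact: cp].
  exists k => // m /= km; split; first by apply/Cc_ell2/CcB.
  have := kP n m kn km; rewrite QE; last exact: CcB.
  have := h0 (CcB (c n) (c m)) => h1 h2.
  have : l * ell2_norm (phi n - phi m) ^+ 2 < l * e ^+ 2 by lra.
  by rewrite ltr_pM2l// ltr_pXn2r ?nnegrE ?ell2_norm_ge0 ?(ltW e0)// => /ltW.
have fs : ell2 f.
  have [k kP] := small 1 ltr01; have [s _] := kP k (leqnn k).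
  rewrite (_ : f = phi k - (phi k - f)); last by rewrite subKr.
  by apply: ell2B => //; exact: Cc_ell2.
split=> // [|e e0].
  apply/cvgr_epsP => e e0; have [k kP] := small (e / 2) (divr_gt0 e0 (ltr0n _ 2)).
  exists k => n /kP [_ le]; rewrite subr0 ger0_norm ?ell2_norm_ge0//.
  by apply: le_lt_trans le _; rewrite ltr_pdivrMr// ltr_pMr// ltr1n.
have [k kP] := ca e e0; exists k => m n km kn; apply: le_lt_trans (kP m n km kn).
by rewrite (QE l (CcB (c m) (c n))) lerDl mulr_ge0 ?sqr_ge0// ltW.
Qed.

Lemma closure_domE l : 0 < l -> closure_dom b q = dom l.
Proof.
move=> l0; apply/seteqP; split=> f [phi fa]; exists phi.
  exact: closure_approx_approx.
exact: approx_closure_approx fa.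
Qed.

Lemma dom_ell2 l f : 0 < l -> dom l f -> ell2 f.
Proof. by move=> l0 [phi fa]; have [] := approx_closure_approx l0 fa. Qed.

Lemma closure_form_lim l f (phi : nat -> X -> R) : 0 < l -> approx l f phi ->
  hform b q (phi n) @[n --> \oo] --> qbar l f - l * ell2_dot f f.
Proof.
move=> l0 fa; have [c _ _] := fa.
have [fs _ cv _] := approx_closure_approx l0 fa.
have E n : hform b q (phi n) = Q l (phi n) - l * ell2_dot (phi n) (phi n).
  by rewrite hform_shift_cst// addrK.
under eq_cvg do rewrite E; apply: cvgB.
  by apply: qbar_lim fa => //; [exact: hl0|exact: hlb].
apply: cvgM; first exact: cvg_cst.
by apply: ell2_norm_cvg => // n; exact: Cc_ell2.
Qed.

Lemma closure_formE l f : 0 < l -> dom l f ->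
  closure_form b q f = qbar l f - l * ell2_dot f f.
Proof.
move=> l0 [phi fa]; rewrite /closure_form.
have lim := closure_form_lim l0 fa.
case: xgetP => [r -> [psi ga gl]|].
  have ga' := closure_approx_approx l0 ga.
  exact: cvg_unique gl (closure_form_lim l0 ga').
move=> /(_ (qbar l f - l * ell2_dot f f)); case.
by exists phi => //; exact: approx_closure_approx fa.
Qed.

Lemma closure_form_ge0 l f : 0 < l -> dom l f ->
  l * ell2_dot f f <= qbar l f.
Proof.
move=> l0 [phi fa]; rewrite -subr_ge0; have [c _ _] := fa.
by apply: (cvgr_to_ge (closure_form_lim l0 fa)); exists 0%N => // n _; exact: h0.
Qed.

Lemma polar_closure_form l f v : 0 < l -> dom l f -> dom l v ->
  polar (closure_form b q) f v = form l f v - l * ell2_dot f v.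
Proof.
move=> l0 df dv; have [fs vs] := (dom_ell2 l0 df, dom_ell2 l0 dv).
have [hh hb] := (hl0 l0, hlb l0).
have [dp dm] := (domD gb hh df dv, domB gb hh df dv).
rewrite /polar !(closure_formE l0)//.
rewrite /bform /polar ell2_dotB//; last exact: ell2B.
rewrite (ell2_dotC f) (ell2_dotC v (f - v)) !ell2_dotB//.
rewrite (_ : f + v = fun x => 1 * f x + v x); last first.
  by apply/funext => x; rewrite mul1r.
rewrite ell2_dot_linl//; last exact: ell2_lin.
rewrite !ell2_dot_linr// (ell2_dotC v f).
by field.
Qed.

(** The completion theory applies to the shifted form, so the operator is expressed through it. As
    [l] is free, it can be matched with the resolvent parameter. *)
Lemma H1P l f g : 0 < l -> H1 b q f g <->
  [/\ dom l f, ell2 g &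
   forall v, dom l v -> form l f v = ell2_dot g v + l * ell2_dot f v].
Proof.
move=> l0; rewrite /H1 (closure_domE l0); split=> -[df gs h]; split=> // v dv.
  by have := h v dv; rewrite (polar_closure_form l0)// => <-; rewrite subrK.
by rewrite (polar_closure_form l0)// h// addrK.
Qed.

Lemma H1_ell2 f g : H1 b q f g -> ell2 f /\ ell2 g.
Proof.
by move=> /(H1P _ _ ltr01) [df gs _]; split=> //; exact: dom_ell2 df.
Qed.

Lemma H1_lin (a : R) u v u' v' : H1 b q u v -> H1 b q u' v' ->
  H1 b q (fun x => a * u x + u' x) (fun x => a * v x + v' x).
Proof.
move=> h1 h2; have [us vs] := H1_ell2 h1; have [us' vs'] := H1_ell2 h2.
move: h1 h2 => /(H1P _ _ ltr01) [d1 _ e1] /(H1P _ _ ltr01) [d2 _ e2].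
have hb := hlb (@ltr01 R); have hh := hl0 (@ltr01 R).
apply/(H1P _ _ ltr01); split; [exact: dom_lin|exact: ell2_lin|].
move=> w dw; have ws := dom_ell2 ltr01 dw.
by rewrite bform_linl// e1// e2// !ell2_dot_linl//; ring.
Qed.

Lemma H1_ge0 u v : H1 b q u v -> 0 <= ell2_dot v u.
Proof.
move=> /(H1P _ _ ltr01) [du vs e].
have := closure_form_ge0 ltr01 du; have := e u du.
by rewrite bform_diag//; [lra|exact: hl0|exact: hlb].
Qed.

(** [|u|^2 <= <u + s v, u>] because [<v, u> >= 0]; Cauchy-Schwarz does the rest. *)
Lemma H1_accretive u v (s : R) : 0 < s -> H1 b q u v ->
  ell2_norm u <= ell2_norm (fun x => u x + s * v x).
Proof.
move=> s0 h; have [us vs] := H1_ell2 h; have p := H1_ge0 h.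
have ws : ell2 (fun x => u x + s * v x).
  by under eq_fun do rewrite addrC; exact: ell2_lin.
have := ell2_CS ws us.
have -> : ell2_dot (fun x => u x + s * v x) u = ell2_norm u ^+ 2 + s * ell2_dot v u.
  by under eq_fun do rewrite addrC; rewrite ell2_dot_linl// ell2_normE addrC.
have n0 := ell2_norm_ge0 u; have m0 := ell2_norm_ge0 (fun x => u x + s * v x).
set N := ell2_norm u in n0 *; set M := ell2_norm _ in m0 *.
rewrite ger0_norm; last by rewrite addr_ge0 ?sqr_ge0// mulr_ge0// ltW.
move=> le; rewrite leNgt; apply/negP => MN.
have : 0 <= s * ell2_dot v u by rewrite mulr_ge0// ltW.
have : M * N < N * N by rewrite ltr_pM2r//; exact: le_lt_trans MN.
by rewrite expr2 in le; lra.
Qed.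

Lemma H1_Hop u v : H1 b q u v -> Fspace b u /\ Hop b q u = v.
Proof.
move=> /(H1P _ _ ltr01) [du vs e].
have hb := hlb (@ltr01 R); have hh := hl0 (@ltr01 R).
have us := dom_ell2 ltr01 du; split; first exact: dom_Fspace du.
apply/funext => x; have := e _ (Cc_dom gb (ql 1) (@Cc_delta R X x)).
rewrite !(ell2_dotC _ \1_[set x]) !ell2_dot_delta bform_Cc//; last exact: Cc_delta.
by rewrite hB_delta Hop_shift => /addIr.
Qed.

(** Riesz representation of [phi -> <f, phi>] for the form of [q + l], bounded since that form
    dominates [l |phi|^2]. A nonnegative [f] gives a positive functional. *)
Lemma H1_surj l f : 0 < l -> ell2 f -> exists u,
  H1 b q u (fun x => f x - l * u x) /\ ((forall x, 0 <= f x) -> forall x, 0 <= u x).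
Proof.
move=> l0 fs; have hb := hlb l0; have hh := hl0 l0.
have [a phi psi c1 c2|phi c|u [du uP upos]] := @riesz R X b gb (ql l) hh hb (ell2_dot f)
  (ell2_dot f f / l).
- exact: ell2_dot_linr (Cc_ell2 c1) (Cc_ell2 c2) fs.
- have cs := Cc_ell2 c.
  rewrite -real_normK ?num_real//.
  apply: (@le_trans _ _ ((ell2_norm f * ell2_norm phi) ^+ 2)).
    by rewrite lerXn2r ?nnegrE ?mulr_ge0 ?ell2_norm_ge0//; exact: ell2_CS.
  rewrite exprMn ell2_normE -mulrA ler_wpM2l ?ell2_dot_ge0//.
  rewrite mulrC ler_pdivlMr// mulrC QE// lerDr; exact: h0.
exists u; split; last first.
  move=> f0; apply: upos => phi c p0; apply: rsum_ge0 => x.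
  by rewrite mulr_ge0.
have us := dom_ell2 l0 du.
apply/(H1P _ _ l0); split=> //.
  rewrite (_ : (fun x => _) = fun x => - l * u x + f x); first exact: ell2_lin.
  by apply/funext => x; ring.
move=> v [psi va]; have [c _ _] := va.
have [vs _ cv _] := approx_closure_approx l0 va.
have -> : ell2_dot (fun x => f x - l * u x) v + l * ell2_dot u v = ell2_dot f v.
  rewrite (_ : (fun x => _) = fun x => - l * u x + f x); last first.
    by apply/funext => x; ring.
  by rewrite ell2_dot_linl//; ring.
have dv : dom l v by exists psi.
(* The identity is known on [C_c(X)]; both sides converge along a sequence approximating [v]. *)
have h1 : ell2_dot f (psi n) @[n --> \oo] --> ell2_dot f v.
  by apply: ell2_dot_cvg => // n; exact: Cc_ell2.
have h2 : ell2_dot f (psi n) @[n --> \oo] --> form l u v.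
  have E n : ell2_dot f (psi n) = form l u (psi n).
    by rewrite -uP// bform_Cc.
  under eq_cvg do rewrite E.
  exact: bform_cvg.
exact: cvg_unique h2 h1.
Qed.

(** [b x] is summable and bounded by [deg b x], hence square summable, so [H 1_x] is in [l^2]. That
    point masses lie in the operator domain yields its density. *)
Lemma H1_delta x : H1 b q \1_[set x] (Hop b q \1_[set x]).
Proof.
have hb := hlb (@ltr01 R); have hh := hl0 (@ltr01 R).
have bs : abs_summable (b x).
  case: gb => _ _ _ /(_ x) h; apply/abs_summableE.
  rewrite (_ : esum _ _ = \esum_(y in [set: X]) (b x y)%:E)%E//.
  by apply: eq_esum => y _; rewrite ger0_norm//; case: gb.
have b0 y : 0 <= b x y by case: gb.
have bl2 : ell2 (b x).
  apply/ell2P; apply: (abs_summable_le (abs_summableZ (deg b x) bs)) => y.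
  rewrite normrX normrM !ger0_norm// ?rsum_ge0// expr2 ler_wpM2r//.
  exact: le_rsum1.
have E : Hop b q \1_[set x] = fun y => (deg b x + q x) * \1_[set x] y - 1 * b x y.
  apply/funext => y; rewrite Hop_delta// deltaE mul1r (_ : b y x = b x y).
    by case: eqP => [->//|_]; rewrite !mulr0.
  by case: gb.
have ds : ell2 (\1_[set x] : X -> R) by exact/Cc_ell2/Cc_delta.
have E' : Hop b q \1_[set x] = fun y => -1 * b x y + (deg b x + q x) * \1_[set x] y.
  by rewrite E; apply/funext => y; ring.
have Hs : ell2 (Hop b q \1_[set x]).
  by rewrite E'; apply: ell2_lin => //; exact: ell2Z.
apply/(H1P _ _ ltr01); split=> //; first exact/Cc_dom/Cc_delta.
move=> v dv; have vs := dom_ell2 ltr01 dv; have Fv := dom_Fspace gb hh hb dv.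
rewrite bformC//; last exact/Cc_dom/Cc_delta.
rewrite bform_Cc//; last exact: Cc_delta.
rewrite hB_delta Hop_shift ell2_dot_delta; congr (_ + _).
rewrite HopE// E' ell2_dot_linl//; last exact: ell2Z.
rewrite (_ : (fun y => (deg b x + q x) * _) =
  (fun y => (deg b x + q x) * \1_[set x] y + (fun=> 0) y)); last first.
  by apply/funext => y; rewrite addr0.
rewrite ell2_dot_linl//; last exact: ell20.
rewrite ell2_dot_delta (_ : ell2_dot (fun=> 0) v = 0).
  by rewrite /ell2_dot; ring.
by rewrite /ell2_dot; under eq_fun do rewrite mul0r; exact: rsum0.
Qed.

Lemma H1_0 : H1 b q (fun=> 0) (fun=> 0).
Proof.
have hb := hlb (@ltr01 R); have hh := hl0 (@ltr01 R).
have d0 : dom 1 (fun=> 0) by exact: dom0.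
have dot0 v : ell2_dot (fun=> 0) v = 0.
  by rewrite /ell2_dot; under eq_fun do rewrite mul0r; exact: rsum0.
apply/(H1P _ _ ltr01); split=> // [|v dv]; first exact: ell20.
rewrite bformC// bform_Cc//; last exact: Cc0.
by rewrite hB0l !dot0 mulr0 addr0.
Qed.

Lemma H1_Cc phi : Cc phi -> exists v, H1 b q phi v.
Proof.
move: phi; apply: Cc_ind => [|a x phi c [v Hv]]; first by eexists; exact: H1_0.
by eexists; apply: H1_lin; [exact: H1_delta|exact: Hv].
Qed.

End ClosedForm.

(** * The heat semigroup *)

Section HeatSemigroup.
Context {R : realType} {X : choiceType}.
Variable b : X -> X -> R.
Hypothesis gb : is_graph b.
Variable q : X -> R.
Hypothesis h0 : hform_ge0 b q.
Implicit Types (f g u v : X -> R) (x y : X) (l t : R).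

Definition l2op (u v : l2 R X) : Prop := H1 b q u v.

Lemma l2val_inj : injective (@l2val R X).
Proof. exact: val_inj. Qed.

Lemma to_l2 f : ell2 f -> exists F : l2 R X, l2val F = f.
Proof.
move=> fs; have fP : f \in (l2_pred : {pred X -> R}) by rewrite inE.
by exists (L2 fP).
Qed.

Lemma l2_valD (F G : l2 R X) : l2val (F + G) = (fun x => F x + G x).
Proof. by []. Qed.

Lemma l2_valZ (a : R) (F : l2 R X) : l2val (a *: F) = (fun x => a * F x).
Proof. by []. Qed.

Lemma l2op_m_accretive : m_accretive l2op.
Proof.
split=> [a u v u' v'|s u v s0 h|s f s0|f e e0].
- exact: (H1_lin gb h0).
- exact: (H1_accretive gb h0).
- have si : 0 < s^-1 by rewrite invr_gt0.
  have [u [Hu _]] := H1_surj gb h0 si (ell2Z s^-1 (l2_ell2 f)).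
  have [us vs] := H1_ell2 gb h0 Hu.
  have [U UE] := to_l2 us; have [V VE] := to_l2 vs.
  exists U, V; split; first by rewrite /l2op UE VE.
  apply: val_inj; rewrite /= VE UE; apply/funext => x.
  rewrite !fctE /=.
  by rewrite /GRing.scale /=; field; rewrite gt_eqF.
- have [phi c lt] := ell2_dense (l2_ell2 f) e0.
  have [v Hv] := H1_Cc gb h0 c.
  have [us vs] := H1_ell2 gb h0 Hv.
  have [U UE] := to_l2 us; have [V VE] := to_l2 vs.
  exists U, V; split; first by rewrite /l2op UE VE.
  by rewrite l2_normE /= UE.
Qed.

Definition heat_op t (F : l2 R X) : l2 R X := T l2op t F.

Let mA := l2op_m_accretive.

(** [C0_semigroup] speaks of maps on all functions; the default outside [ell2] is 0. *)
Definition heat_ext t f : X -> R :=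
  if pselect (ell2 f) is left fs then l2val (heat_op t (sval (cid (to_l2 fs)))) else 0.

Lemma heat_extE t (F : l2 R X) : heat_ext t F = heat_op t F.
Proof.
rewrite /heat_ext; case: pselect => [fs|]; last by case; exact: l2_ell2.
congr (l2val (heat_op t _)); apply: val_inj.
exact: (svalP (cid (to_l2 fs))).
Qed.

Lemma heat_ext_semigroup : C0_semigroup heat_ext.
Proof.
split=> [t t0|f fs|s t f s0 t0 fs|f fs].
- split=> [f fs|a f g fs gs|].
  + by have [F <-] := to_l2 fs; rewrite heat_extE; exact: l2_ell2.
  + have [F <-] := to_l2 fs; have [G <-] := to_l2 gs.
    have -> : (fun x => a * F x + G x) = l2val (a *: F + G) by [].
    by rewrite !heat_extE /heat_op T_lin.
  + exists 1 => f fs; have [F <-] := to_l2 fs; rewrite heat_extE mul1r.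
    exact: (T_contr mA F t0).
- by have [F <-] := to_l2 fs; rewrite heat_extE /heat_op T0.
- by have [F <-] := to_l2 fs; rewrite !heat_extE /heat_op T_add.
- have [F <-] := to_l2 fs.
  apply/cvgrPdistC_lt => e e0.
  have [u [v [Auv Fu]]] : exists u v : l2 R X, l2op u v /\ `|F - u| < e / 4.
    by case: mA => _ _ _; apply; rewrite divr_gt0.
  have v1 : 0 < `|v| + 1 by rewrite ltr_wpDl.
  near=> t; have t0 : 0 <= t by near: t; exact: nbhs_right_ge.
  rewrite heat_extE subr0 -/(ell2_norm _) ger0_norm ?ell2_norm_ge0//.
  rewrite -[ell2_norm _]/(`|heat_op t F - F|) /heat_op.
  have tv : t * `|v| < e / 4.
    have : t < e / 4 / (`|v| + 1).
      by near: t; apply: nbhs_right_lt; rewrite !divr_gt0.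
    rewrite ltr_pdivlMr//; apply: le_lt_trans.
    by rewrite ler_wpM2l// lerDl.
  rewrite (sub_split _ _ (T l2op t u) u) -TB//.
  apply: le_lt_trans (ler_normD _ _) _.
  apply: le_lt_trans (lerD (T_dist mA t0 Auv) (ler_normB _ _)) _.
  by have := T_contr mA (F - u) t0; lra.
Unshelve. all: by end_near. Qed.

Lemma heat_ext_generator : generated_by_opp (H1 b q) heat_ext.
Proof.
move=> f g; split=> [Hfg|[fs gs lim]].
  have [fs gs] := H1_ell2 gb h0 Hfg; split=> //.
  have [F FE] := to_l2 fs; have [G GE] := to_l2 gs; subst f g.
  have /cvgrPdistC_lt lim := T_generator mA (Hfg : l2op F G).
  apply/cvgrPdistC_lt => e e0; apply: filterS (lim e e0) => t.
  by rewrite subr0 ger0_norm ?ell2_norm_ge0// heat_extE.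
have [F FE] := to_l2 fs; have [G GE] := to_l2 gs; subst f g.
apply: (generator_A mA (f := F) (g := G)).
move: lim => /cvgrPdistC_lt lim.
apply/cvgrPdistC_lt => e e0; apply: filterS (lim e e0) => t.
by rewrite subr0 ger0_norm ?ell2_norm_ge0// heat_extE.
Qed.

(** [semigroup] selects some C0-semigroup generated by [- H1]. [heat_ext] shows that one exists, and
    the selected one, transported to the type [l2], equals [T] by uniqueness. *)
Lemma semigroupE t (F : l2 R X) : 0 <= t ->
  semigroup (H1 b q) t F = heat_op t F.
Proof.
move=> t0; rewrite /semigroup; case: xgetP => [S _ [[C1 C2 C3 C4] G]|]; last first.
  move=> /(_ heat_ext); case; split; first exact: heat_ext_semigroup.
  exact: heat_ext_generator.
(* At negative times [S] need not preserve [ell2], so the values of [S'] are arbitrary there. *)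
have [S' S'E] : exists S' : R -> l2 R X -> l2 R X,
    forall t F, 0 <= t -> l2val (S' t F) = S t F.
  have ex (p : R * l2 R X) : exists G : l2 R X, 0 <= p.1 -> l2val G = S p.1 p.2.
    have [p0|] := leP 0 p.1; last by move=> _; exists 0.
    by have [/(_ _ (l2_ell2 p.2))/to_l2[G' <-] _ _] := C1 _ p0; exists G'.
  have [f fP] := choice ex; exists (fun t F => f (t, F)) => t' F' t'0.
  exact: (fP (t', F')).
rewrite -S'E//; congr l2val; move: t F t0.
suff H t F : 0 <= t -> S' t F = T l2op t F by [].
apply: (semigroup_unique mA) => {t F} [t a F G' t0|t t0|F|s t F s0 t0|F|F G'].
- apply: l2val_inj; rewrite S'E//.
  have [_ lin _] := C1 _ t0; have := lin a _ _ (l2_ell2 F) (l2_ell2 G').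
  by move=> /= ->; apply/funext => x; rewrite -!S'E.
- have [_ _ [M MP]] := C1 _ t0; exists M => F.
  by rewrite !l2_normE S'E//; apply: MP; exact: l2_ell2.
- by apply: l2val_inj; rewrite S'E// C2//; exact: l2_ell2.
- apply: l2val_inj; rewrite S'E ?addr_ge0// C3//; last exact: l2_ell2.
  by rewrite !S'E.
- have /cvgrPdistC_lt lim := C4 _ (l2_ell2 F); apply/cvgrPdistC_lt => e e0.
  apply: filterS2 (lim e e0) (nbhs_right_ge 0) => t lt t0.
  by rewrite l2_normE /= S'E.
- split=> [/G [_ _ /cvgrPdistC_lt lim]|/cvgrPdistC_lt lim].
    apply/cvgrPdistC_lt => e e0.
    apply: filterS2 (lim e e0) (nbhs_right_ge 0) => t lt t0.
    by rewrite l2_normE /= S'E.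
  apply/G; split; [exact: l2_ell2|exact: l2_ell2|].
  apply/cvgrPdistC_lt => e e0.
  apply: filterS2 (lim e e0) (nbhs_right_ge 0) => t lt t0.
  by move: lt; rewrite l2_normE /= S'E.
Qed.

End HeatSemigroup.

(** * Laplace transform of the semigroup *)

(** Quadratic error bounds are what [T_quad] provides; the restriction [|h| < t] keeps [t + h]
    positive. *)
Lemma is_derive_quad {R : realType} (phi : R -> R) (t d C : R) : 0 < t ->
  (forall h, `|h| < t -> `|phi (t + h) - phi t - h * d| <= C * h ^+ 2) ->
  is_derive t 1 phi d.
Proof.
move=> t0 qd.
have lim : h^-1 *: ((phi \o shift t) (h *: 1) - phi t) @[h --> 0^'] --> d.
  apply/cvgrPdistC_lt => e e0.
  have C1 : 0 < `|C| + 1 by rewrite ltr_wpDl.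
  near=> h.
  have hn0 : h != 0 by near: h; exact: nbhs_dnbhs_neq.
  have h1 : `|h| < t.
    near: h; apply: dnbhs0_lt; exact: t0.
  have h2 : `|h| < e / (`|C| + 1).
    near: h; apply: dnbhs0_lt; exact: divr_gt0.
  have hp : 0 < `|h| by rewrite normr_gt0.
  have -> : h^-1 *: ((phi \o shift t) (h *: 1) - phi t) - d =
      h^-1 * (phi (t + h) - phi t - h * d).
    rewrite /= /GRing.scale /= mulr1 (addrC h) [RHS]mulrBr mulrA mulVf//.
    by rewrite mul1r.
  rewrite normrM normfV mulrC ltr_pdivrMr//.
  apply: le_lt_trans (qd h h1) _.
  rewrite -(real_normK (num_real h)) expr2 mulrA ltr_pM2r//.
  move: h2; rewrite ltr_pdivlMr//; apply: le_lt_trans; rewrite mulrC.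
  by rewrite ler_wpM2l// (le_trans (ler_norm C))// lerDl.
apply: DeriveDef; first by apply/cvg_ex; exists d.
exact: cvg_lim lim.
Unshelve. all: by end_near. Qed.

Section Laplace.
Context {R : realType} {X : choiceType}.
Variable b : X -> X -> R.
Hypothesis gb : is_graph b.
Variable q : X -> R.
Hypothesis h0 : hform_ge0 b q.
Implicit Types (f g u v : X -> R) (x y : X) (l t s : R).

Local Notation A := (l2op b q).
Local Notation heat := (heat_op b q).

Let mA := l2op_m_accretive gb h0.

Lemma H1_resolvent_unique l f u u' : 0 < l ->
  H1 b q u (fun x => f x - l * u x) -> H1 b q u' (fun x => f x - l * u' x) ->
  u = u'.
Proof.
move=> l0 h1 h2; have li : 0 < l^-1 by rewrite invr_gt0.
(* The difference [w] of the two solutions satisfies [w + l^-1 H1 w = 0]. *)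
have := H1_accretive gb h0 li (H1_lin gb h0 (-1) h2 h1).
rewrite (_ : (fun x => _ + l^-1 * _) = fun=> 0); last first.
  by apply/funext => x; field; rewrite gt_eqF.
have [us _] := H1_ell2 gb h0 h1; have [us' _] := H1_ell2 gb h0 h2.
rewrite (_ : (fun x => -1 * u' x + u x) = u - u'); last first.
  by apply/funext => x; rewrite mulN1r addrC.
have n0 : ell2_norm (fun _ : X => 0 : R) = 0.
  rewrite /ell2_norm /ell2_dot.
  by under eq_fun do rewrite mul0r; rewrite rsum0 sqrtr0.
rewrite n0 => le0; apply/eqP; rewrite -subr_eq0; apply/eqP.
apply: ell2_dot_eq0; first exact: ell2B.
rewrite -ell2_normE; apply/eqP; rewrite sqrf_eq0 eq_le le0.
exact: ell2_norm_ge0.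
Qed.

Lemma resolventP l f : 0 < l -> ell2 f ->
  H1 b q (resolvent (H1 b q) (- l) f)
    (fun x => f x - l * resolvent (H1 b q) (- l) f x) /\
  ((forall x, 0 <= f x) -> forall x, 0 <= resolvent (H1 b q) (- l) f x).
Proof.
move=> l0 fs; have [u [Hu upos]] := H1_surj gb h0 l0 fs.
have Hr : H1 b q (resolvent (H1 b q) (- l) f)
    (fun x => f x - l * resolvent (H1 b q) (- l) f x).
  rewrite /resolvent; case: xgetP => [w _ [v Hw fE]|]; last first.
    move=> /(_ u); case; exists (fun x => f x - l * u x) => //.
    by apply/funext => x; ring.
  rewrite (_ : (fun x => _) = v)//; apply/funext => x; rewrite fE; ring.
by split=> //; rewrite (H1_resolvent_unique l0 Hr Hu).
Qed.

Lemma l2_eval_le (F : l2 R X) y : `|F y| <= `|F|.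
Proof. exact/ell2_eval/l2_ell2. Qed.

Lemma heat_ge0 t (F : l2 R X) : 0 <= t -> (forall x, 0 <= F x) ->
  forall x, 0 <= heat t F x.
Proof.
move=> t0 F0; apply: (T_invariant mA (P := fun G : l2 R X => forall x, 0 <= G x)) => //.
  move=> u L up ul x.
  have ulx : u n x @[n --> \oo] --> L x.
    apply/cvgr_epsP => e e0; have /cvgr_epsP /(_ e e0) [k kP] := ul.
    exists k => n /kP; apply: le_lt_trans.
    exact: (l2_eval_le (u n - L)).
  by apply: (cvgr_to_ge ulx); exists 0%N => // n _; exact: up.
move=> s G s0 G0 x; have si : 0 < s^-1 by rewrite invr_gt0.
have [u [Hu upos]] := H1_surj gb h0 si (ell2Z s^-1 (l2_ell2 G)).
have [us vs] := H1_ell2 gb h0 Hu.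
have [U UE] := to_l2 us; have [V VE] := to_l2 vs.
rewrite (@J_unique _ _ _ mA s G U V)//.
- by rewrite UE; apply: upos => z; rewrite mulr_ge0// ltW.
- by rewrite /l2op UE VE.
- apply: l2val_inj; rewrite l2_valD l2_valZ VE UE; apply/funext => z.
  by field; rewrite gt_eqF.
Qed.

Section Eval.
Variable y : X.

(** The absolute value extends the curve continuously to the whole line, so that two-sided
    continuity is available at 0. *)
Let curve (F : l2 R X) t := heat `|t| F y.

Let heat_lip (F G : l2 R X) s t : A F G -> 0 <= s -> 0 <= t ->
  `|heat s F - heat t F| <= `|s - t| * `|G|.
Proof.
move=> FG; wlog st : s t / s <= t => [hw s0 t0|s0 t0].
  have [st|/ltW ts] := leP s t; first exact: hw.
  by rewrite distrC (distrC s); exact: hw.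
have d0 : 0 <= t - s by rewrite subr_ge0.
rewrite distrC (distrC s) (ger0_norm d0).
have tE : t = s + (t - s) by rewrite addrC subrK.
rewrite {1}tE /heat_op T_add// -TB//.
apply: le_trans (T_contr mA _ s0) _; exact: T_dist.
Qed.

Let curve_continuous (F G : l2 R X) : A F G -> continuous (curve F).
Proof.
move=> FG t; apply/cvgrPdistC_lt => e e0.
have G1 : 0 < `|G| + 1 by rewrite ltr_wpDl.
near=> s.
apply: le_lt_trans (l2_eval_le (heat `|s| F - heat `|t| F) y) _.
apply: le_lt_trans (heat_lip FG (normr_ge0 _) (normr_ge0 _)) _.
have : `|s - t| < e / (`|G| + 1).
  by near: s; apply: cvgr_distC_lt; rewrite ?divr_gt0//; exact: cvg_id.
rewrite ltr_pdivlMr//; apply: le_lt_trans.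
by apply: ler_pM => //; [exact: ler_dist_dist|rewrite lerDl].
Unshelve. all: by end_near. Qed.

Let curve_derive (F G K : l2 R X) t : A F G -> A G K -> 0 < t ->
  is_derive t 1 (curve F) (- curve G t).
Proof.
move=> FG GK t0; apply: (@is_derive_quad _ _ _ _ (2 * `|K|)) => // h ht.
have th : 0 < t + h by have := ler_norm (- h); rewrite normrN; lra.
rewrite /curve (gtr0_norm th) (gtr0_norm t0) mulrN opprK.
have -> : heat (t + h) F y - heat t F y + h * heat t G y =
  (heat (t + h) F - heat t F + h *: heat t G) y by [].
apply: le_trans (l2_eval_le _ _) _.
have [hp|hn] := leP 0 h.
  rewrite /heat_op T_add ?(ltW t0)// -TZ ?(ltW t0)//.
  rewrite -[_ - _]opprB -TB ?(ltW t0)// addrC -TB ?(ltW t0)//.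
  apply: le_trans (T_contr mA _ (ltW t0)) _.
  rewrite distrC; apply: le_trans (T_quad mA hp FG GK) _.
  by rewrite mulrC -mulrA mulrCA ler_peMl ?mulr_ge0 ?sqr_ge0// ler1n.
(* For a backward step, [T t = T (t + h) T s] is factored. The derivative then sits at the other end
   of the interval; correcting this by [T_dist] adds a second [s^2 |K|], hence the constant
   [2 |K|]. *)
pose s := - h; have hs : h = - s by rewrite /s opprK.
have s0 : 0 <= s by rewrite oppr_ge0 ltW.
have tE (U : l2 R X) : T A t U = T A (t + h) (T A s U).
  by rewrite -(T_add mA U (ltW th) s0) /s addrK.
rewrite /heat_op (_ : h *: T A t G = - (s *: T A t G)); last first.
  by rewrite /s scaleNr opprK.
rewrite !tE -TZ ?(ltW th)// -!TB ?(ltW th)//.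
apply: le_trans (T_contr mA _ (ltW th)) _.
rewrite (_ : F - T A s F - s *: T A s G =
    (F - T A s F - s *: G) + s *: (G - T A s G)); last first.
  by rewrite scalerBr addrA subrK.
apply: le_trans (ler_normD _ _) _.
rewrite normrZ (ger0_norm s0) hs sqrrN.
have := T_quad mA s0 FG GK; have := T_dist mA s0 GK; rewrite distrC => h1 h2.
apply: le_trans (lerD h2 (ler_wpM2l s0 h1)) _.
by rewrite le_eqVlt; apply/orP; left; apply/eqP; ring.
Qed.

Let weighted_continuous (c : R) (F G : l2 R X) : A F G ->
  continuous (fun t => expR (- (c * t)) * curve F t).
Proof.
move=> FG t.
have H1 : continuous_at t (fun t => expR (- (c * t))).
  apply: continuous_comp; last exact: continuous_expR.
  by apply: cvgN; apply: cvgM; [exact: cvg_cst|exact: cvg_id].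
have h := curve_continuous FG.
have H2 : continuous_at t (curve F) by exact (h t).
exact: (continuousM H1 H2).
Qed.

(** With [G] the resolvent of [1_x] one has [1_x = l G + H1 G], so [- exp(- l t) (T t G)(y)] is an
    antiderivative of the integrand. It tends to 0 at infinity and equals [- G y] at 0. *)
Lemma laplace l x : 0 < l ->
  (\int[lebesgue_measure]_(t in `[0%R, +oo[)
     (expR (- (l * t)) * semigroup (H1 b q) t \1_[set x] y)%:E =
   (resolvent (H1 b q) (- l) \1_[set x] y)%:E)%E.
Proof.
move=> l0; have ds : ell2 (\1_[set x] : X -> R) by exact/Cc_ell2/Cc_delta.
have [Hg gpos] := resolventP l0 ds.
have [gs g1s] := H1_ell2 gb h0 Hg.
have [E0s E1s] := H1_ell2 gb h0 (H1_delta gb h0 x).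
have [D DE] := to_l2 ds; have [G GE] := to_l2 gs; have [E EE] := to_l2 E1s.
have AD : A D E by rewrite /l2op DE EE; exact: H1_delta.
(* [curve_derive] needs [G] in the domain of [A^2]: [A G = 1_x - l G] is a combination of [1_x] and
   [G], both in the domain. *)
pose G1 : l2 R X := - l *: G + D; pose G2 : l2 R X := - l *: G1 + E.
have G1E : l2val G1 = fun z => \1_[set x] z - l * resolvent (H1 b q) (- l) \1_[set x] z.
  by rewrite /G1 l2_valD l2_valZ DE GE; apply/funext => z; ring.
have AG : A G G1 by rewrite /l2op G1E GE.
have AG1 : A G1 G2 by case: mA => + _ _ _; apply.
pose f t := expR (- (l * t)) * curve D t.
pose F t := - (expR (- (l * t)) * curve G t).
have FD t : 0 < t -> is_derive t 1 F (f t).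
  move=> t0; have dG := curve_derive AG AG1 t0.
  have dl : is_derive t 1 (fun t => - (l * t)) (- l).
    apply: (@is_derive_quad _ _ _ _ 0) => // h _.
    have -> : - (l * (t + h)) - - (l * t) - h * - l = 0 by ring.
    by rewrite normr0 mul0r.
  have de : is_derive t 1 (fun t => expR (- (l * t))) (- l * expR (- (l * t))).
    have := @is_derive1_comp _ expR (fun t => - (l * t)) t _ _ (is_derive_expR _) dl.
    by rewrite mulrC.
  have H := is_deriveN (is_deriveM de dG).
  suff <- : - (expR (- (l * t)) *: (- curve G1 t) +
      curve G t *: (- l * expR (- (l * t)))) = f t by exact H.
  have TD : heat `|t| D = l *: heat `|t| G + heat `|t| G1.
    rewrite (_ : D = l *: G + G1); first exact: T_lin.
    by rewrite /G1 addrA scaleNr subrr add0r.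
  by rewrite /f /GRing.scale /= /curve TD l2_valD l2_valZ; ring.
have D0 z : 0 <= D z by rewrite DE deltaE.
transitivity (\int[lebesgue_measure]_(t in `[0%R, +oo[) (f t)%:E)%E.
  apply: eq_integral => t; rewrite inE /= in_itv /= andbT => t0.
  by rewrite -DE (semigroupE gb h0 D t0) /f /curve (ger0_norm t0).
rewrite (@ge0_continuous_FTC2y _ f F 0 0).
- by rewrite /F /curve normr0 mulr0 oppr0 expR0 mul1r /heat_op T0// GE EFinN sub0e oppeK.
- by move=> t t0; rewrite /f mulr_ge0 ?expR_ge0// heat_ge0.
- by apply: continuous_subspaceT; exact: weighted_continuous AD.
- rewrite -oppr0; apply: cvgN.
  apply: norm_cvg0.
  have lim : expR (- (l * t)) * `|G| @[t --> +oo] --> (0 : R).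
    rewrite -(mul0r `|G|); apply: cvgM; last exact: cvg_cst.
    apply: (cvg_comp (fun t => l * t) (fun t => expR (- t))); last exact: cvgr_expR.
    by apply: gt0_cvgMry => //; exact: cvg_id.
  apply: (squeeze_cvgr _ (cvg_cst 0) lim).
  near=> t; rewrite normr_ge0/= normrM (ger0_norm (expR_ge0 _)).
  rewrite ler_wpM2l ?expR_ge0//; apply: le_trans (l2_eval_le _ _) _.
  exact: T_contr.
- by move=> t t0; exact (@ex_derive _ _ _ _ _ _ _ (FD t t0)).
- rewrite /F; apply: cvgN; apply: cvg_at_right_filter.
  by have h := @weighted_continuous l _ _ AG; exact (h 0).
- move=> t; rewrite in_itv/= andbT => t0; rewrite derive1E.
  by rewrite (@derive_val _ _ _ _ _ _ _ (FD t t0)).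
Unshelve. all: by end_near. Qed.
Lemma semigroup_ge0 x t : 0 <= t -> 0 <= semigroup (H1 b q) t \1_[set x] y.
Proof.
move=> t0; have [D DE] := to_l2 (Cc_ell2 (@Cc_delta R X x)).
rewrite -DE (semigroupE gb h0 D t0); apply: heat_ge0 => // z.
by rewrite DE deltaE.
Qed.

Let weighted_measurable (c : R) x :
  measurable_fun (`[0%R, +oo[ : set R)
    (fun t => expR (- (c * t)) * semigroup (H1 b q) t \1_[set x] y).
Proof.
have [_ E1s] := H1_ell2 gb h0 (H1_delta gb h0 x).
have [D DE] := to_l2 (Cc_ell2 (@Cc_delta R X x)); have [E EE] := to_l2 E1s.
have AD : A D E by rewrite /l2op DE EE; exact: H1_delta.
apply: (@eq_measurable_fun _ _ _ _ _ (fun t => expR (- (c * t)) * curve D t)).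
  move=> t; rewrite inE /= in_itv /= andbT => t0.
  by rewrite -DE (semigroupE gb h0 D t0) /curve (ger0_norm t0).
apply: measurable_funTS; apply: continuous_measurable_fun.
exact: weighted_continuous AD.
Qed.

Let semigroup_measurable x :
  measurable_fun (`[0%R, +oo[ : set R)
    (fun t => semigroup (H1 b q) t \1_[set x] y).
Proof.
have := weighted_measurable 0 x; apply: eq_measurable_fun => t _.
by rewrite mul0r oppr0 expR0 mul1r.
Qed.

(** Read off the Laplace transform: the semigroup is nonnegative, so the integrand decreases in
    [l]. *)
Lemma resolvent_le l l' x : 0 < l -> l <= l' ->
  resolvent (H1 b q) (- l') \1_[set x] y <= resolvent (H1 b q) (- l) \1_[set x] y.
Proof.
move=> l0 ll'; have l'0 := lt_le_trans l0 ll'.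
rewrite -lee_fin -!laplace//; apply: ge0_le_integral => //.
- move=> t; rewrite /= in_itv /= andbT => t0.
  by rewrite lee_fin mulr_ge0 ?expR_ge0// semigroup_ge0.
- by apply/measurable_EFinP; exact: weighted_measurable.
- by apply/measurable_EFinP; exact: weighted_measurable.
- move=> t; rewrite /= in_itv /= andbT => t0.
  by rewrite lee_fin ler_wpM2r ?semigroup_ge0// ler_expR lerN2 ler_wpM2r.
Qed.

Lemma resolvent_le_integral l x : 0 < l ->
  ((resolvent (H1 b q) (- l) \1_[set x] y)%:E <=
   \int[lebesgue_measure]_(t in `[0%R, +oo[)
     (semigroup (H1 b q) t \1_[set x] y)%:E)%E.
Proof.
move=> l0; rewrite -laplace//; apply: ge0_le_integral => //.
- move=> t; rewrite /= in_itv /= andbT => t0.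
  by rewrite lee_fin mulr_ge0 ?expR_ge0// semigroup_ge0.
- by apply/measurable_EFinP; exact: weighted_measurable.
- by apply/measurable_EFinP; exact: semigroup_measurable.
- move=> t; rewrite /= in_itv /= andbT => t0.
  rewrite lee_fin ler_piMl ?semigroup_ge0// -expR0 ler_expR oppr_le0.
  by rewrite mulr_ge0// ltW.
Qed.

Lemma integral_semigroup_le (M : R) x :
  (forall l, 0 < l -> resolvent (H1 b q) (- l) \1_[set x] y <= M) ->
  (\int[lebesgue_measure]_(t in `[0%R, +oo[)
     (semigroup (H1 b q) t \1_[set x] y)%:E <= M%:E)%E.
Proof.
move=> hM.
pose g' (n : nat) t :=
  (expR (- (n.+1%:R^-1 * t)) * semigroup (H1 b q) t \1_[set x] y)%:E.
have g'0 n t : `[0, +oo[%classic t -> (0 <= g' n t)%E.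
  rewrite /= in_itv /= andbT => t0.
  by rewrite lee_fin mulr_ge0 ?expR_ge0// semigroup_ge0.
have nd t : `[0, +oo[%classic t -> nondecreasing_seq (g'^~ t).
  rewrite /= in_itv /= andbT => t0 m n mn.
  rewrite lee_fin ler_wpM2r ?semigroup_ge0// ler_expR lerN2 ler_wpM2r//.
  by rewrite lef_pV2 ?posrE// ler_nat.
have mg n : measurable_fun (`[0%R, +oo[ : set R) (g' n).
  by apply/measurable_EFinP; exact: weighted_measurable.
have := @cvg_monotone_convergence _ _ R lebesgue_measure `[0%R, +oo[%classic
  (measurable_itv _) g' mg g'0 nd.
rewrite [X in _ --> X](_ : _ =
  (\int[lebesgue_measure]_(t in `[0%R, +oo[)
     (semigroup (H1 b q) t \1_[set x] y)%:E)%E); last first.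
  apply: eq_integral => t _; apply: cvg_lim => //.
  apply: cvg_EFin; first by apply: nearW.
  rewrite -[X in _ --> X]mul1r; apply: cvgM; last exact: cvg_cst.
  rewrite -[X in _ --> X](@expR0 R); apply: continuous_cvg.
    exact: continuous_expR.
  rewrite -[X in _ --> X]oppr0 -[X in _ --> - X](mul0r t); apply: cvgN.
  by apply: cvgM; [exact: cvg_harmonic|exact: cvg_cst].
move=> lim; apply: (cvge_le _ lim); exists 0%N => // n _.
by rewrite laplace// lee_fin hM.
Qed.

End Eval.
End Laplace.

(** * Equivalent forms of subcriticality *)

Section Equivalences.
Context {R : realType} {X : choiceType}.
Variable b : X -> X -> R.
Hypothesis gb : is_graph b.
Hypothesis cb : connected_graph b.
Variable q : X -> R.
Hypothesis h0 : hform_ge0 b q.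
Implicit Types (f g u v : X -> R) (x y o : X) (l t s : R).

Local Notation bd := (bounded_evals b q).
Local Notation gr l x y := (resolvent (H1 b q) (- l) \1_[set x] y).

Let ds x : ell2 (\1_[set x] : X -> R).
Proof. exact/Cc_ell2/Cc_delta. Qed.

Lemma Hop_delta_positive r u x : (forall y, 0 <= u y) -> Hop b r u = \1_[set x] ->
  Fspace b u -> positive u.
Proof.
move=> u0 Hu Fu; split=> //; apply: contrapT => ne.
have uE : u = fun=> 0.
  by apply/funext => y; apply: contrapT => /eqP uy; apply: ne; exists y.
have := hB0r gb r (\1_[set x] : X -> R).
rewrite hB_delta -uE Hu deltaE eqxx => /eqP.
by rewrite oner_eq0.
Qed.

(** The last clause is the reproducing property: the resolvent kernel represents evaluation at [x]
    in the form domain of [q + l]. *)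
Lemma green_facts l x : 0 < l ->
  [/\ Fspace b (fun y => gr l x y), forall y, 0 < gr l x y,
      forall y, 0 <= Hop b (q + cst l) (fun y => gr l x y) y,
      dom b (q + cst l) (fun y => gr l x y) &
      forall v, dom b (q + cst l) v ->
        bform b (q + cst l) (fun y => gr l x y) v = v x].
Proof.
move=> l0; have [Hg gpos] := resolventP gb h0 l0 (ds x).
have g0 y : 0 <= gr l x y by apply: gpos => z; rewrite deltaE.
have [Fg Hgr] := H1_Hop gb h0 Hg.
have HE : Hop b (q + cst l) (fun y => gr l x y) = \1_[set x].
  apply/funext => y; rewrite Hop_shift.
  by rewrite -[X in Hop b q X y]/(resolvent (H1 b q) (- l) \1_[set x]) Hgr subrK.
have H0 y : 0 <= Hop b (q + cst l) (fun y => gr l x y) y by rewrite HE deltaE.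
have hl := hl0 gb h0 l0.
have := Hg => /(H1P gb h0 _ _ l0) [dg _ bE].
split=> //.
  apply: superharmonic_gt0 hl _ _ _ => //.
  exact: Hop_delta_positive HE _.
move=> v dv; rewrite bE//.
have vs := dom_ell2 gb h0 l0 dv; have gs := dom_ell2 gb h0 l0 dg.
rewrite (_ : (fun y => \1_[set x] y - l * gr l x y) =
  (fun y => - l * gr l x y + \1_[set x] y)); last first.
  by apply/funext => y; ring.
by rewrite ell2_dot_linl// ell2_dot_delta; ring.
Qed.

(** The energy of the kernel is its own value at [x], so [gr l x z ^+ 2 <= C_z * gr l x x]. The case
    [z = x] gives [gr l x x <= C_x]; for [y], [a^2 <= c] is weakened to [a <= c + 1]. *)
Lemma bounded_green x y : bd -> exists M : R, forall l, 0 < l -> gr l x y <= M.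
Proof.
move=> bq; have [Cx Cx0 CxP] := bq x; have [Cy Cy0 CyP] := bq y.
exists (Cy * Cx + 1) => l l0; have [Fg gpos _ dg bE] := green_facts x l0.
have hl := hl0 gb h0 l0; have hb := bounded_evals_cst gb h0 l0.
have up z (C : R) : 0 <= C -> (forall phi, Cc phi -> phi z ^+ 2 <= C * hform b q phi) ->
    gr l x z ^+ 2 <= C * gr l x x.
  move=> C0 CP; rewrite -[X in C * X](bE _ dg) bform_diag//.
  apply: (dom_eval gb hl hb _ dg) => phi c; apply: le_trans (CP phi c) _.
  rewrite ler_wpM2l// hform_shift_cst// lerDl mulr_ge0 ?ell2_dot_ge0//.
  exact: ltW.
have gx : gr l x x <= Cx.
  have := up x Cx Cx0 CxP; rewrite expr2 ler_pM2r//.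
have gy := le_trans (up y Cy Cy0 CyP) (ler_wpM2l Cy0 gx).
have := mulr_ge0 Cy0 Cx0; have := gpos y; move: gy.
move: (gr l x y) (Cy * Cx) => a c; nra.
Qed.

(** Harnack moves the bound from [y] to [x]; the reproducing property and Cauchy-Schwarz then give
    [phi(x)^2 <= K M (h(phi) + l |phi|^2)], and [l] is sent to 0. *)
Lemma green_bounded x y (M : R) :
  (forall l, 0 < l -> l <= 1 -> gr l x y <= M) -> bd.
Proof.
move=> gM; have h1 : hform_ge0 b (q + cst 1) by exact: hl0.
have [K K0 KP] := harnack gb cb y x h1.
have gx l : 0 < l -> l <= 1 -> gr l x x <= K * M.
  move=> l0 l1; have [Fg gpos H0 _ _] := green_facts x l0.
  apply: le_trans (KP _ Fg (fun z => ltW (gpos z)) _) _.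
    (* A nonnegative superharmonic function for [q + l] with [l <= 1] is one for [q + 1], so the
       constant [K] serves all these [l]. *)
    move=> z; have := H0 z; rewrite !Hop_shift /= => /le_trans; apply.
    by rewrite lerD2l ler_wpM2r// ltW.
  by rewrite ler_wpM2l// gM.
apply: (bounded_evals1 gb cb h0 (o := x) (C := K * M)) => phi c.
have key l : 0 < l -> l <= 1 ->
    phi x ^+ 2 <= K * M * (hform b q phi + l * ell2_dot phi phi).
  move=> l0 l1; have [_ gpos _ dg bE] := green_facts x l0.
  have hl := hl0 gb h0 l0; have hb := bounded_evals_cst gb h0 l0.
  have dphi := Cc_dom gb (q + cst l) c.
  rewrite -(bE _ dphi); apply: le_trans (bform_CS gb hl hb dg dphi) _.
  rewrite -[qbar _ _ (fun _ => _)]bform_diag// bE// qbar_Cc// hform_shift_cst//.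
  rewrite ler_wpM2r ?gx// addr_ge0 ?h0// mulr_ge0 ?ell2_dot_ge0//.
  exact: ltW.
apply/ler_addgt0Pr => e e0.
set a := K * M in key *; set n := ell2_dot phi phi in key *.
have an : 0 < `|a * n| + 1 by rewrite ltr_wpDl.
have l0 : 0 < Num.min 1 (e / (`|a * n| + 1)) by rewrite lt_min ltr01 divr_gt0.
have := key _ l0; rewrite ge_min lexx => /(_ isT) /le_trans; apply.
rewrite mulrDr lerD2l mulrCA; apply: le_trans (ler_wpM2l (ltW l0) (ler_norm _)) _.
apply: (@le_trans _ _ (e / (`|a * n| + 1) * `|a * n|)).
  by rewrite ler_wpM2r// ge_min lexx orbT.
by rewrite -mulrA ler_piMr ?(ltW e0)// mulrC ler_pdivrMr// mul1r lerDl.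
Qed.

Lemma green_resolventP x y : bd <->
  exists2 g : R, 0 < g & resolvent (H1 b q) l \1_[set x] y @[l --> 0^'-] --> g.
Proof.
split=> [bq|[g g0 lim]].
  have [M MP] := bounded_green x y bq.
  have inc (l l' : R) : l' < 0 -> l <= l' ->
      resolvent (H1 b q) l \1_[set x] y <= resolvent (H1 b q) l' \1_[set x] y.
    move=> l'0 ll'; rewrite -[l]opprK -[l']opprK; apply: resolvent_le => //.
      by rewrite oppr_gt0.
    by rewrite lerN2.
  have cv : cvg (resolvent (H1 b q) l \1_[set x] y @[l --> 0^'-]).
    apply: nondecreasing_at_left_is_cvgr.
      near=> a => l l'; rewrite !in_itv/= => _ /andP[_ l'0]; exact: inc.
    near=> a; exists M => _ /= [l + <-]; rewrite in_itv/= => /andP[_ l0].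
    by rewrite -[l]opprK; apply: MP; rewrite oppr_gt0.
  exists (lim (resolvent (H1 b q) l \1_[set x] y @[l --> 0^'-])) => //.
  have [_ gpos _ _ _] := green_facts x (@ltr01 R).
  apply: lt_le_trans (gpos y) _; apply: limr_ge => //.
  near=> l; apply: inc.
    by near: l; exact: nbhs_left_lt.
  by near: l; apply: nbhs_left_ge; rewrite oppr_lt0.
apply: (@green_bounded x y g) => l l0 _.
apply: (cvgr_to_ge lim); near=> s.
have s0 : s < 0 by near: s; exact: nbhs_left_lt.
have sl : - l <= s by near: s; apply: nbhs_left_ge; rewrite oppr_lt0.
rewrite -[s]opprK; apply: resolvent_le => //; first by rewrite oppr_gt0.
by rewrite -[l]opprK lerN2.
Unshelve. all: by end_near. Qed.

Lemma green_semigroupP x y : bd <->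
  let G : \bar R := (\int[lebesgue_measure]_(t in `[0%R, +oo[)
         (semigroup (H1 b q) t \1_[set x] y)%:E)%E in
  (0 < G)%E /\ (G < +oo)%E.
Proof.
split=> [bq /=|[_ fin]].
  have [M MP] := bounded_green x y bq; split.
    apply: lt_le_trans (resolvent_le_integral gb h0 y x (@ltr01 R)).
    by have [_ gpos _ _ _] := green_facts x (@ltr01 R); rewrite lte_fin.
  exact: le_lt_trans (integral_semigroup_le gb h0 MP) (ltry _).
move: fin; set G := (\int[_]_(_ in _) _)%E => fin.
have G0 : (0 <= G)%E.
  apply: le_trans (resolvent_le_integral gb h0 y x (@ltr01 R)).
  by have [_ gpos _ _ _] := green_facts x (@ltr01 R); rewrite lee_fin ltW.
apply: (@green_bounded x y (fine G)) => l l0 _.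
rewrite -lee_fin fineK; first exact: resolvent_le_integral.
by rewrite ge0_fin_numE.
Qed.

Lemma green_function : bd -> forall x, exists u,
  [/\ positive u, H_superharmonic b q u & Hop b q u = \1_[set x]].
Proof.
move=> bq x; have [C C0 CP] := bq x.
have [||u [du uP upos]] := @riesz R X b gb q h0 bq (fun phi => phi x) C.
- by [].
- exact: CP.
have u0 := upos (fun phi _ p0 => p0 x).
have HE : Hop b q u = \1_[set x].
  apply/funext => y; rewrite -hB_delta uP; last exact: Cc_delta.
  by rewrite !deltaE eq_sym.
have Fu := dom_Fspace gb h0 bq du.
exists u; split=> //; first exact: Hop_delta_positive HE Fu.
by split=> // y; rewrite HE deltaE.
Qed.

Lemma Hop_sum n (c : 'I_n -> R) (u : 'I_n -> X -> R) :
  (forall i, Fspace b (u i)) ->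
  Fspace b (fun x => \sum_(i < n) c i * u i x) /\
  forall x, Hop b q (fun x => \sum_(i < n) c i * u i x) x =
    \sum_(i < n) c i * Hop b q (u i) x.
Proof.
move=> Fu; elim: n => [|n IH] in c u Fu *.
  have E : (fun x => \sum_(i < 0) c i * u i x) = fun=> 0.
    by apply/funext => x; rewrite big_ord0.
  rewrite E; split=> [|x]; first exact/Cc_Fspace/Cc0.
  by rewrite big_ord0 -(hB_delta b q x) hB0r.
have E : (fun x => \sum_(i < n.+1) c i * u i x) =
    (fun x => c ord0 * u ord0 x + \sum_(i < n) c (lift ord0 i) * u (lift ord0 i) x).
  by apply/funext => x; rewrite big_ord_recl.
have [|Fs Hs] := IH (fun i => c (lift ord0 i)) (fun i => u (lift ord0 i)).
  by move=> i; exact: Fu.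
rewrite E; split=> [|x]; first exact: Fspace_lin.
by rewrite Hop_lin// Hs big_ord_recl.
Qed.

(** [H] maps a linear combination of Green functions to the same combination of distinct point
    masses, from which the coefficients are read off. *)
Lemma green_functions_independent : infinite_set [set: X] ->
  (forall x, exists u,
    [/\ positive u, H_superharmonic b q u & Hop b q u = \1_[set x]]) ->
  exists u : nat -> X -> R, lin_indep_seq u /\
    (forall n, positive (u n) /\ H_superharmonic b q (u n)).
Proof.
move=> inf ex; have [e einj] : exists e : nat -> X, injective e.
  have /card_leP[f] := (infiniteP _).1 inf.
  exists (fun n => \val (f (to_setT n))) => m n /val_inj fmn.
  have := @inj _ _ _ f (to_setT m) (to_setT n) (mem_set I) (mem_set I) fmn.
  by move=> /(congr1 \val).
have [G GP] := choice ex.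
exists (fun n => G (e n)); split=> [n c c0 j|n]; last by have [] := GP (e n).
have [|_ HS] := @Hop_sum n c (fun i => G (e i)).
  by move=> i; have [_ []] := GP (e i).
have := HS (e j).
rewrite (_ : (fun x => _) = fun=> 0); last by apply/funext => x; exact: c0.
rewrite -hB_delta hB0r// (bigD1 j)//= big1 ?addr0.
  have [_ _ ->] := GP (e j); rewrite deltaE eqxx mulr1 => ->//.
move=> i ij; have [_ _ ->] := GP (e i); rewrite deltaE.
case: eqP => [eij|_]; last by rewrite mulr0.
have /val_inj ji : (j : nat) = i by exact: einj.
by rewrite ji eqxx in ij.
Qed.

(** In the critical case [u 0] and [u 1], normalised at [o], are the limit of the same null
    sequence: a nontrivial linear relation. *)
Lemma independent_bounded o :
  (exists u : nat -> X -> R, lin_indep_seq u /\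
    (forall n, positive (u n) /\ H_superharmonic b q (u n))) -> bd.
Proof.
move=> [u [li uP]]; apply: contrapT => nb.
have [phi phiP] := not_bounded_evals gb cb h0 o nb.
have up n z : 0 < u n z.
  by have [p [F H]] := uP n; exact: superharmonic_gt0 h0 p F H z.
have lim n x : phi k x @[k --> \oo] --> u n x / u n o.
  have [_ [F H]] := uP n.
  exact: (null_seq_ratio gb cb (up n) F H phiP).
have E x : u 0%N x / u 0%N o = u 1%N x / u 1%N o.
  exact: cvg_unique (lim 0%N x) (lim 1%N x).
pose c (i : 'I_2) : R := if i == ord0 then (u 0%N o)^-1 else - (u 1%N o)^-1.
have := li 2%N c; rewrite /c => /(_ _ ord0); rewrite eqxx => h.
have : (u 0%N o)^-1 = 0.
  apply: h => x; rewrite big_ord_recl big_ord_recl big_ord0 /= addr0.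
  by rewrite mulNr ![_^-1 * _]mulrC E subrr.
by apply/eqP; rewrite invr_eq0 gt_eqF.
Qed.

(** Pointwise convergence at [o] makes the extra term [phi(o)^2] Cauchy by itself. *)
Lemma Dho_approxP o f (phi : nat -> X -> R) :
  Dho_approx b q o f phi <-> approx b q f phi.
Proof.
have sq (c : forall n, Cc (phi n)) m n :
    honorm b q o (phi m - phi n) ^+ 2 =
    hform b q (phi m - phi n) + (phi m o - phi n o) ^+ 2.
  by rewrite sqr_sqrtr// addr_ge0 ?sqr_ge0// h0//; exact: CcB.
split=> -[c ca cp]; split=> // e e0.
  (* A norm below 1 dominates its own square, hence [hform]. *)
  have [|k kP] := ca (Num.min 1 e); first by rewrite lt_min ltr01.
  exists k => m n km kn; have := kP m n km kn; rewrite lt_min => /andP[n1 ne].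
  have n0 : 0 <= honorm b q o (phi m - phi n) by exact: sqrtr_ge0.
  apply: le_lt_trans ne; apply: (@le_trans _ _ (honorm b q o (phi m - phi n) ^+ 2)).
    by rewrite sq// lerDl sqr_ge0.
  by rewrite expr2 ler_piMl// ltW.
have e2 : 0 < e ^+ 2 / 2 by rewrite divr_gt0// exprn_gt0.
have [k1 kP1] := ca _ e2.
have /cvgr_epsP /(_ (e / 4)) [|k2 kP2] := cp o; first by rewrite divr_gt0.
exists (maxn k1 k2) => m n; rewrite !geq_max => /andP[m1 m2] /andP[n1 n2].
rewrite -(@ltr_pXn2r _ 2)// ?nnegrE ?sqrtr_ge0 ?(ltW e0)// sq//.
have := kP1 m n m1 n1.
have hd : `|phi m o - phi n o| <= e / 2.
  rewrite -(subrKA (f o)); apply: le_trans (ler_normD _ _) _.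
  by have := kP2 m m2; have := kP2 n n2; rewrite (distrC (f o)); lra.
have : (phi m o - phi n o) ^+ 2 <= (e / 2) ^+ 2.
  by rewrite -real_normK ?num_real// lerXn2r ?nnegrE// divr_ge0// ltW.
rewrite expr_div_n; have : 0 < e ^+ 2 by rewrite exprn_gt0.
lra.
Qed.

(** [D_{h,o}] is thereby the completion for the potential [q + 1_o], where evaluations are bounded
    in every case. *)
Lemma approx_deltaP o f (phi : nat -> X -> R) :
  approx b q f phi <-> approx b (q + \1_[set o]) f phi.
Proof.
split=> -[c ca cp]; split=> // e e0.
  have [k1 kP1] := ca (e / 2) (divr_gt0 e0 (ltr0n _ 2)).
  pose d : R := Num.min 1 (e / 2).
  have d0 : 0 < d by rewrite lt_min ltr01 divr_gt0.
  have /cvgr_epsP /(_ (d / 2)) [|k2 kP2] := cp o; first by rewrite divr_gt0.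
  exists (maxn k1 k2) => m n; rewrite !geq_max => /andP[m1 m2] /andP[n1 n2].
  rewrite hform_shift_delta//; last exact: CcB.
  have hd : `|phi m o - phi n o| < d.
    rewrite -(subrKA (f o)); apply: le_lt_trans (ler_normD _ _) _.
    by have := kP2 m m2; have := kP2 n n2; rewrite (distrC (f o)); lra.
  have : (phi m o - phi n o) ^+ 2 <= d.
    rewrite -real_normK ?num_real// expr2; apply: le_trans (ltW hd).
    by rewrite ler_piMr// (le_trans (ltW hd))// ge_min lexx.
  have : d <= e / 2 by rewrite ge_min lexx orbT.
  by rewrite !fctE; have := kP1 m n m1 n1; lra.
have [k kP] := ca e e0; exists k => m n km kn; apply: le_lt_trans (kP m n km kn).
by rewrite hform_shift_delta ?lerDl ?sqr_ge0//; exact: CcB.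
Qed.

Lemma DhoE o : Dho b q o = dom b q.
Proof. by apply/seteqP; split=> f [phi /Dho_approxP fa]; exists phi => //; exact/Dho_approxP. Qed.

Lemma hbarE o : hbar b q o = qbar b q.
Proof.
apply/funext => f; rewrite /hbar /qbar; congr xget.
by apply/seteqP; split=> l [phi /Dho_approxP fa lP]; exists phi => //; exact/Dho_approxP.
Qed.

Let hd0 o : hform_ge0 b (q + \1_[set o]).
Proof. by apply: hform_ge0_shift => // x; rewrite deltaE. Qed.

(** Here [q] may lack bounded evaluations, so uniqueness of the limit is taken from [q + 1_o] and
    the term [phi(o)^2] subtracted. *)
Lemma hbar_Cc o phi : Cc phi -> hbar b q o phi = hform b q phi.
Proof.
move=> c; rewrite hbarE /qbar; have hb := bounded_evals_delta gb cb h0 o.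
have a0 : approx b q phi (fun=> phi) by exact: approx_cst.
case: xgetP => [l _ [psi pa pl]|]; last first.
  by move=> /(_ (hform b q phi)); case; exists (fun=> phi) => //; exact: cvg_cst.
have [cpsi _ cp] := pa; move: pa => /(approx_deltaP o) pa.
have := qbar_lim gb (hd0 o) hb pa; rewrite qbar_Cc// hform_shift_delta//.
have E n : hform b (q + \1_[set o]) (psi n) = hform b q (psi n) + psi n o ^+ 2.
  exact: hform_shift_delta.
under eq_cvg do rewrite E; move=> lim.
have lim2 : hform b q (psi n) + psi n o ^+ 2 @[n --> \oo] --> l + phi o ^+ 2.
  apply: cvgD; first exact: pl.
  under eq_cvg do rewrite expr2; rewrite expr2.
  by apply: cvgM; exact: cp.
have : l + phi o ^+ 2 = hform b q phi + phi o ^+ 2.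
  exact: cvg_unique lim2 lim.
by move=> /addIr.
Qed.

Let equiv o := equivalent_norms (Dho b q o) (fun f => Num.sqrt (hbar b q o f))
      (hbar_norm b q o).

Lemma norms_equivalentP o : bd <-> equiv o.
Proof.
split=> [bq|[c [C [c0 _ eqn]]]].
  have [C C0 CP] := bq o; have C1 : 0 < C + 1 by rewrite ltr_wpDl.
  exists (Num.sqrt (C + 1))^-1, 1; split=> //; first by rewrite invr_gt0 sqrtr_gt0.
  rewrite DhoE /hbar_norm hbarE => f df.
  have f0 := qbar_ge0 gb h0 bq df; have fo := dom_eval gb h0 bq CP df.
  split; last by rewrite mul1r ler_wsqrtr// lerDl sqr_ge0.
  rewrite mulrC ler_pdivrMr ?sqrtr_gt0// -sqrtrM// ler_wsqrtr//.
  by move: fo; lra.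
apply: (bounded_evals1 gb cb h0 (o := o) (C := (c ^+ 2)^-1)) => phi cphi.
have [|le _] := eqn phi; first by rewrite DhoE; exact: Cc_dom.
rewrite mulrC ler_pdivlMr ?exprn_gt0// mulrC.
move: le; rewrite /hbar_norm hbar_Cc// -{1}(gtr0_norm c0) -sqrtr_sqr -sqrtrM ?sqr_ge0//.
rewrite ler_sqrt ?h0//; apply: le_trans.
by rewrite ler_wpM2l ?sqr_ge0// lerDr h0.
Qed.

Lemma Dho_hilbert o : bd -> is_hilbert (Dho b q o) (polar (hbar b q o)).
Proof.
move=> bq; rewrite DhoE hbarE -/(bform b q).
have B f : polar (qbar b q) f f = bform b q f f by [].
split.
- split; first exact: dom0.
  by move=> a f g; exact: dom_lin.
- by move=> a f g u df dg du; exact: bform_linl.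
- by move=> f g df dg; exact: bformC.
- move=> f df; rewrite B bform_diag//; split; first exact: qbar_ge0.
  exact: qbar_eq0.
- move=> u du uc.
  have uc' : cauchy_for (fun f => Num.sqrt (qbar b q f)) u.
    move=> e e0; have [k kP] := uc e e0; exists k => m n km kn.
    by have := kP m n km kn; rewrite B bform_diag//; exact: domB.
  have [f df lim] := dom_complete gb h0 bq du uc'.
  exists f => //; have E n : polar (qbar b q) (u n - f) (u n - f) = qbar b q (u n - f).
    by rewrite B bform_diag//; exact: domB.
  by under eq_cvg do rewrite E.
Qed.

Lemma no_harmonicP o : bd <->
  ~ (exists u : X -> R, [/\ positive u, H_harmonic b q u & Dho b q o u]).
Proof.
split=> [bq [u [[_ [x ux]] [Fu Hu] Du]]|nu].
  rewrite DhoE in Du; have [phi ua] := Du; have [c _ _] := ua.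
  (* A harmonic [u] is orthogonal to [C_c(X)], which is dense, hence to itself. *)
  have E n : bform b q u (phi n) = 0.
    rewrite bform_Cc// /hB (_ : (fun x => _) = fun=> 0) ?rsum0//.
    by apply/funext => z; rewrite Hu mulr0.
  have := bform_cvg gb h0 bq Du ua; under eq_cvg do rewrite E.
  move=> lim; have : bform b q u u = 0 by exact: cvg_unique lim (cvg_cst 0).
  rewrite bform_diag// => /(qbar_eq0 gb h0 bq Du) u0.
  by move: ux; rewrite u0 eqxx.
apply: contrapT => nb; apply: nu.
have [phi phiP] := not_bounded_evals gb cb h0 o nb.
have c n : Cc (phi n) by have [] := phiP n.
have hb := bounded_evals_delta gb cb h0 o.
have ca : cauchy_for (hform b (q + \1_[set o])) phi.
  move=> e e0; have [k kP] := harmonic_small (divr_gt0 e0 (ltr0n _ 4)).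
  exists k => m n km kn; rewrite hform_shift_delta//; last exact: CcB.
  have [_ _ om hm] := phiP m; have [_ _ on hn] := phiP n.
  rewrite !fctE om on subrr expr0n addr0.
  (* By the parallelogram law [h(phi_m - phi_n) <= 2 h(phi_m) + 2 h(phi_n)], and the term at [o]
     vanishes because both values there are 1. *)
  have p0 : 0 <= hform b q (phi m + phi n) by apply/h0/CcD.
  move: p0; rewrite (Q_add gb)// (Q_sub gb)//.
  have arith (a a' i i' B r : R) : a <= i -> a' <= i' -> i < r / 4 -> i' < r / 4 ->
    0 <= a + 2 * B + a' -> a - 2 * B + a' < r by lra.
  exact: arith hm hn (kP m km) (kP n kn).
have [u ua] := cauchy_approx hb c ca.
have [_ _ cu] := ua.
have uo : u o = 1.
  have E n : phi n o = 1 by have [] := phiP n.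
  have h : phi n o @[n --> \oo] --> (1 : R).
    by under eq_cvg do rewrite E; exact: cvg_cst.
  exact: cvg_unique (cu o) h.
have u0 x : 0 <= u x.
  by apply: (cvgr_to_ge (cu x)); exists 0%N => // n _; have [_ + _ _] := phiP n.
have Fu : Fspace b u by apply: dom_Fspace (hd0 o) hb _ _ => //; exists phi.
exists u; split; last by rewrite DhoE; exists phi; exact/(approx_deltaP o).
  by split=> //; exists o; rewrite uo oner_eq0.
split=> // x.
have lim : Hop b (q + \1_[set o]) (phi n) x @[n --> \oo] -->
    Hop b (q + \1_[set o]) u x by exact: (approx_Hop gb (hd0 o) hb ua).
have lim0 : Hop b q (phi n) x @[n --> \oo] --> Hop b q u x.
  have E n : Hop b q (phi n) x =
      Hop b (q + \1_[set o]) (phi n) x - \1_[set o] x * phi n x.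
    by rewrite Hop_shift addrK.
  rewrite (_ : Hop b q u x = Hop b (q + \1_[set o]) u x - \1_[set o] x * u x).
    under eq_cvg do rewrite E; apply: cvgB => //.
    by apply: cvgM; [exact: cvg_cst|exact: cu].
  by rewrite Hop_shift addrK.
(* Cauchy-Schwarz against the point mass at [x] gives [(H phi_n)(x)^2 <= (deg x + q x) h(phi_n)], so
   [H phi_n] tends to 0 pointwise. *)
have d0 := potential_ge0 gb h0 x; set d := deg b x + q x in d0.
have limd : Num.sqrt (d * n.+1%:R^-1) @[n --> \oo] --> Num.sqrt (d * 0).
  apply: continuous_cvg; first exact: sqrt_continuous.
  by apply: cvgM; [exact: cvg_cst|exact: cvg_harmonic].
rewrite mulr0 sqrtr0 in limd.
suff lim1 : Hop b q (phi n) x @[n --> \oo] --> (0 : R).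
  exact: cvg_unique lim0 lim1.
apply: norm_cvg0; apply: (squeeze_cvgr _ (cvg_cst 0) limd).
exists 0%N => // n _ /=; rewrite normr_ge0/= -sqrtr_sqr ler_wsqrtr//.
have := hB_CS gb h0 (@Cc_delta R X x) (c n); rewrite hB_delta hform_delta//.
move=> /le_trans; apply; rewrite ler_wpM2l//.
by have [] := phiP n.
Qed.

End Equivalences.


Theorem theorem5p12 (R : realType) (X : choiceType)
    (b : X -> X -> R) (q : X -> R) (o : X) :
  infinite_set [set: X] ->
  is_graph b -> connected_graph b -> hform_ge0 b q ->
  let green_resolvent (x y : X) : Prop :=
    exists2 g : R, 0 < g &
      resolvent (H1 b q) l \1_[set x] y @[l --> 0^'-] --> g in
  let green_semigroup (x y : X) : Prop :=
    let G : \bar R :=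
      (\int[lebesgue_measure]_(t in `[0%R, +oo[)
         (semigroup (H1 b q) t \1_[set x] y)%:E)%E in
    (0 < G)%E /\ (G < +oo)%E in
  let norms_equivalent : Prop :=
    equivalent_norms (Dho b q o) (fun f => Num.sqrt (hbar b q o f))
      (hbar_norm b q o) in
  [<-> (* (i) *)
       subcritical b q;
       (* (ii), for some and for all *)
       exists x y : X, green_resolvent x y;
       forall x y : X, green_resolvent x y;
       (* (ii'), for some and for all *)
       exists x y : X, green_semigroup x y;
       forall x y : X, green_semigroup x y;
       (* (iii) *)
       forall x : X, exists u : X -> R,
         [/\ positive u, H_superharmonic b q u & Hop b q u = \1_[set x]];
       (* (iii') *)
       exists u : nat -> X -> R,
         lin_indep_seq u /\
         (forall n, positive (u n) /\ H_superharmonic b q (u n));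
       (* (iv) *)
       norms_equivalent;
       (* (iv') *)
       ~ (exists u : X -> R,
            [/\ positive u, H_harmonic b q u & Dho b q o u]);
       (* (v) *)
       forall x : X, 0 < capacity b q x]
  /\ (norms_equivalent -> is_hilbert (Dho b q o) (polar (hbar b q o))).
Proof.
move=> inf gb cb h0 green_resolvent green_semigroup norms_equivalent.
pose bd := bounded_evals b q.
have i_iff : bd <-> subcritical b q.
  have [h1 h2] := subcriticalP gb cb h0.
  by split=> [bq|/h1[]//]; apply: h2; split=> //; exists o.
have ii_iff x y : bd <-> green_resolvent x y by exact: green_resolventP.
have ii'_iff x y : bd <-> green_semigroup x y by exact: green_semigroupP.
have iv_iff : bd <-> norms_equivalent by exact: norms_equivalentP.
have iv'_iff := no_harmonicP gb cb h0 o.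
have v_iff := capacityP gb h0.
split; last by move=> /iv_iff; exact: Dho_hilbert.
(* Boundedness of evaluations implies (iii), (iii) implies (iii'), and (iii') gives boundedness
   back; each other condition has been shown equivalent to it. *)
tfae.
- by move=> /i_iff bq; exists o, o; exact/ii_iff.
- by move=> [x [y /ii_iff bq]] z w; exact/ii_iff.
- by move=> /(_ o o) /ii_iff bq; exists o, o; exact/ii'_iff.
- by move=> [x [y /ii'_iff bq]] z w; exact/ii'_iff.
- by move=> /(_ o o) /ii'_iff; exact: green_function.
- exact: green_functions_independent.
- by move=> /(independent_bounded gb cb h0 o) bq; exact/iv_iff.
- by move=> /iv_iff bq; exact/iv'_iff.
- by move=> /iv'_iff bq; exact/v_iff.
- by move=> /v_iff bq; exact/i_iff.
Qed.
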